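(* Let $f(z)=\sum_{n\ge 0}\phi_n z^n$ be a formal power series with complex coefficients, fix integers $m\ge m^*\ge 1$, and for each $n\ge m$ fix one incomplete Padé approximant $r_{n,m}=p_{n,m}/q_{n,m}$ of type $(n,m,m^* )$ of $f$, with the associated constants $A_{n,m}$, polynomials $q^*_{n,m-m^*}$, radius $R_m^*(f)$ and disk $D_m^*(f)=\{z:|z|<R_m^*(f)\}$ (all defined in the context). Assume that $0<R_m^*(f)<+\infty$. Let $\mathcal{P}_{n,m}(f)$ be the set of zeros of $q_{n,m}$ and let $\mathcal{Z}_n(f)$ be the set of zeros of $q^*_{n,m-m^*}$. Let $\Lambda$ be any infinite set of indices satisfying property iv) of a regularizing sequence of $(A_{n,m})_{n\ge m}$ (see the context). For a point $\zeta\in\mathbb{C}$ consider the condition $$(\ast)\qquad \lim_{n\to\infty,\ n\in\Lambda}\operatorname{dist}(\zeta,\mathcal{Z}_n(f))=0 .$$ Suppose that $\zeta\in\mathbb{C}$ satisfies $\lim_{n\to\infty}\operatorname{dist}(\zeta,\mathcal{P}_{n,m}(f))=0$. Then: (1) If $|\zeta|>R_m^*(f)$, then $(\ast)$ holds. (2) If $|\zeta|<R_m^*(f)$, then either $(\ast)$ holds or $\zeta$ is a pole of $f$ of order greater than or equal to $\lambda(\zeta)$, where $\lambda(\zeta)$ is the number of points of $\mathcal{P}_{n,m}(f)$ which tend to $\zeta$ (see the context). (3) If there is a polynomial $q_m$ with $\deg q_m=m$, $q_m(0)\ne 0$, such that $\lim_{n\to\infty}q_{n,m}=q_m$, and if $|\zeta|=R_m^*(f)$,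 then either $(\ast)$ holds or $\zeta$ is a singular point of $f$. Moreover: (4) If there is a polynomial $q_m$ with $\deg q_m=m$, $q_m(0)\neq 0$, such that $\lim_{n\to\infty}q_{n,m}=q_m$, and the zeros of $q_m$ are distinct, then at least $m^*$ of the zeros of $q_m$ are singular points of $f$ lying in the closure of $D_m^*(f)$, and those of them lying in $D_m^*(f)$ are simple poles of $f$.
   Context: **Incomplete Padé approximants.** Let $f(z)=\sum_{n\ge0}\phi_nz^n$ be a formal power series and let $n\ge m\ge m^*\ge1$. An incomplete Padé approximant of type $(n,m,m^* )$ of $f$ is a rational function $r_{n,m}$ which is the quotient $p/q$ of any two polynomials $p,q$ such that - $\deg p\le n-m^*$, $\deg q\le m$, $q\not\equiv0$; - $q(z)f(z)-p(z)=Az^{n+1}+\cdots$, i.e. the formal power series $qf-p$ has vanishing coefficients at $z^0,\dots,z^n$. Such $p,q$ always exist but $r_{n,m}$ need not be unique; for each $n\ge m$ one choice of $(p,q)$ is fixed. Let $\lambda_n$, $0\le\lambda_n\le m$, be the order of the common zero of $p$ and $q$ at $z=0$ ($\lambda_n=0$ if there is none). After cancelling all common factors of $p$ and $q$ one writes $r_{n,m}=p_{n,m}/q_{n,m}$, with $q_{n,m}$ normalized as $$q_{n,m}(z)=\prod_{|\zeta_{n,k}|\le1}(z-\zeta_{n,k})\prod_{|\zeta_{n,k}|>1}\Bigl(1-\frac{z}{\zeta_{n,k}}\Bigr),$$ where $\zeta_{n,1},\dots,\zeta_{n,m_n}$ are the zeros of $q_{n,m}$, counted with multiplicity (an empty product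 is $1$). **The constants $A_{n,m}$ and polynomials $q^*_{n,m-m^*}$.** It follows from the definition that for each $n\ge m$ $$r_{n+1,m}(z)-r_{n,m}(z)=\frac{A_{n,m}\,z^{\,n+1-\lambda_n-\lambda_{n+1}}\,q^*_{n,m-m^*}(z)}{q_{n,m}(z)\,q_{n+1,m}(z)},$$ where $A_{n,m}\in\mathbb{C}$ is a constant and $q^*_{n,m-m^*}$ is a polynomial of degree at most $m-m^*$, normalized in the same way as $q_{n,m}$ (a product over its zeros of factors $z-\eta$ for zeros $|\eta|\le1$ and $1-z/\eta$ for zeros $|\eta|>1$). **Radius and disk.** $R_m^*(f)=\bigl(\limsup_{n\to\infty}|A_{n,m}|^{1/n}\bigr)^{-1}$ and $D_m^*(f)=\{z\in\mathbb{C}:|z|<R_m^*(f)\}$. It is a known fact that if $R_m^*(f)>0$, then $f$ converges in a neighborhood of the origin and extends to a meromorphic function in $D_m^*(f)$ with at most $m$ poles counting multiplicities; $f$ also denotes this extension. A point $\zeta$ in the closure of $D_m^*(f)$ is called a singular point of $f$ if $f$ (as a meromorphic function in $D_m^*(f)$) does not extend analytically to a neighborhood of $\zeta$; for $\zeta\in D_m^*(f)$ this means that $\zeta$ is a pole of $f$. Otherwise $\zeta$ is a regular point. **Regularizing sequence.** Let $R=R_m^*(f)\in(0,\infty)$ and $B_n=A_{n,m}R^n$, so that $\limsup_n|B_n|^{1/n}=1$. It is known that there exists a sequence of positive numbers $(B_n^* )_{n\ge m}$ (a regularizing sequence) such that - i) $\lim_{n\to\infty}B_n^*/B_{n+1}^*=1$;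 - ii) the sequence $\{\log(B_n^*/n!)\}$ is concave; - iii) $|B_n|\le B_n^*$ for all $n$; - iv) there are a constant $c>0$ and an infinite set of indices $\Lambda$ such that $|B_n|\ge c\,B_n^*$ for all $n\in\Lambda$. The set $\Lambda$ in the theorem is any infinite set as in iv). **Distance and the number $\lambda(\zeta)$.** $\operatorname{dist}(\zeta,B)$ is the distance from the point $\zeta$ to the set $B$ (equal to $+\infty$ if $B=\emptyset$). Given $\zeta\in\mathbb{C}$, enumerate the zeros of $q_{n,m}$ so that $|\zeta_{n,1}-\zeta|\le\cdots\le|\zeta_{n,m_n}-\zeta|$. One says that $\lambda=\lambda(\zeta)$ points of $\mathcal{P}_{n,m}(f)$ tend to $\zeta$ if $$\lim_{n\to\infty}|\zeta_{n,\lambda}-\zeta|=0,\qquad \limsup_{n\to\infty}|\zeta_{n,\lambda+1}-\zeta|>0,$$ with the convention that $\limsup_{n\to\infty}|\zeta_{n,\kappa}-\zeta|>0$ whenever $\kappa>\liminf_{n\to\infty}m_n$. **Convergence of polynomials.** $\lim_n q_{n,m}=q_m$ means coefficientwise convergence. *)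

(* Defs.v *)
From HB Require Import structures.
From mathcomp Require Import all_boot all_order all_algebra.
From mathcomp Require Import all_classical all_reals all_analysis.
From mathcomp Require Import complex.
Set Implicit Arguments.
Unset Strict Implicit.
Unset Printing Implicit Defensive.
Import Order.TTheory GRing.Theory Num.Theory.
Import numFieldNormedType.Exports.
Local Open Scope classical_set_scope.
Local Open Scope ring_scope.
Local Open Scope complex_scope.

(* The usual topology and norm of [R[i]], which the library puts on the alias
   [R[i]^o] only. *)
HB.instance Definition _ (R : rcfType) :=
  PseudoPointedMetric.copy R[i] (R[i])^o.
HB.instance Definition _ (R : rcfType) := GRing.ComAlgebra.copy R[i] (R[i])^o.
HB.instance Definition _ (R : rcfType) := Vector.copy R[i] (R[i])^o.
HB.instance Definition _ (R : rcfType) := NormedModule.copy R[i] (R[i])^o.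

(* The modulus with values in [R]; [`|z|] lives in [R[i]]. *)
Definition cmod (R : rcfType) (z : R[i]) : R := ComplexField.Normc.normc z.

Section FunctionTheory.
Variable R : realType.
Local Notation C := R[i].
Implicit Types (phi : nat -> C) (F g : C -> C) (z zeta : C) (rho : R).

Definition disk rho : set C := [set z | cmod z < rho].

Definition analytic_at g z0 : Prop :=
  exists a : nat -> C, \forall z \near z0,
    series (fun n => a n * (z - z0) ^+ n) @ \oo --> g z.

(* Meromorphic functions are total functions [C -> C]; their values at the
   isolated points where they fail to be analytic are irrelevant. *)
Definition meromorphic_at F z0 : Prop :=
  exists (k : nat) (g : C -> C), analytic_at g z0 /\
    \forall z \near z0^', F z = g z / (z - z0) ^+ k.

Definition pole_of_order F z0 (k : nat) : Prop :=
  (0 < k)%N /\ exists g : C -> C, [/\ analytic_at g z0, g z0 != 0 &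
    \forall z \near z0^', F z = g z / (z - z0) ^+ k].

Definition meromorphic_extension phi (D : set C) F : Prop :=
  (\forall z \near (0 : C), series (fun n => phi n * z ^+ n) @ \oo --> F z) /\
  (forall z, D z -> meromorphic_at F z).

Definition regular_point F (D : set C) zeta : Prop :=
  exists g : C -> C, analytic_at g zeta /\
    \forall z \near zeta, D z -> analytic_at F z -> F z = g z.

Definition singular_point F (D : set C) zeta : Prop :=
  closure D zeta /\ ~ regular_point F D zeta.

Definition cdist zeta (B : set C) : \bar R :=
  ereal_inf [set (cmod (zeta - z))%:E | z in B].

End FunctionTheory.

Section IncompletePade.
Variable R : realType.
Local Notation C := R[i].
Implicit Types (phi A : nat -> C) (p q P Q : {poly C}) (zeta : C).
Implicit Types (n m ms k : nat).

(* The zeros of a nonzero polynomial, with multiplicity. *)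
Definition zeros p : seq C := sval (closed_field_poly_normal p).

Definition zero_set p : set C := [set z | root p z].

Definition normalized p : Prop :=
  p = \prod_(z <- zeros p) (if cmod z <= 1 then 'X - z%:P else 1 - z^-1 *: 'X).

Definition incomplete_pade phi n m ms P Q : Prop :=
  [/\ (size P <= (n - ms).+1)%N, (size Q <= m.+1)%N, Q != 0 &
      forall k, (k <= n)%N -> \sum_(i < k.+1) Q`_i * phi (k - i)%N = P`_k].

Definition reduced_fraction P Q p q : Prop :=
  [/\ coprimep p q, P * q = p * Q & normalized q].

Definition common_zero_order P Q : nat := mup 0 (gcdp P Q).

(* The exponent of [z] may be negative, hence an integer power and [z != 0]. *)
Definition difference_formula (p q p' q' : {poly C}) (l l' n : nat)
    (a : C) (qs : {poly C}) : Prop :=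
  forall z : C, z != 0 -> q.[z] != 0 -> q'.[z] != 0 ->
    p'.[z] / q'.[z] - p.[z] / q.[z] =
    a * z ^ (n.+1%:Z - l%:Z - l'%:Z) * qs.[z] / (q.[z] * q'.[z]).

Definition Rstar A : \bar R :=
  ((limn_esup (fun n => (cmod (A n) `^ n%:R^-1)%:E))^-1)%E.

Definition regularizing_sequence m (B : nat -> C) (Bs : nat -> R)
    (c : R) (Lambda : set nat) : Prop :=
  [/\ [/\ forall n, (m <= n)%N -> 0 < Bs n,
      Bs n / Bs n.+1 @[n --> \oo] --> (1 : R),
      (let u n := ln (Bs n / n`!%:R) in
       forall n, (m <= n)%N -> u n + u n.+2 <= 2 * u n.+1) &
      forall n, (m <= n)%N -> cmod (B n) <= Bs n],
      0 < c, infinite_set Lambda &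
      forall n, Lambda n -> (m <= n)%N /\ c * Bs n <= cmod (B n)].

(* [zero_dist q zeta k], for [k >= 1], is the distance from [zeta] to the
   [k]-th closest zero of [q], and [+oo] if [q] has fewer than [k] zeros; the
   default value makes the limsup positive when [k > liminf m_n]. *)
Definition zero_dist q zeta k : \bar R :=
  nth +oo%E [seq d%:E | d <- sort <=%R [seq cmod (w - zeta) | w <- zeros q]]
      k.-1.

Definition zeros_tending_to (q : nat -> {poly C}) zeta (l : nat) : Prop :=
  ((0 < l)%N -> zero_dist (q n) zeta l @[n --> \oo] --> 0%E) /\
  (0 < limn_esup (fun n => zero_dist (q n) zeta l.+1))%E.

Definition poly_cvg (q : nat -> {poly C}) (qm : {poly C}) : Prop :=
  forall k, (q n)`_k @[n --> \oo] --> qm`_k.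

End IncompletePade.

(* Main.v *)
(** Write [a n] for [B_n^* / rho^n], so that [|A_n| <= a n], with equality up to
    a constant factor for [n] in [Lambda], and consider the identity
      [p_{n+1} q_n - p_n q_{n+1} = A_n z^(n + 1 - lam_n - lam_{n+1}) qs_n]
    near a point [zeta] to which zeros of [q_n] tend.  If its left-hand side is
    small compared with [a n * |z|^n], then [qs_n] is small, hence has zeros
    tending to [zeta], for [n] in [Lambda].

    For [|zeta| > rho] this holds because [|p_n| <= C a_n |z|^n], by summing the
    telescoping series on circles that avoid the zeros of all the [q_k].
    For [|zeta| < rho] let [w] be a limit point of [q_n], divided by its common
    zeros with [W = w f].  The remainders [q_n W - w p_n] are [O(a_n |z|^n)], so
    that either the left-hand side is small or [w] vanishes at [zeta] to the
    order [lambda(zeta)]; in the latter case [f = W / w] has a pole.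

    For [|zeta| = rho] let [g] continue [f] analytically to a neighbourhood of
    [zeta].  The remainders [F_n = q_n g - p_n] there obey a recursion that
    contracts upwards in [n] for [|z| < a_n / a_{n+1}] and downwards for
    [|z| > a_n / a_{n+1}], and on the critical circle they are controlled by the
    mean value property with a polynomial multiplier that is small in the
    tangential directions.  Concavity of [log (a_n / n!)] keeps the critical
    radii under control, and a bootstrap from the a priori bound
    [|F_n| <= e^(o(n)) a_n |z|^n] yields [|F_n zeta| <= C a_n rho^n].

    Finally, the regular zeros of [q_m] attract different zeros of [qs_n], of
    which there are at most [m - ms]. *)

Require Import Defs.
From mathcomp Require Import all_boot all_order all_algebra.
From mathcomp Require Import all_classical all_reals all_analysis.
From mathcomp Require Import complex.
From mathcomp Require Import ring lra zify.
From mathcomp Require cyclic separable cyclotomic.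
Import Order.TTheory GRing.Theory Num.Theory.
Import numFieldNormedType.Exports.
Local Open Scope classical_set_scope.
Local Open Scope ring_scope.
Local Open Scope complex_scope.

Set Implicit Arguments.
Unset Strict Implicit.
Unset Printing Implicit Defensive.

(** The scales of the bootstrap come from one balance. If [|x|] differs from the critical radius by
    a relative amount [b], then [j] steps of the recursion gain [exp(- b j)], while the drift of
    that radius, as far as concavity permits it, costs [exp(2 j^2 / n)]; so about [b n] steps are
    useful and they gain [exp(- const b^2 n)]. A bound [exp(v^2 n)] is therefore wiped out off a
    band of relative width comparable to [v], and inside the band averaging over circles of radius
    comparable to [v] lowers it to [exp((19 v / 20)^2 n)]. This can go on until [v^2 n] is of order
    [log n], which leaves a factor [n^2]. It disappears in a last average over a fixed circle around
    [zeta]: there [n^2 exp(- const b^2 n)] is at most a multiple of [b^(-4)], which the fourth power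
    of a multiplier vanishing on the critical circle absorbs. The recursion divides by [q_n], so it
    is available only on an annulus around [zeta]; the value at [zeta] is reached by averaging
    alone. Averages are taken over roots of unity and for polynomials; other functions enter as
    uniform limits of polynomials. *)

Lemma eq_ler (R : numDomainType) (x y : R) : x = y -> x <= y.
Proof. by move=> ->. Qed.

(** * The real modulus and Cauchy's estimate for polynomials *)

Section Modulus.
Variable R : realType.
Local Notation C := R[i].
Implicit Types (x y z : C) (p q : {poly C}) (r : R).

Lemma cmod_norm z : `|z| = (cmod z)%:C :> C.
Proof. by []. Qed.

Lemma cmod0 : cmod (0 : C) = 0.
Proof. exact: ComplexField.Normc.normc0. Qed.

Lemma cmod1 : cmod (1 : C) = 1.
Proof. exact: ComplexField.Normc.normc1. Qed.

Lemma cmodM x y : cmod (x * y) = cmod x * cmod y.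
Proof. exact: ComplexField.Normc.normcM. Qed.

Lemma cmodV x : cmod x^-1 = (cmod x)^-1.
Proof. exact: ComplexField.Normc.normcV. Qed.

Lemma cmodN x : cmod (- x) = cmod x.
Proof. exact: normcN. Qed.

Lemma cmodD x y : cmod (x + y) <= cmod x + cmod y.
Proof. exact: le_normcD. Qed.

Lemma cmodB x y : cmod (x - y) <= cmod x + cmod y.
Proof. by rewrite (le_trans (cmodD _ _))// cmodN. Qed.

Lemma cmodBC x y : cmod (x - y) = cmod (y - x).
Proof. by rewrite -cmodN opprB. Qed.

Lemma cmod_ge0 x : 0 <= cmod x.
Proof. by case: x => a b; rewrite /cmod /= sqrtr_ge0. Qed.
Hint Resolve cmod_ge0 : core.

Lemma cmod_eq0 x : (cmod x == 0) = (x == 0).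
Proof.
apply/eqP/eqP => [|->]; last exact: cmod0.
exact: ComplexField.Normc.eq0_normc.
Qed.

Lemma cmod_gt0 x : (0 < cmod x) = (x != 0).
Proof. by rewrite lt_neqAle cmod_ge0 andbT eq_sym cmod_eq0. Qed.

Lemma cmodX x n : cmod (x ^+ n) = cmod x ^+ n.
Proof. by elim: n => [|n ih]; rewrite ?cmod1// !exprS cmodM ih. Qed.

Lemma cmod_real r : 0 <= r -> cmod r%:C = r.
Proof. by move=> r0; rewrite /cmod /= expr0n addr0 sqrtr_sqr ger0_norm. Qed.

Lemma cmod_nat n : cmod (n%:R : C) = n%:R.
Proof. by rewrite -[RHS]cmod_real ?ler0n// rmorph_nat. Qed.

Lemma cmod_dist x y : cmod x - cmod y <= cmod (x - y).
Proof. by rewrite lerBlDr -{1}(subrK y x) cmodD. Qed.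

Lemma cmod_dist_norm x y : `|cmod x - cmod y| <= cmod (x - y).
Proof.
rewrite ler_norml cmod_dist andbT lerNl opprB cmodBC; exact: cmod_dist.
Qed.

Lemma cmod_tri x y z : cmod (x - z) <= cmod (x - y) + cmod (y - z).
Proof. by rewrite (_ : x - z = (x - y) + (y - z)) ?cmodD//; ring. Qed.

Lemma cmod_sum (I : Type) (s : seq I) (P : pred I) (F : I -> C) :
  cmod (\sum_(i <- s | P i) F i) <= \sum_(i <- s | P i) cmod (F i).
Proof.
elim/big_rec2: _ => [|i a b _ h]; first by rewrite cmod0.
by rewrite (le_trans (cmodD _ _))// lerD2l.
Qed.

Lemma cmod_prod (I : Type) (s : seq I) (P : pred I) (F : I -> C) :
  cmod (\prod_(i <- s | P i) F i) = \prod_(i <- s | P i) cmod (F i).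
Proof. exact: (big_morph _ cmodM cmod1). Qed.

Lemma cmod_Re x : `|complex.Re x| <= cmod x.
Proof.
case: x => a b /=; rewrite /cmod /= -sqrtr_sqr ler_wsqrtr//.
by rewrite lerDl sqr_ge0.
Qed.

Lemma cmod_Im x : `|complex.Im x| <= cmod x.
Proof.
case: x => a b /=; rewrite /cmod /= -sqrtr_sqr ler_wsqrtr//.
by rewrite lerDr sqr_ge0.
Qed.

Lemma cmod_le_ReIm x : cmod x <= `|complex.Re x| + `|complex.Im x|.
Proof.
have E : x = (complex.Re x +i* 0) + (0 +i* complex.Im x).
  by case: x => a b; apply/eqP; rewrite eq_complex /= addr0 add0r !eqxx.
rewrite {1}E (le_trans (cmodD _ _))// /cmod /= !expr0n !(addr0, add0r).
by rewrite !sqrtr_sqr.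
Qed.

Lemma sqr_cmod x : cmod x ^+ 2 = complex.Re x ^+ 2 + complex.Im x ^+ 2.
Proof. by case: x => a b; rewrite /cmod /= sqr_sqrtr// addr_ge0// sqr_ge0. Qed.

Lemma sqr_cmod_conj x : ((cmod x ^+ 2)%:C : C) = x * x^*.
Proof.
case: x => a b; rewrite sqr_cmod /=.
by apply/eqP; rewrite eq_complex /=; apply/andP; split; apply/eqP; ring.
Qed.

Lemma cmod_conj x : cmod x^* = cmod x.
Proof. by case: x => a b; rewrite /cmod /= sqrrN. Qed.

Lemma cmod_horner p z :
  cmod p.[z] <= \sum_(i < size p) cmod p`_i * cmod z ^+ i.
Proof.
rewrite horner_coef (le_trans (cmod_sum _ _ _))// le_eqVlt; apply/orP; left.
by apply/eqP; apply: eq_bigr => i _; rewrite cmodM cmodX.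
Qed.

(* Multiplying the N-th roots of unity by [r] gives the sample points of the
   discrete Cauchy formula. *)
Lemma exists_prim_root n : (0 < n)%N -> exists w : C, n.-primitive_root w.
Proof.
move=> n0; have [s /= sE] := closed_field_poly_normal ('X^n - 1 : {poly C}).
have lc1 : lead_coef ('X^n - 1 : {poly C}) = 1 by apply/monicP/monicXnsubC.
move: sE; rewrite lc1 scale1r => sE.
have sz : size s = n.
  by have := size_XnsubC (1 : C) n0; rewrite sE size_prod_XsubC => -[].
have [|w _ wP] := @hasP _ (n.-primitive_root) s _; last by exists w.
apply: cyclic.has_prim_root => //; last by rewrite sz.
- apply/allP => x xs; rewrite unity_rootE -subr_eq0.
  have /eqP := congr1 (horner^~ x) sE; rewrite !hornerE => /eqP ->.
  by rewrite -/(root _ _) root_prod_XsubC.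
- rewrite -separable.separable_prod_XsubC -sE.
  by apply: cyclotomic.separable_Xn_sub_1; rewrite pnatr_eq0 -lt0n.
Qed.

Lemma sum_unity_root n (w : C) l : w ^+ n = 1 -> w ^+ l != 1 ->
  \sum_(k < n) (w ^+ l) ^+ k = 0.
Proof.
move=> wn wl; apply: (mulfI (x := w ^+ l - 1)); first by rewrite subr_eq0.
by rewrite mulr0 -subrX1 -exprM mulnC exprM wn expr1n subrr.
Qed.

(** Averaging over the [n]-th roots of unity kills every monomial but the [i]-th; the exponent
    [n - i] stands for [- i]. Since [p] has at most [n] coefficients, no two of them are confused
    modulo [n]. *)
Lemma discrete_cauchy p n (w c : C) i : n.-primitive_root w ->
    (size p <= n)%N -> (i < n)%N ->
  n%:R * (p`_i * c ^+ i) =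
  \sum_(k < n) p.[c * w ^+ k] * (w ^+ (n - i)) ^+ k.
Proof.
move=> wP sp lin; have n0 := prim_order_gt0 wP.
under eq_bigr => k _ do rewrite (horner_coef_wide _ sp) mulr_suml.
rewrite exchange_big /= (bigD1 (Ordinal lin))//= [X in _ = _ + X]big1 => [|j].
  rewrite addr0 (eq_bigr (fun=> p`_i * c ^+ i)) => [|k _].
    by rewrite sumr_const card_ord mulr_natl.
  have E : (w ^+ k) ^+ i * (w ^+ (n - i)) ^+ k = 1.
    rewrite -!exprM -exprD [(k * i)%N]mulnC -mulnDl subnKC ?(ltnW lin)//.
    by rewrite exprM (prim_expr_order wP) expr1n.
  by rewrite /= exprMn -!mulrA E mulr1.
move=> ji; rewrite (eq_bigr (fun k : 'I_n => p`_j * c ^+ j * (w ^+ (j + (n - i))) ^+ k)).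
  rewrite -mulr_sumr sum_unity_root ?mulr0// ?(prim_expr_order wP)//.
  rewrite -(expr0 w) (eq_prim_root_expr wP) mod0n addnBA ?(ltnW lin)//.
  have jn := ltn_ord j; apply: contraNneq ji; rewrite -val_eqE /= => /eqP.
  rewrite -/(dvdn n (j + n - i)) => h.
  have /dvdnP[[|[|k]] hk] := h; apply/eqP; nia.
move=> k _; rewrite exprMn -!mulrA; congr (_ * (_ * _)).
by rewrite -!exprM -exprD mulnDl mulnC.
Qed.

(** The coefficient is an average of [n] values of [p] at points of modulus [r], twisted by
    unimodular factors. This replaces the Cauchy integral throughout. *)
Lemma cauchy_coef p r M i : 0 <= r ->
  (forall z, cmod z = r -> cmod p.[z] <= M) -> cmod p`_i * r ^+ i <= M.
Proof.
move=> r0 hM; pose n := maxn (size p) i.+1.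
have n0 : (0 < n)%N by rewrite /n leq_max orbT.
have [w wP] := exists_prim_root n0.
have w1 : cmod w = 1.
  apply: (pexpIrn n0); rewrite ?nnegrE ?cmod_ge0//.
  by rewrite -cmodX (prim_expr_order wP) cmod1 expr1n.
have := congr1 (@cmod R) (discrete_cauchy r%:C wP (leq_maxl _ _) (leq_maxr _ _)).
rewrite cmodM cmod_nat cmodM cmodX cmod_real// => E.
rewrite -(ler_pM2l (x := n%:R)) ?ltr0n// E (le_trans (cmod_sum _ _ _))//.
rewrite mulr_natl -[X in _ *+ X](card_ord n) -sumr_const.
apply: ler_sum => k _; rewrite cmodM !cmodX w1 !expr1n mulr1.
by apply: hM; rewrite cmodM cmod_real// cmodX w1 expr1n mulr1.
Qed.

Lemma mean_value_poly p z0 r M : 0 <= r ->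
  (forall z, cmod (z - z0) = r -> cmod p.[z] <= M) -> cmod p.[z0] <= M.
Proof.
move=> r0 hM; have := @cauchy_coef (p \Po ('X + z0%:P)) r M 0 r0.
rewrite expr0 mulr1 -horner_coef0 horner_comp !hornerE; apply => z zr.
by rewrite horner_comp !hornerE; apply: hM; rewrite addrK.
Qed.
End Modulus.
#[global] Hint Extern 0 (is_true (@Order.le _ _ (@GRing.zero _) (@cmod _ _))) =>
  solve [apply: cmod_ge0] : core.

Ltac pos := lazymatch goal with
  | |- is_true (@Order.le _ _ _ (@GRing.mul _ _ _)) => apply: mulr_ge0; pos
  | |- is_true (@Order.le _ _ _ (@GRing.inv _ _)) => rewrite invr_ge0; pos
  | |- is_true (@Order.le _ _ _ (@GRing.exp _ _ _)) => apply: exprn_ge0; pos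
  | |- is_true (@Order.le _ _ _ (@GRing.add _ _ _)) =>
      first [done | lra | apply: addr_ge0; pos]
  | |- is_true (@Order.le _ _ _ _) => first [done | by apply: ltW | lra]
  | |- is_true (@Order.lt _ _ _ (@GRing.mul _ _ _)) => apply: mulr_gt0; pos
  | |- is_true (@Order.lt _ _ _ (@GRing.inv _ _)) => rewrite invr_gt0; pos
  | |- is_true (@Order.lt _ _ _ (@GRing.exp _ _ _)) => apply: exprn_gt0; pos
  | |- is_true (@Order.lt _ _ _ (@GRing.add _ _ _)) =>
      first [done | lra | apply: addr_gt0; pos | apply: ltr_wpDl; pos
            | apply: ltr_pwDl; pos]
  | |- is_true (@Order.lt _ _ _ _) => first [done | rewrite ltr0n; done | lra]
  end.

(* [lia] diverges on contexts with let-bound real numbers. *)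
Ltac nlia :=
  repeat match goal with
  | H : is_true (leq _ _) |- _ => revert H
  | H : is_true (andb (leq _ _) (leq _ _)) |- _ => revert H
  | H : @eq nat _ _ |- _ => revert H
  end;
  repeat match goal with
  | |- context [@size ?T ?x] => generalize (@size T x); intro
  end; clear; lia.

(** * Power series with an explicit bound on the coefficients *)

Section PowerSeries.
Variable R : realType.
Local Notation C := R[i].
Implicit Types (x y z : C) (p q : {poly C}) (r t e M : R) (c : nat -> C).

(** Convergence with a real tolerance, so that estimates take place in the totally ordered field [R]
    and not in [R[i]]. *)
Definition ccvg (u : nat -> C) (l : C) :=
  forall e, 0 < e -> exists N, forall n, (N <= n)%N -> cmod (u n - l) < e.

Lemma ltC0P (e : C) : 0 < e -> exists2 r, 0 < r & e = r%:C.
Proof.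
case: e => a b; rewrite ltcE /= => /andP[/eqP b0 a0].
by exists a => //; rewrite b0.
Qed.

Lemma cvg_ccvg (u : nat -> C) (l : C) : u n @[n --> \oo] --> l <-> ccvg u l.
Proof.
split=> [/cvgrPdist_lt h e e0|h].
  have [|N _ hN] := h e%:C; first by rewrite ltcR.
  by exists N => n /hN /=; rewrite cmod_norm ltcR cmodBC.
apply/cvgrPdist_lt => _ /ltC0P[e e0 ->]; have [N hN] := h e e0.
by exists N => // n /= /hN; rewrite cmod_norm ltcR cmodBC.
Qed.

Lemma nearCP z0 (P : set C) : (\forall z \near z0, P z) <->
  exists2 r, 0 < r & forall z, cmod (z - z0) < r -> P z.
Proof.
split=> [/nbhs_normP[_ /ltC0P[r r0 ->] h]|[r r0 h]].
  exists r => // z zr; apply: h; rewrite /ball_ /= cmod_norm ltcR.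
  by rewrite cmodBC.
apply/nbhs_normP; exists r%:C => /=; first by rewrite ltcR.
by move=> z; rewrite /ball_ /= cmod_norm ltcR cmodBC; exact: h.
Qed.

Lemma dnearCP z0 (P : set C) : (\forall z \near z0^', P z) <->
  exists2 r, 0 < r & forall z, z != z0 -> cmod (z - z0) < r -> P z.
Proof.
rewrite /dnbhs /within; split=> [/nearCP[r r0 h]|[r r0 h]].
  by exists r => // z zz0 zr; exact: h.
by apply/nearCP; exists r => // z zr zz0; apply: h.
Qed.

Lemma ccvg_unique (u : nat -> C) (l l' : C) : ccvg u l -> ccvg u l' -> l = l'.
Proof.
by move=> /cvg_ccvg h /cvg_ccvg h'; exact: (cvg_unique _ h h').
Qed.

Lemma real_cauchy (v : nat -> R) :
  (forall e, 0 < e -> exists N, forall n, (N <= n)%N -> `|v n - v N| < e) ->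
  exists l, forall e, 0 < e ->
    exists N, forall n, (N <= n)%N -> `|v n - l| < e.
Proof.
move=> h; have /cauchy_cvgP : cauchy (v @ \oo).
  apply: cauchy_exP => e e0; have [N hN] := h e e0; exists (v N).
  by exists N => // n /= Nn; rewrite /ball /= distrC; exact: hN.
move=> vl; exists (lim (v @ \oo)) => e e0.
move/cvgrPdist_lt : vl => /(_ e e0)[N _ hN].
by exists N => n Nn; rewrite distrC; exact: hN.
Qed.

Lemma ccvg_cauchy (u : nat -> C) :
  (forall e, 0 < e -> exists N, forall n, (N <= n)%N -> cmod (u n - u N) < e) ->
  exists l, ccvg u l.
Proof.
move=> h.
have [a ha] : exists l, forall e, 0 < e ->
    exists N, forall n, (N <= n)%N -> `|complex.Re (u n) - l| < e.
  apply: real_cauchy => e e0; have [N hN] := h e e0; exists N => n /hN.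
  by apply: le_lt_trans; rewrite -(raddfB (@complex.Re R)) cmod_Re.
have [b hb] : exists l, forall e, 0 < e ->
    exists N, forall n, (N <= n)%N -> `|complex.Im (u n) - l| < e.
  apply: real_cauchy => e e0; have [N hN] := h e e0; exists N => n /hN.
  by apply: le_lt_trans; rewrite -(raddfB (@complex.Im R)) cmod_Im.
exists (a +i* b) => e e0; have e20 : 0 < e / 2 by rewrite divr_gt0.
have [N hN] := ha _ e20; have [N' hN'] := hb _ e20.
exists (maxn N N') => n; rewrite geq_max => /andP[/hN h1 /hN' h2].
rewrite (le_lt_trans (cmod_le_ReIm _))//.
rewrite (raddfB (@complex.Re R)) (raddfB (@complex.Im R)) /=; lra.
Qed.

Definition psums c z n : C := \sum_(i < n) c i * z ^+ i.

(** A total sum function, with the default value 0 at points of divergence; identities between sums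
    then need no limits in their statements. *)
Definition psum c z : C := xget 0 [set s | ccvg (psums c z) s].

(** This takes the place of a radius of convergence: it is preserved by the operations below, and it
    gives geometric tails for [|z| < t]. *)
Definition pbound c t := exists M, forall j, cmod (c j) * t ^+ j <= M.

Lemma psumE c z s : ccvg (psums c z) s -> psum c z = s.
Proof.
by move=> cs; rewrite /psum; case: xgetP => [x _ /= /ccvg_unique|/(_ s)//]; apply.
Qed.

Lemma psumsB c z n N : (n <= N)%N ->
  psums c z N - psums c z n = \sum_(n <= i < N) c i * z ^+ i.
Proof.
move=> nN; rewrite /psums -!(big_mkord xpredT (fun i => c i * z ^+ i)).
by rewrite (big_cat_nat _ nN)//= addrAC subrr add0r.
Qed.

Lemma geo_sum_le (k : R) n N : 0 <= k -> k < 1 ->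
  \sum_(n <= i < N) k ^+ i <= k ^+ n / (1 - k).
Proof.
move=> k0 k1; have k1' : 0 < 1 - k by lra.
rewrite ler_pdivlMr// mulr_suml.
have [nN|/ltnW Nn] := leqP n N; last by rewrite big_geq// exprn_ge0.
rewrite (eq_bigr (fun i => (- k ^+ i.+1) - (- k ^+ i))); last first.
  by move=> i _; rewrite exprS; ring.
rewrite telescope_sumr// opprK addrC gerBl exprn_ge0//.
Qed.

Lemma bound_ge0 c t M : (forall j, cmod (c j) * t ^+ j <= M) -> 0 <= M.
Proof.
move=> /(_ 0%N); rewrite expr0 mulr1; apply: le_trans => //.
Qed.

Lemma psums_tail c t M z n N : 0 < t -> (forall j, cmod (c j) * t ^+ j <= M) ->
  cmod z < t -> (n <= N)%N ->
  cmod (psums c z N - psums c z n) <= M * (cmod z / t) ^+ n / (1 - cmod z / t).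
Proof.
move=> t0 hM zt nN; rewrite psumsB// (le_trans (cmod_sum _ _ _))//.
have M0 := bound_ge0 hM.
apply: (@le_trans _ _ (\sum_(n <= i < N) M * (cmod z / t) ^+ i)).
  apply: ler_sum => i _; rewrite cmodM cmodX expr_div_n mulrA mulrAC.
  by rewrite ler_wpM2r ?exprn_ge0// ler_pdivlMr ?exprn_gt0.
rewrite -mulr_sumr -mulrA ler_wpM2l// geo_sum_le ?divr_ge0// ?(ltW t0)//.
by rewrite ltr_pdivrMr// mul1r.
Qed.

Lemma geo_small (M k e : R) : 0 <= k -> k < 1 -> 0 < e ->
  exists N, forall n, (N <= n)%N -> M * k ^+ n < e.
Proof.
move=> k0 k1 e0.
have : M * k ^+ n @[n --> \oo] --> M * 0.
  by apply: cvgMr; apply: cvg_expr; rewrite ger0_norm.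
rewrite mulr0 => /cvgrPdist_lt /(_ e e0)[N _ hN]; exists N => n /hN /=.
by rewrite sub0r normrN; exact: le_lt_trans (ler_norm _).
Qed.

Lemma psum_cvg c t z : 0 < t -> pbound c t -> cmod z < t ->
  ccvg (psums c z) (psum c z).
Proof.
move=> t0 [M hM] zt; suff [s hs] : exists s, ccvg (psums c z) s.
  by rewrite (psumE hs).
have k1 : cmod z / t < 1 by rewrite ltr_pdivrMr// mul1r.
have k0 : 0 <= cmod z / t by rewrite divr_ge0// ltW.
apply: ccvg_cauchy => e e0.
have [N hN] := geo_small (M / (1 - cmod z / t)) k0 k1 e0.
exists N => n Nn; rewrite (le_lt_trans (psums_tail t0 hM zt Nn))// mulrAC.
exact: hN.
Qed.

Lemma ccvg_le (u : nat -> C) (l a : C) M N : ccvg u l ->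
  (forall n, (N <= n)%N -> cmod (u n - a) <= M) -> cmod (l - a) <= M.
Proof.
move=> ul h; apply/ler_addgt0Pr => e e0; have [N' hN'] := ul e e0.
have := h _ (leq_maxl N N'); have := hN' _ (leq_maxr N N').
rewrite cmodBC; set n := maxn _ _ => h1 h2.
by rewrite (le_trans (cmod_tri _ (u n) _))//; lra.
Qed.

Lemma psum_tail c t M z n : 0 < t -> (forall j, cmod (c j) * t ^+ j <= M) ->
  cmod z < t ->
  cmod (psum c z - psums c z n) <= M * (cmod z / t) ^+ n / (1 - cmod z / t).
Proof.
move=> t0 hM zt; have cc : pbound c t by exists M.
by apply: (ccvg_le (N := n) (psum_cvg t0 cc zt)) => N nN; exact: psums_tail.
Qed.

Lemma psum_le c t M z : 0 < t -> (forall j, cmod (c j) * t ^+ j <= M) ->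
  cmod z < t -> cmod (psum c z) <= M / (1 - cmod z / t).
Proof.
move=> t0 hM zt; have := psum_tail 0%N t0 hM zt.
by rewrite /psums big_ord0 subr0 expr0 mulr1.
Qed.

Lemma ccvgD (u v : nat -> C) a b : ccvg u a -> ccvg v b ->
  ccvg (fun n => u n + v n) (a + b).
Proof.
move=> h h' e e0; have e20 : 0 < e / 2 by rewrite divr_gt0.
have [N hN] := h _ e20; have [N' hN'] := h' _ e20.
exists (maxn N N') => n; rewrite geq_max => /andP[/hN h1 /hN' h2].
rewrite opprD addrACA (le_lt_trans (cmodD _ _))//; lra.
Qed.

Lemma ccvgM (u v : nat -> C) a b : ccvg u a -> ccvg v b ->
  ccvg (fun n => u n * v n) (a * b).
Proof.
move=> h h' e e0; pose K := cmod a + cmod b + 1.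
have K0 : 0 < K by rewrite ltr_wpDl// addr_ge0.
pose d := Num.min 1 (e / K).
have d0 : 0 < d by rewrite lt_min ltr01 divr_gt0.
have [N hN] := h _ d0; have [N' hN'] := h' _ d0.
exists (maxn N N') => n; rewrite geq_max => /andP[/hN h1 /hN' h2].
have -> : u n * v n - a * b = (u n - a) * (v n - b) + (u n - a) * b + a * (v n - b).
  by ring.
have d1 : d <= 1 by rewrite ge_min lexx.
have dK : d * K <= e by rewrite -ler_pdivlMr// ge_min lexx orbT.
have t1 := cmodD ((u n - a) * (v n - b) + (u n - a) * b) (a * (v n - b)).
have t2 := cmodD ((u n - a) * (v n - b)) ((u n - a) * b).
rewrite !cmodM in t1 t2.
have := cmod_ge0 a; have := cmod_ge0 b; have := cmod_ge0 (u n - a).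
have := cmod_ge0 (v n - b); move: t1 t2 dK; rewrite /K; move: h1 h2 d1 d0.
move: (cmod (u n - a)) (cmod (v n - b)) (cmod a) (cmod b) => x y A B.
move=> *; nra.
Qed.

Lemma ccvg_cst (a : C) : ccvg (fun=> a) a.
Proof. by move=> e e0; exists 0%N => n _; rewrite subrr cmod0. Qed.

Lemma ccvg_ext (u v : nat -> C) a : u =1 v -> ccvg u a -> ccvg v a.
Proof. by move=> /funext ->. Qed.

Lemma pboundD c c' t : pbound c t -> pbound c' t ->
  0 <= t -> pbound (fun j => c j + c' j) t.
Proof.
move=> [M h] [M' h'] t0; exists (M + M') => j.
apply: le_trans (lerD (h j) (h' j)); rewrite -mulrDl.
by rewrite ler_wpM2r ?exprn_ge0// cmodD.
Qed.

Lemma pboundZ c t (a : C) : pbound c t -> pbound (fun j => a * c j) t.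
Proof.
move=> [M h]; exists (cmod a * M) => j.
by rewrite cmodM -mulrA ler_wpM2l.
Qed.

Lemma pbound_le c t t' : pbound c t -> 0 <= t' <= t -> pbound c t'.
Proof.
move=> [M h] /andP[t0 t't]; exists M => j; apply: le_trans (h j).
by rewrite ler_wpM2l// lerXn2r// nnegrE (le_trans t0).
Qed.

Lemma pbound_shift c t : 0 < t -> pbound c t -> pbound (fun j => c j.+1) t.
Proof.
move=> t0 [M h]; exists (M / t) => j.
by rewrite ler_pdivlMr// -mulrA -exprSr.
Qed.

Lemma psumD c c' t z : 0 < t -> pbound c t -> pbound c' t -> cmod z < t ->
  psum (fun j => c j + c' j) z = psum c z + psum c' z.
Proof.
move=> t0 h h' zt; apply: psumE.
apply: ccvg_ext (ccvgD (psum_cvg t0 h zt) (psum_cvg t0 h' zt)) => n.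
by rewrite /psums -big_split /=; apply: eq_bigr => i _; rewrite mulrDl.
Qed.

Lemma psumZ c t z (a : C) : 0 < t -> pbound c t -> cmod z < t ->
  psum (fun j => a * c j) z = a * psum c z.
Proof.
move=> t0 h zt; apply: psumE.
apply: ccvg_ext (ccvgM (@ccvg_cst a) (psum_cvg t0 h zt)) => n.
by rewrite /psums mulr_sumr; apply: eq_bigr => i _; rewrite mulrA.
Qed.

Lemma psum_shift c t z : 0 < t -> pbound c t -> cmod z < t ->
  psum c z = c 0 + z * psum (fun j => c j.+1) z.
Proof.
move=> t0 h zt; apply: psumE => e e0.
have hS := psum_cvg t0 (pbound_shift t0 h) zt.
have := ccvgD (@ccvg_cst (c 0)) (ccvgM (@ccvg_cst z) hS).
move=> /(_ e e0)[N hN]; exists N.+1 => -[//|n] /hN.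
rewrite {2}/psums big_ord_recl expr0 mulr1 mulr_sumr.
by under eq_bigr => i _ do rewrite mulrCA -exprS.
Qed.

Lemma psum_fin c n z : (forall j, (n <= j)%N -> c j = 0) -> psum c z = psums c z n.
Proof.
move=> h; apply: psumE => e e0; exists n => N nN.
rewrite psumsB// big_nat big1 ?cmod0// => i /andP[ni _].
by rewrite h// mul0r.
Qed.

Lemma psum_poly p z : psum (fun j => p`_j) z = p.[z].
Proof.
rewrite (psum_fin (n := size p)) ?horner_coef// => j; exact: nth_default.
Qed.

Lemma pbound_fin c n t : (forall j, (n <= j)%N -> c j = 0) -> pbound c t.
Proof.
move=> h; exists (\sum_(j < n) `|cmod (c j) * t ^+ j|) => j.
have [jn|/h ->] := ltnP j n; last by rewrite cmod0 mul0r sumr_ge0.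
by rewrite (bigD1 (Ordinal jn))//= (le_trans (ler_norm _))// lerDl sumr_ge0.
Qed.

Lemma pbound_poly p t : pbound (fun j => p`_j) t.
Proof. by apply: (pbound_fin (n := size p)) => j; exact: nth_default. Qed.

(** The Cauchy product of a polynomial and a formal series; with [c := phi] it is the sum that
    occurs in [incomplete_pade]. *)
Definition pmul q c j : C := \sum_(i < j.+1) q`_i * c (j - i)%N.

Lemma pmul0 c j : pmul 0 c j = 0.
Proof. by rewrite /pmul big1// => i _; rewrite coef0 mul0r. Qed.

(** Horner's rule for the product, which opens the way to induction on [q] by [poly_ind]. *)
Lemma pmulMXaddC q (a : C) c j : pmul (q * 'X + a%:P) c j =
  (if j is k.+1 then pmul q c k else 0) + a * c j.
Proof.
rewrite /pmul big_ord_recl subn0 coefD coefMX coefC eqxx add0r addrC.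
congr (_ + _); case: j => [|j]; first by rewrite big_ord0.
by apply: eq_bigr => i _; rewrite coefD coefMX coefC /= addr0.
Qed.

Lemma pbound_pmul q c t : 0 < t -> pbound c t -> pbound (pmul q c) t.
Proof.
move=> t0 h; elim/poly_ind: q => [|q a [M hM]].
  by exists 0 => j; rewrite pmul0 cmod0 mul0r.
rewrite (funext (pmulMXaddC q a c)); apply: (pboundD _ (pboundZ a h) (ltW t0)).
have M0 := bound_ge0 hM.
exists (t * M) => -[|j]; first by rewrite cmod0 mul0r mulr_ge0// ltW.
by rewrite exprS mulrCA ler_wpM2l// ltW.
Qed.

Lemma psum_pmul q c t z : 0 < t -> pbound c t -> cmod z < t ->
  psum (pmul q c) z = q.[z] * psum c z.
Proof.
move=> t0 h zt; elim/poly_ind: q => [|q a ih].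
  by rewrite (psum_fin (n := 0)) ?horner0 ?mul0r ?/psums ?big_ord0// => j _; exact: pmul0.
have hb := pbound_pmul q t0 h.
rewrite (funext (pmulMXaddC q a c)) (psumD t0 _ (pboundZ a h) zt); last first.
  have [M hM] := hb.
  have M0 := bound_ge0 hM.
  exists (t * M) => -[|j]; first by rewrite cmod0 mul0r mulr_ge0// ltW.
  by rewrite exprS mulrCA ler_wpM2l// ltW.
rewrite (psum_shift (t := t) (c := fun j => if j is k.+1 then _ else _))//; last first.
  have [M hM] := hb.
  have M0 := bound_ge0 hM.
  exists (t * M) => -[|j]; first by rewrite cmod0 mul0r mulr_ge0// ltW.
  by rewrite exprS mulrCA ler_wpM2l// ltW.
rewrite (psumZ a t0 h zt) add0r ih hornerMXaddC; ring.
Qed.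

(** A long truncation is a polynomial with the same [j]-th coefficient, and on the circle it differs
    from the sum by at most [e]. *)
Lemma psum_cauchy_coef c t r M j : 0 < t -> pbound c t -> 0 <= r -> r < t ->
  (forall z, cmod z = r -> cmod (psum c z) <= M) -> cmod (c j) * r ^+ j <= M.
Proof.
move=> t0 [B hB] r0 rt hM; apply/ler_addgt0Pr => e e0.
have k1 : r / t < 1 by rewrite ltr_pdivrMr// mul1r.
have k0 : 0 <= r / t by rewrite divr_ge0// ltW.
have [N hN] := geo_small (B / (1 - r / t)) k0 k1 e0.
pose n := maxn N j.+1; pose p := \poly_(i < n) c i.
have -> : c j = p`_j by rewrite coef_poly /n leq_max leqnn orbT.
apply: cauchy_coef => // z zr.
have -> : p.[z] = psums c z n by rewrite horner_poly.
have zt : cmod z < t by rewrite zr.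
have := psum_tail n t0 hB zt; rewrite zr mulrAC => h1.
have := hN n (leq_maxl _ _); have := hM z zr => h2 h3.
rewrite -[psums c z n](subrK (psum c z)) (le_trans (cmodD _ _))// addrC.
by rewrite lerD// cmodBC ltW// (le_lt_trans h1).
Qed.
End PowerSeries.

(** * Recentring of power series, orders of vanishing and the identity theorem *)

Section LocalTheory.
Variable R : realType.
Local Notation C := R[i].
Implicit Types (x y z : C) (p q : {poly C}) (r t e M : R) (a : nat -> C).
Implicit Types (g h : C -> C).

(** The coefficients of the divided difference [(psum a z - psum a z0) / (z - z0)]; see
    [psum_pdiv]. *)
Definition pdiv a z0 j : C := psum (fun i => a (i + j).+1) z0.

Lemma pbound_drop a t M j : 0 < t -> (forall i, cmod (a i) * t ^+ i <= M) ->
  forall i, cmod (a (i + j)%N) * t ^+ i <= M / t ^+ j.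
Proof.
by move=> t0 hM i; rewrite ler_pdivlMr ?exprn_gt0// -mulrA -exprD.
Qed.

Lemma pdiv_bound a t M z0 j : 0 < t -> (forall i, cmod (a i) * t ^+ i <= M) ->
  cmod z0 < t -> cmod (pdiv a z0 j) * t ^+ j <= M / (t - cmod z0).
Proof.
move=> t0 hM zt; have h i : cmod (a (i + j).+1) * t ^+ i <= M / t ^+ j.+1.
  by rewrite -addnS; exact: pbound_drop.
have tj : 0 < t ^+ j by rewrite exprn_gt0.
apply: le_trans (ler_wpM2r (ltW tj) (psum_le t0 h zt)) _.
have tz : 0 < t - cmod z0 by rewrite subr_gt0.
rewrite le_eqVlt; apply/orP; left; apply/eqP.
by rewrite exprS; field; rewrite !gt_eqF ?exprn_gt0.
Qed.

Lemma pdivS a t z0 j : 0 < t -> pbound a t -> cmod z0 < t ->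
  pdiv a z0 j = a j.+1 + z0 * pdiv a z0 j.+1.
Proof.
move=> t0 [M hM] zt; rewrite /pdiv (psum_shift (t := t))// ?add0n.
  by under eq_fun do rewrite addSnnS.
exists (M / t ^+ j.+1) => i; rewrite -addnS; exact: pbound_drop.
Qed.

Lemma pbound_pdiv a t z0 : 0 < t -> pbound a t -> cmod z0 < t ->
  pbound (pdiv a z0) t.
Proof. by move=> t0 [M hM] zt; exists (M / (t - cmod z0)) => j; exact: pdiv_bound. Qed.

Lemma psum_pdiv a t z0 z : 0 < t -> pbound a t -> cmod z0 < t -> cmod z < t ->
  psum a z = psum a z0 + (z - z0) * psum (pdiv a z0) z.
Proof.
move=> t0 ha z0t zt; have hd := pbound_pdiv t0 ha z0t.
have hs := pbound_shift t0 ha; have hds := pbound_shift t0 hd.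
have E : psum (pdiv a z0) z =
    psum (fun j => a j.+1) z + z0 * psum (fun j => pdiv a z0 j.+1) z.
  rewrite -(psumZ z0 t0 hds zt) -(psumD t0 hs (pboundZ z0 hds) zt).
  by congr psum; apply/funext => j; exact: pdivS t0 ha z0t.
have E0 : psum a z0 = a 0%N + z0 * pdiv a z0 0%N.
  rewrite (psum_shift t0 ha z0t); congr (_ + _ * _).
  by rewrite /pdiv; under [in RHS]eq_fun do rewrite addn0.
have E1 := psum_shift t0 hd zt.
rewrite (psum_shift t0 ha zt) E0.
have -> : psum (fun j => a j.+1) z =
    psum (pdiv a z0) z - z0 * psum (fun j => pdiv a z0 j.+1) z.
  by rewrite E addrK.
rewrite E1; ring.
Qed.

(** The Taylor coefficients at [z0], obtained by dividing [k] times by [z - z0] and evaluating;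
    neither derivatives nor double series occur. *)
Definition recentre a z0 k : C := psum (iter k (pdiv^~ z0) a) z0.

Lemma iter_pdiv_bound a t M z0 k j : 0 < t ->
    (forall i, cmod (a i) * t ^+ i <= M) -> cmod z0 < t ->
  cmod (iter k (pdiv^~ z0) a j) * t ^+ j <= M / (t - cmod z0) ^+ k.
Proof.
move=> t0 hM zt; elim: k j => [|k ih] j /=; first by rewrite divr1.
apply: le_trans (pdiv_bound j t0 ih zt) _.
have tz : 0 < t - cmod z0 by rewrite subr_gt0.
by rewrite exprSr invfM mulrA mulrAC.
Qed.

Lemma psum_recentre_sums a t z0 z k : 0 < t -> pbound a t ->
    cmod z0 < t -> cmod z < t ->
  psum a z = psums (recentre a z0) (z - z0) k +
             (z - z0) ^+ k * psum (iter k (pdiv^~ z0) a) z.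
Proof.
move=> t0 [M hM] z0t zt; elim: k => [|k ->].
  by rewrite /psums big_ord0 add0r expr0 mul1r.
rewrite (psum_pdiv (a := iter k _ a) t0 _ z0t zt); last first.
  by eexists => j; exact: iter_pdiv_bound.
rewrite /psums big_ord_recr /= exprSr mulrDr addrA mulrA; congr (_ + _ + _).
exact: mulrC.
Qed.

Lemma recentre_bound a t z0 : 0 < t -> pbound a t -> cmod z0 < t ->
  pbound (recentre a z0) (t - cmod z0).
Proof.
move=> t0 [M hM] z0t; have tz : 0 < t - cmod z0 by rewrite subr_gt0.
exists (M / (1 - cmod z0 / t)) => k.
have h := psum_le t0 (fun j => iter_pdiv_bound k j t0 hM z0t) z0t.
have tk : 0 < (t - cmod z0) ^+ k by rewrite exprn_gt0.
apply: le_trans (ler_wpM2r (ltW tk) h) _.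
by rewrite mulrAC divfK// gt_eqF.
Qed.

(** The remainder after [n] divisions is [(z - z0)^n] times a series of size [(t - |z0|)^(- n)],
    hence tends to 0 geometrically. *)
Lemma psum_recentre a t z0 z : 0 < t -> pbound a t -> cmod z0 < t ->
  cmod (z - z0) < t - cmod z0 -> psum a z = psum (recentre a z0) (z - z0).
Proof.
move=> t0 ha z0t zz0; have tz : 0 < t - cmod z0 by rewrite subr_gt0.
have zt : cmod z < t.
  have := cmodD (z - z0) z0; rewrite subrK => h; lra.
apply/esym/psumE => e e0; have [M hM] := ha.
have k0 : 0 <= cmod (z - z0) / (t - cmod z0) by rewrite divr_ge0// ltW.
have k1 : cmod (z - z0) / (t - cmod z0) < 1 by rewrite ltr_pdivrMr// mul1r.
have [N hN] := geo_small (M / (1 - cmod z / t)) k0 k1 e0.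
exists N => n Nn; rewrite (psum_recentre_sums n t0 ha z0t zt).
rewrite cmodBC addrC addKr cmodM cmodX; apply: le_lt_trans (hN n Nn).
have h := psum_le t0 (fun j => iter_pdiv_bound n j t0 hM z0t) zt.
apply: le_trans (ler_wpM2l (exprn_ge0 n (cmod_ge0 (z - z0))) h) _.
rewrite expr_div_n le_eqVlt; apply/orP; left; apply/eqP; ring.
Qed.

Definition has_pseries g z0 t :=
  exists2 a, pbound a t & forall z, cmod (z - z0) < t -> g z = psum a (z - z0).

(** At the point [r / 2] the terms of the series are differences of consecutive partial sums, so
    convergence there bounds them. *)
Lemma pbound_of_cvg a r (g : C -> C) : 0 < r ->
  (forall z, cmod z < r -> ccvg (psums a z) (g z)) -> pbound a (r / 2).
Proof.
move=> r0 h; have r2 : 0 < r / 2 by rewrite divr_gt0.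
have cr : cmod ((r / 2)%:C : C) = r / 2 by rewrite cmod_real// ltW.
have [|N hN] := h (r / 2)%:C _ 1 ltr01; first by rewrite cr; lra.
pose S := \sum_(j < N) cmod (a j) * (r / 2) ^+ j.
have S0 : 0 <= S by rewrite sumr_ge0// => j _; pos.
exists (S + 2) => j; have [jN|Nj] := ltnP j N.
  rewrite /S (bigD1 (Ordinal jN))//= -addrA lerDl; apply: addr_ge0 => //.
  by apply: sumr_ge0 => i _; pos.
have h1 := hN j Nj; have h2 := hN j.+1 (leqW Nj).
have -> : cmod (a j) * (r / 2) ^+ j =
    cmod (psums a (r / 2)%:C j.+1 - psums a (r / 2)%:C j).
  by rewrite /psums big_ord_recr /= addrAC subrr add0r cmodM cmodX cr.
have := cmod_tri (psums a (r / 2)%:C j.+1) (g (r / 2)%:C) (psums a (r / 2)%:C j).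
rewrite (cmodBC (g _)); lra.
Qed.

Lemma analytic_atP g z0 :
  analytic_at g z0 <-> exists2 t, 0 < t & has_pseries g z0 t.
Proof.
split=> [[a /nearCP[r r0 h]]|[t t0 [a ha gE]]]; last first.
  exists a; apply/nearCP; exists t => // z zt; apply/cvg_ccvg.
  rewrite gE//; apply: ccvg_ext (psum_cvg t0 ha zt) => n.
  by rewrite /series /= big_mkord.
have {}h z : cmod z < r -> ccvg (psums a z) (g (z + z0)).
  move=> zr; have := h (z + z0); rewrite addrK => /(_ zr) /cvg_ccvg.
  by apply: ccvg_ext => n; rewrite /series /= big_mkord.
have r2 : 0 < r / 2 by rewrite divr_gt0.
exists (r / 2) => //; exists a; first exact: pbound_of_cvg r0 h.
move=> z zr; apply/esym/psumE; rewrite -{2}(subrK z0 z); apply: h.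
by apply: lt_trans zr _; lra.
Qed.

Lemma has_pseries_recentre g z0 t z1 : cmod (z1 - z0) < t ->
  has_pseries g z0 t -> has_pseries g z1 (t - cmod (z1 - z0)).
Proof.
move=> z1t [a ha gE]; have t0 := le_lt_trans (cmod_ge0 _) z1t.
exists (recentre a (z1 - z0)); first exact: recentre_bound.
move=> z zz1; have E : z - z1 = z - z0 - (z1 - z0) by ring.
rewrite E -(psum_recentre t0 ha z1t) -?E// gE//.
have := cmod_tri z z1 z0; lra.
Qed.

Lemma has_pseries_le g z0 t t' : 0 <= t' <= t ->
  has_pseries g z0 t -> has_pseries g z0 t'.
Proof.
move=> /andP[t0 tt] [a ha gE]; exists a; first by apply: pbound_le ha _; rewrite t0.
by move=> z zt; apply: gE; exact: lt_le_trans tt.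
Qed.

Lemma has_pseries_ext g h z0 t : (forall z, cmod (z - z0) < t -> g z = h z) ->
  has_pseries g z0 t -> has_pseries h z0 t.
Proof. by move=> E [a ha gE]; exists a => // z zt; rewrite -E// gE. Qed.

Lemma has_pseriesD g h z0 t : 0 < t -> has_pseries g z0 t -> has_pseries h z0 t ->
  has_pseries (fun z => g z + h z) z0 t.
Proof.
move=> t0 [a ha gE] [b hb hE]; exists (fun j => a j + b j).
  by apply: pboundD => //; exact: ltW.
by move=> z zt; rewrite (psumD t0 ha hb)// gE// hE.
Qed.

Lemma has_pseriesM g p z0 t : 0 < t -> has_pseries g z0 t ->
  has_pseries (fun z => p.[z] * g z) z0 t.
Proof.
move=> t0 [a ha gE]; exists (pmul (p \Po ('X + z0%:P)) a).
  exact: pbound_pmul.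
move=> z zt; rewrite (psum_pmul _ t0 ha)// gE//.
by rewrite horner_comp !hornerE subrK.
Qed.

Lemma has_pseries_psum a t : pbound a t -> has_pseries (psum a) 0 t.
Proof. by move=> ha; exists a; [exact: ha|move=> z _; rewrite subr0]. Qed.

Lemma has_pseries_poly p z0 t : has_pseries (fun z => p.[z]) z0 t.
Proof.
exists (fun j => (p \Po ('X + z0%:P))`_j); first exact: pbound_poly.
by move=> z _; rewrite psum_poly horner_comp !hornerE subrK.
Qed.

Lemma pmul1 a j : pmul 1 a j = a j.
Proof.
rewrite /pmul big_ord_recl subn0 coef1 eqxx mul1r big1 ?addr0// => i _.
by rewrite coef1 mul0r.
Qed.

Lemma has_pseries_inv z0 : z0 != 0 ->
  has_pseries (fun z => z^-1) z0 (cmod z0).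
Proof.
move=> z00; have z0p : 0 < cmod z0 by rewrite cmod_gt0.
pose c j : C := (-1) ^+ j / z0 ^+ j.+1.
have cb : pbound c (cmod z0).
  exists (cmod z0)^-1 => j; rewrite /c cmodM cmodV !cmodX cmodN cmod1 expr1n mul1r.
  by rewrite exprSr invfM mulrAC mulrC mulVf ?mulr1// expf_neq0// gt_eqF.
exists c => // z zz0.
have z_0 : z != 0.
  by apply: contraTneq zz0 => ->; rewrite sub0r cmodN ltxx.
(* Multiplied by [z0 + (z - z0)] the geometric series collapses to the constant 1. The factor is
   written with [1 * 'X] to fit [pmulMXaddC]. *)
have := psum_pmul (1 * 'X + z0%:P) z0p cb zz0.
rewrite (psum_fin (n := 1)).
  rewrite /psums big_ord_recl big_ord0 pmulMXaddC !add0r addr0 mulr1 hornerMXaddC.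
  rewrite hornerC mul1r subrK /c expr0 expr1 mul1r divff// => E.
  by apply: (mulfI z_0); rewrite -E divff.
case=> // j _; rewrite pmulMXaddC pmul1 /c [(-1) ^+ _.+1]exprS [z0 ^+ j.+2]exprS.
have : z0 ^+ j.+1 != 0 by rewrite expf_neq0.
by move: (z0 ^+ _) ((-1) ^+ _) => u v u0; field; rewrite z00 u0.
Qed.

Lemma psum_drop a t z k : 0 < t -> pbound a t -> cmod z < t ->
  (forall j, (j < k)%N -> a j = 0) ->
  psum a z = z ^+ k * psum (fun j => a (j + k)%N) z.
Proof.
move=> t0 [M hM] zt; elim: k => [|k ih] h.
  by rewrite expr0 mul1r; under [in RHS]eq_fun do rewrite addn0.
rewrite ih => [|j jk]; last by apply: h; rewrite ltnW.
rewrite (psum_shift (t := t) (c := fun j => a (j + k)%N))//; last first.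
  by eexists; exact: pbound_drop.
rewrite add0n h// add0r exprSr mulrA.
by under eq_fun do rewrite addSnnS.
Qed.

Lemma pseries_order g z0 t : 0 < t -> has_pseries g z0 t ->
  (forall z, cmod (z - z0) < t -> g z = 0) \/
  exists k h, [/\ has_pseries h z0 t, h z0 != 0 &
    forall z, cmod (z - z0) < t -> g z = (z - z0) ^+ k * h z].
Proof.
move=> t0 [a ha gE].
have [a0|] := pselect (forall j, a j = 0).
  left=> z zt; rewrite gE// (psum_fin (n := 0))// /psums big_ord0//.
move=> /existsNP[j0 aj0]; right.
have ex : exists j, a j != 0 by exists j0; apply/eqP.
have [k ak kmin] := ex_minnP ex.
exists k, (fun z => psum (fun j => a (j + k)%N) (z - z0)).
have hk : pbound (fun j => a (j + k)%N) t.
  by case: ha => M hM; eexists; exact: pbound_drop.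
split.
- by exists (fun j => a (j + k)%N).
- rewrite subrr (psum_shift (t := t))// ?cmod0// mul0r addr0 add0n//.
- move=> z zt; rewrite gE//; apply: (psum_drop t0 ha zt) => j jk.
  by apply/eqP/negPn/negP => /kmin; rewrite leqNgt jk.
Qed.

Lemma has_pseries_lip g z0 t : 0 < t -> has_pseries g z0 t ->
  exists2 K, 0 <= K & forall z, cmod (z - z0) < t / 2 ->
    cmod (g z - g z0) <= K * cmod (z - z0).
Proof.
move=> t0 [a ha gE]; have [M hM] := pbound_shift t0 ha.
have M0 := bound_ge0 hM.
exists (M * 2) => [|z zt]; first by rewrite mulr_ge0.
have zt' : cmod (z - z0) < t by lra.
have c0 : cmod (0 : C) < t by rewrite cmod0.
have gz0 : g z0 = psum a 0 by rewrite gE (subrr z0).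
rewrite (gE _ zt') gz0.
rewrite (psum_shift t0 ha zt') (psum_shift t0 ha c0).
rewrite mul0r addr0 addrAC subrr add0r cmodM mulrC ler_wpM2r//.
apply: le_trans (psum_le t0 hM zt') _; rewrite ler_wpM2l//.
have tz : 0 < t - cmod (z - z0) by rewrite subr_gt0.
have -> : (1 - cmod (z - z0) / t)^-1 = t / (t - cmod (z - z0)).
  by field; rewrite !gt_eqF.
rewrite ler_pdivrMr//; lra.
Qed.

Lemma has_pseries_continuous g z0 t e : 0 < t -> has_pseries g z0 t -> 0 < e ->
  exists2 d, 0 < d & forall z, cmod (z - z0) < d -> cmod (g z - g z0) < e.
Proof.
move=> t0 hg e0; have [K K0 hK] := has_pseries_lip t0 hg.
have K1 : 0 < K + 1 by rewrite ltr_wpDl.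
exists (Num.min (t / 2) (e / (K + 1))) => [|z].
  by rewrite lt_min !divr_gt0.
rewrite lt_min => /andP[/hK h1]; rewrite ltr_pdivlMr// => h2.
apply: (le_lt_trans h1 (le_lt_trans _ h2)); rewrite mulrC ler_wpM2l//; lra.
Qed.

(** Zeros accumulating at [z0] are incompatible with the factorization [(z - z0)^k h] with
    [h z0 != 0], since [h] does not vanish near [z0]. *)
Lemma pseries_zero g z0 t : 0 < t -> has_pseries g z0 t ->
  (forall e, 0 < e -> exists z, [/\ z != z0, cmod (z - z0) < e & g z = 0]) ->
  forall z, cmod (z - z0) < t -> g z = 0.
Proof.
move=> t0 hg hz; have [//|[k [h [hh h0 gE]]]] := pseries_order t0 hg.
have [d d0 hd] := has_pseries_continuous (e := cmod (h z0)) t0 hh ltac:(by rewrite cmod_gt0).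
have [|z [zz0 zd gz]] := hz (Num.min d t); first by rewrite lt_min d0.
move: zd; rewrite lt_min => /andP[/hd + zt].
have : (z - z0) ^+ k * h z = 0 by rewrite -gE.
move=> /eqP; rewrite mulf_eq0 expf_eq0 subr_eq0 (negbTE zz0) andbF /= => /eqP ->.
by rewrite sub0r cmodN ltxx.
Qed.

(** The exponents [i] of the zero and [k] of the denominator are kept apart, so that no integer
    powers and no sign distinctions are needed. *)
Lemma meromorphic_order (F : C -> C) z0 : meromorphic_at F z0 ->
  (exists2 t, 0 < t & forall z, z != z0 -> cmod (z - z0) < t -> F z = 0) \/
  exists i k h t, [/\ 0 < t, has_pseries h z0 t, h z0 != 0 &
    forall z, z != z0 -> cmod (z - z0) < t ->
      F z = (z - z0) ^+ i / (z - z0) ^+ k * h z].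
Proof.
move=> [k [g [/analytic_atP[t t0 hg] /dnearCP[r r0 hF]]]].
have [g0|[i [h [hh h0 gE]]]] := pseries_order t0 hg.
  left; exists (Num.min t r) => [|z zz0]; rewrite lt_min ?t0//.
  by move=> /andP[zt zr]; rewrite hF// g0// mul0r.
right; exists i, k, h, (Num.min t r); split => //.
- by rewrite lt_min t0.
- by apply: has_pseries_le hh; rewrite ge_min lexx andbT le_min (ltW t0) (ltW r0).
- move=> z zz0; rewrite lt_min => /andP[zt zr].
  by rewrite hF// gE// mulrAC.
Qed.

End LocalTheory.

(** * Uniform limits of polynomials and their mean value property *)

Section UniformPolynomials.
Variable R : realType.
Local Notation C := R[i].
Implicit Types (x y z : C) (p q : {poly C}) (r t e M : R).
Implicit Types (g h : C -> C).

(** The form of analyticity that suffices for mean values: it is stable under products and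
    differences, and it reduces averages to [mean_value_poly]. *)
Definition poly_limit z0 t g := forall e, 0 < e ->
  exists p, forall z, cmod (z - z0) <= t -> cmod (g z - p.[z]) <= e.

Lemma pseries_poly_limit g z0 t t' : 0 <= t -> t < t' ->
  has_pseries g z0 t' -> poly_limit z0 t g.
Proof.
move=> t0 tt' [a [M hM] gE] e e0; have t'0 := le_lt_trans t0 tt'.
have k0 : 0 <= t / t' by rewrite divr_ge0// ltW.
have k1 : t / t' < 1 by rewrite ltr_pdivrMr// mul1r.
have M0 := bound_ge0 hM.
have [N hN] := geo_small (M / (1 - t / t')) k0 k1 e0.
exists ((\poly_(i < N) a i) \Po ('X - z0%:P)) => z zt.
have zt' := le_lt_trans zt tt'.
rewrite gE// horner_comp !hornerE horner_poly.
apply: le_trans (psum_tail N t'0 hM zt') _.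
apply: le_trans _ (ltW (hN N (leqnn _))); rewrite -!mulrA ler_wpM2l// mulrC.
have zk : cmod (z - z0) / t' <= t / t' by rewrite ler_wpM2r// invr_ge0 ltW.
apply: ler_pM; rewrite ?invr_ge0 ?exprn_ge0 ?divr_ge0 ?(ltW t'0)//.
- by rewrite subr_ge0 (le_trans zk)// ltW.
- by rewrite lef_pV2 ?posrE ?subr_gt0 ?(le_lt_trans zk)// lerD2l lerN2.
- by rewrite lerXn2r// nnegrE ?divr_ge0// ltW.
Qed.

Lemma poly_poly_limit p z0 t : poly_limit z0 t (fun z => p.[z]).
Proof. by move=> e e0; exists p => z _; rewrite subrr cmod0 ltW. Qed.

Lemma poly_bounded p z0 t :
  exists2 M, 0 <= M & forall z, cmod (z - z0) <= t -> cmod p.[z] <= M.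
Proof.
have [t0|t0] := leP 0 t; last first.
  exists 0 => // z zt; have := le_lt_trans zt t0.
  by rewrite ltNge cmod_ge0.
exists (\sum_(i < size p) cmod p`_i * (cmod z0 + t) ^+ i) => [|z zt].
  by apply: sumr_ge0 => i _; rewrite mulr_ge0// exprn_ge0// addr_ge0.
apply: le_trans (cmod_horner p z) _; apply: ler_sum => i _.
rewrite ler_wpM2l// lerXn2r ?nnegrE ?addr_ge0//.
by have := cmodD z0 (z - z0); rewrite addrC subrK => h; lra.
Qed.

Lemma poly_limit_bounded g z0 t : poly_limit z0 t g ->
  exists2 M, 0 <= M & forall z, cmod (z - z0) <= t -> cmod (g z) <= M.
Proof.
move=> /(_ 1 ltr01)[p hp]; have [M M0 hM] := poly_bounded p z0 t.
exists (1 + M) => [|z zt]; first by rewrite addr_ge0.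
rewrite -(subrK p.[z] (g z)) (le_trans (cmodD _ _))// lerD//; [exact: hp|exact: hM].
Qed.

Lemma poly_limitM g h z0 t : poly_limit z0 t g -> poly_limit z0 t h ->
  poly_limit z0 t (fun z => g z * h z).
Proof.
move=> hg hh e e0; have [Mg Mg0 hMg] := poly_limit_bounded hg.
have [Mh Mh0 hMh] := poly_limit_bounded hh.
pose K := Mg + Mh + 1; have K0 : 0 < K by rewrite ltr_wpDl ?addr_ge0.
pose d := Num.min 1 (e / K).
have d0 : 0 < d by rewrite lt_min ltr01 divr_gt0.
have d1 : d <= 1 by rewrite ge_min lexx.
have dK : d * K <= e by rewrite -ler_pdivlMr// ge_min lexx orbT.
have [p hp] := hg d d0; have [q hq] := hh d d0.
exists (p * q) => z zt; rewrite hornerM.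
have hx := hp z zt; have hy := hq z zt; have hu := hMg z zt; have hv := hMh z zt.
pose x : C := g z - p.[z]; pose y : C := h z - q.[z].
rewrite (_ : _ - _ = x * h z + g z * y - x * y); last by rewrite /x /y; ring.
have t1 := cmodB (x * h z + g z * y) (x * y).
have t2 := cmodD (x * h z) (g z * y).
rewrite !cmodM in t1 t2.
have xv : cmod x * cmod (h z) <= d * Mh by apply: ler_pM.
have uy : cmod (g z) * cmod y <= Mg * d by apply: ler_pM.
have xy : cmod x * cmod y <= d * 1 by apply: ler_pM => //; exact: le_trans hy d1.
apply: le_trans t1 _; rewrite /K in dK; lra.
Qed.

Lemma poly_limitX g z0 t n : poly_limit z0 t g ->
  poly_limit z0 t (fun z => g z ^+ n).
Proof.
move=> hg; elim: n => [|n ih].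
  by move=> e e0; exists 1 => z _; rewrite hornerE expr0 subrr cmod0 ltW.
have := poly_limitM hg ih; congr poly_limit.
by apply/funext => z; rewrite exprS.
Qed.

Lemma poly_limitB g h z0 t : poly_limit z0 t g -> poly_limit z0 t h ->
  poly_limit z0 t (fun z => g z - h z).
Proof.
move=> hg hh e e0; have e20 : 0 < e / 2 by rewrite divr_gt0.
have [p hp] := hg _ e20; have [q hq] := hh _ e20.
exists (p - q) => z zt; rewrite hornerD hornerN opprD addrACA -opprD.
have := hp z zt; have := hq z zt => h1 h2.
rewrite (le_trans (cmodB _ _))//; lra.
Qed.

Lemma poly_limit_mean g z0 t x r M : 0 <= r -> cmod (x - z0) + r <= t ->
  poly_limit z0 t g ->
  (forall y, cmod (y - x) = r -> cmod (g y) <= M) -> cmod (g x) <= M.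
Proof.
move=> r0 xr hg hM; apply/ler_addgt0Pr => e e0.
have e20 : 0 < e / 2 by rewrite divr_gt0.
have [p hp] := hg _ e20.
have xt : cmod (x - z0) <= t by lra.
have px : cmod p.[x] <= M + e / 2.
  apply: (mean_value_poly r0) => y yr.
  have yt : cmod (y - z0) <= t by have := cmod_tri y x z0; lra.
  have := hp y yt; have := hM y yr; have := cmod_tri 0 (g y) p.[y].
  by rewrite !sub0r !cmodN => h1 h2 h3; lra.
have := hp x xt; have := cmodD (g x - p.[x]) p.[x]; rewrite subrK; lra.
Qed.
End UniformPolynomials.

(** * Two-sided bounds for normalized polynomials and circles avoiding their zeros *)

Section NormalizedPolynomials.
Variable R : realType.
Local Notation C := R[i].
Implicit Types (x y z w : C) (p q : {poly C}) (r t e d M : R).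

Definition nfactor w z : C := if cmod w <= 1 then z - w else 1 - w^-1 * z.

Lemma zerosP p : p = lead_coef p *: \prod_(w <- zeros p) ('X - w%:P).
Proof. exact: svalP (closed_field_poly_normal p). Qed.

Lemma root_zeros p z : p != 0 -> root p z = (z \in zeros p).
Proof.
by move=> p0; rewrite {1}[p]zerosP rootZ ?lead_coef_eq0// root_prod_XsubC.
Qed.

Lemma size_zeros p : p != 0 -> size p = (size (zeros p)).+1.
Proof.
by move=> p0; rewrite {1}[p]zerosP size_scale ?lead_coef_eq0// size_prod_XsubC.
Qed.

Lemma normalized_horner p z : normalized p ->
  p.[z] = \prod_(w <- zeros p) nfactor w z.
Proof.
move=> pn; rewrite {1}pn horner_prod; apply: eq_bigr => w _.
by rewrite /nfactor; case: ifP; rewrite !hornerE.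
Qed.

Lemma normalized_neq0 p : normalized p -> p != 0.
Proof.
move=> ->; rewrite prodf_seq_neq0; apply/allP => w _ /=.
case: ifP => _; first by rewrite polyXsubC_eq0.
by apply/eqP => /(congr1 (horner^~ 0)); rewrite !hornerE ?mulr0 ?subr0 => /eqP; rewrite oner_eq0.
Qed.

Lemma nfactor_le w z : cmod (nfactor w z) <= 1 + cmod z.
Proof.
rewrite /nfactor; case: ifPn => [w1|]; rewrite -?ltNge.
  by rewrite (le_trans (cmodB _ _))// addrC lerD2r.
move=> w1; rewrite (le_trans (cmodB _ _))// cmod1 lerD2l cmodM cmodV.
by rewrite ler_piMl// invf_le1// ?ltW// (lt_trans ltr01).
Qed.

Lemma nfactor_gt1E w z : 1 < cmod w -> cmod (1 - w^-1 * z) = cmod (z - w) / cmod w.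
Proof.
move=> w1; have w0 : w != 0 by rewrite -cmod_gt0 (lt_trans ltr01).
by rewrite -cmodV -cmodM mulrBl divff// cmodBC mulrC.
Qed.

Lemma nfactor_le_dist w z : cmod (nfactor w z) <= cmod (z - w).
Proof.
rewrite /nfactor; case: ifPn => [//|]; rewrite -?ltNge => w1.
by rewrite nfactor_gt1E// ler_pdivrMr ?(lt_trans ltr01)// ler_peMr// ltW.
Qed.

Lemma nfactor_ge w z d : 0 <= d <= 1 -> d <= cmod (z - w) ->
  d / (2 * (1 + cmod z)) <= cmod (nfactor w z).
Proof.
move=> /andP[d0 d1] dw; have z0 := cmod_ge0 z.
rewrite ler_pdivrMr ?mulr_gt0 ?ltr_pwDl//.
rewrite /nfactor; case: ifPn => [w1|]; rewrite -?ltNge.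
  by rewrite (le_trans dw)// ler_peMr//; lra.
move=> w1; rewrite nfactor_gt1E//.
have w0 : 0 < cmod w by rewrite (lt_trans ltr01).
rewrite mulrAC ler_pdivlMr//.
have := cmod_dist w z; rewrite cmodBC; move: dw.
move: (cmod (z - w)) (cmod w) (cmod z) z0 w1 w0 => a b c c0 b1 b0 da bc.
(* A zero with [|w| <= 2 |z|] costs at most the division by [2 |z|]; for a farther one [|z - w|] is
   at least [|w| / 2]. *)
have [h|h] := leP b (2 * c); nra.
Qed.

Lemma prod_seq_le (s : seq C) (F : C -> R) M :
  (forall w, 0 <= F w <= M) -> \prod_(w <- s) F w <= M ^+ size s.
Proof.
move=> h; elim: s => [|w s ih]; first by rewrite big_nil.
have /andP[F0 FM] := h w; rewrite big_cons exprS ler_pM//.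
by apply: prodr_ge0 => i _; have /andP[] := h i.
Qed.

Lemma prod_seq_ge (s : seq C) (F : C -> R) M : 0 <= M ->
  (forall w, w \in s -> M <= F w) -> M ^+ size s <= \prod_(w <- s) F w.
Proof.
move=> M0; elim: s => [|w s ih] h; first by rewrite big_nil.
rewrite big_cons exprS ler_pM ?exprn_ge0// ?h ?mem_head// ih// => v vs.
by rewrite h// in_cons vs orbT.
Qed.

Lemma normalized_le p m z : normalized p -> (size p <= m.+1)%N ->
  cmod p.[z] <= (1 + cmod z) ^+ m.
Proof.
move=> pn pm; rewrite normalized_horner// cmod_prod.
apply: le_trans (prod_seq_le (M := 1 + cmod z) _ _) _ => [w|].
  by rewrite nfactor_le andbT.
rewrite ler_weXn2l ?lerDl// -ltnS -size_zeros// normalized_neq0//.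
Qed.

Lemma normalized_ge p m z d : normalized p -> (size p <= m.+1)%N ->
    0 <= d <= 1 -> (forall w, root p w -> d <= cmod (z - w)) ->
  (d / (2 * (1 + cmod z))) ^+ m <= cmod p.[z].
Proof.
move=> pn pm d01 h; have p0 := normalized_neq0 pn.
have /andP[d0 d1] := d01.
have u0 : 0 <= d / (2 * (1 + cmod z)) by rewrite divr_ge0// mulr_ge0// addr_ge0.
rewrite normalized_horner// cmod_prod.
apply: le_trans (prod_seq_ge u0 _) => [|w]; last first.
  by rewrite -root_zeros// => /h; exact: nfactor_ge.
apply: ler_wiXn2l => //; last by rewrite -ltnS -size_zeros.
have := cmod_ge0 z => z0; rewrite ler_pdivrMr; lra.
Qed.

Lemma normalized_root_near p m z d : normalized p -> (size p <= m.+1)%N ->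
    0 < d <= 1 -> cmod p.[z] < (d / (2 * (1 + cmod z))) ^+ m ->
  exists2 w, root p w & cmod (z - w) < d.
Proof.
move=> pn pm /andP[d0 d1] h; apply: contrapT => hn.
have d01 : 0 <= d <= 1 by rewrite ltW.
suff /(normalized_ge pn pm d01) : forall w, root p w -> d <= cmod (z - w).
  by rewrite leNgt h.
move=> w pw; rewrite leNgt; apply/negP => zw; apply: hn; by exists w.
Qed.

Lemma normalized_le_near p m l z (s : R) : normalized p -> (size p <= m.+1)%N ->
  (l <= m)%N -> 0 <= s ->
  (l <= count (fun w => (cmod (z - w) <= s)%R) (zeros p))%N ->
  cmod p.[z] <= s ^+ l * (1 + cmod z) ^+ (m - l).
Proof.
move=> pn pm lm s0 hc; rewrite normalized_horner// cmod_prod.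
have : (size (zeros p) <= m)%N by rewrite -ltnS -size_zeros// normalized_neq0.
have z1 : 1 <= 1 + cmod z by rewrite lerDl.
elim: (zeros p) m l lm hc {pn pm} => [|w u ih] m l lm /=.
  rewrite leqn0 => /eqP -> _; rewrite big_nil expr0 mul1r subn0.
  by rewrite exprn_ege1.
case: m lm => // m lm; move=> + um; rewrite big_cons.
have P0 : 0 <= \prod_(j <- u) cmod (nfactor j z) by apply: prodr_ge0.
have [ws|_] := leP (cmod (z - w)) s; last first.
  rewrite add0n => hc; have lm' : (l <= m)%N.
    by apply: leq_trans hc (leq_trans (count_size _ _) um).
  rewrite subSn// exprS mulrCA ler_pM// ?nfactor_le//; exact: ih.
case: l lm => [|l] lm hc.
  rewrite expr0 mul1r subn0 exprS ler_pM// ?nfactor_le//.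
  by have := ih m 0%N isT isT um; rewrite expr0 mul1r subn0.
rewrite subSS exprS -mulrA ler_pM//; last exact: ih.
exact: le_trans (nfactor_le_dist _ _) ws.
Qed.

(** The radii closer than [u k] to some [v k i] form a set of Lebesgue measure at most
    [(b - a) / 2], by countable subadditivity; it cannot cover [[a, b]]. *)
Lemma radial_gap (v : nat -> nat -> R) m a b (u : nat -> R) :
    a < b -> (forall k, 0 <= u k) ->
    (forall N, \sum_(k < N) m%:R * (2 * u k) <= (b - a) / 2) ->
  exists2 t, a <= t <= b & forall k i, (i < m)%N -> u k <= `|t - v k i|.
Proof.
move=> ab u0 hu; apply: contrapT => hn.
pose I k i : set R := `]v k i - u k, v k i + u k[%classic.
have mI k i : measurable (I k i) by exact: measurable_itv.
pose U k := \big[setU/set0]_(i < m) I k i.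
have mU k : measurable (U k) by apply: bigsetU_measurable.
have lI k i : lebesgue_measure (I k i) = (2 * u k)%:E.
  rewrite lebesgue_measure_itv/= lte_fin; case: ltP => h.
    by rewrite -EFinB; congr EFin; ring.
  by congr EFin; apply/eqP; rewrite eq_sym mulf_eq0 pnatr_eq0/= eq_le u0 andbT; lra.
have lU k : (lebesgue_measure (U k) <= (m%:R * (2 * u k))%:E)%E.
  have := content_subadditive (@lebesgue_measure R) (fun i _ => mI k i) (mU k)
    (@subset_refl _ (U k)).
  move=> /le_trans; apply.
  apply: (@le_trans _ _ (\sum_(i < m) (2 * u k)%:E)%E).
    by apply: lee_sum => i _; rewrite [leLHS]lI.
  by rewrite sumEFin sumr_const card_ord (mulr_natl _ m).
have : (lebesgue_measure `[a, b]%classic <= \sum_(0 <= k <oo) lebesgue_measure (U k))%E.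
  apply: measure_sigma_subadditive => // t /=; rewrite in_itv/= => tab.
  apply: contrapT => ht; apply: hn; exists t => // k i im.
  rewrite leNgt; apply/negP => h; apply: ht; exists k => //.
  rewrite /U -(bigcup_mkord m (I k)); exists i => //=.
  by move: h; rewrite /I /= in_itv/= ltr_distl.
rewrite lebesgue_measure_itv/= lte_fin ab -EFinB leNgt => /negP; apply.
apply: (@le_lt_trans _ _ ((b - a) / 2)%:E); last by rewrite lte_fin; lra.
apply: lime_le; first by apply: is_cvg_nneseries.
apply: nearW => N; rewrite big_mkord.
apply: (@le_trans _ _ (\sum_(k < N) (m%:R * (2 * u k))%:E)%E).
  by apply: lee_sum => k _; exact: lU.
by rewrite sumEFin lee_fin.
Qed.

(** With truncated subtraction the exponent [(i - n) + (n - i)] is the distance of [i] and [n]. The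
    bound does not depend on the centre [n]. *)
Lemma sum_geo_dist (k : R) n N : 0 <= k -> k < 1 ->
  \sum_(i < N) k ^+ ((i - n) + (n - i)) <= 2 / (1 - k).
Proof.
move=> k0 k1; have k1' : 0 < 1 - k by lra.
have g a b : \sum_(a <= i < b) k ^+ i <= (1 - k)^-1.
  apply: le_trans (geo_sum_le a b k0 k1) _.
  by rewrite ler_piMl ?invr_ge0 ?(ltW k1')// exprn_ile1 ?(ltW k1).
rewrite -(big_mkord xpredT (fun i => k ^+ ((i - n) + (n - i)))).
apply: (@le_trans _ _ (\sum_(0 <= i < n + N) k ^+ ((i - n) + (n - i)))).
  rewrite [leRHS](big_cat_nat _ (n := N))//= ?leq_addl// lerDl.
  by rewrite sumr_ge0// => i _; rewrite exprn_ge0.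
rewrite (big_cat_nat _ (n := n))//= ?leq_addr//.
rewrite (_ : 2 / (1 - k) = (1 - k)^-1 + (1 - k)^-1); last by field; rewrite gt_eqF.
rewrite lerD//.
  rewrite big_nat_rev/= add0n.
  rewrite (eq_big_nat _ _ (F2 := fun i => k ^+ i.+1)).
    apply: le_trans (g 1%N n.+1); by rewrite big_add1.
  move=> i /andP[_ in_]; congr (_ ^+ _); lia.
rewrite -{1}[n]add0n big_addn addKn.
rewrite (eq_bigr (fun i => k ^+ i))// => i _; congr (_ ^+ _); lia.
Qed.

(** Around the modulus of each zero of [q k] an interval is excluded whose length decays
    geometrically with the distance of [k] and [n]. The total length is bounded independently of
    [n], so [delta] is uniform although the radius [t] depends on [n]. The rate [theta] can be as
    close to 1 as desired. *)
Lemma good_circle (q : nat -> {poly C}) m a b theta :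
    (forall k, normalized (q k) /\ (size (q k) <= m.+1)%N) ->
    0 < a -> a < b -> 0 < theta < 1 ->
  exists2 delta, 0 < delta & forall n, exists2 t, a <= t <= b &
    forall k z, cmod z = t ->
      delta * theta ^+ ((k - n) + (n - k)) <= cmod (q k).[z].
Proof.
move=> hq a0 ab /andP[th0 th1].
(* A product of at most [m] factors comparable to [th^d] must stay above [theta^d]. The root of
   order [m + 1], not [m], also covers [m = 0]. *)
pose th := theta `^ (m.+1%:R)^-1.
have thp : 0 < th by rewrite powR_gt0.
have thE : th ^+ m.+1 = theta.
  by rewrite -powR_mulrn ?ltW// -powRrM mulVf ?pnatr_eq0// powRr1// ltW.
have tlt1 : th < 1.
  rewrite ltNge; apply/negP => h; have := exprn_ege1 m.+1 h.
  by rewrite thE leNgt th1.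
have thm : theta <= th ^+ m by rewrite -thE exprS ler_piMl ?exprn_ge0// ltW.
(* The excluded length is at most [4 m eps / (1 - th)], which has to be at most [(b - a) / 2]. *)
pose eps := Num.min 1 ((b - a) * (1 - th) / (8 * m.+1%:R)).
have eps0 : 0 < eps.
  by rewrite lt_min ltr01 divr_gt0// ?mulr_gt0 ?subr_gt0// ltr0n.
have eps1 : eps <= 1 by rewrite ge_min lexx.
exists ((eps / (2 * (1 + b))) ^+ m).
  by rewrite exprn_gt0// divr_gt0// mulr_gt0// ltr_wpDl// (lt_trans a0).
move=> n; pose u k := eps * th ^+ ((k - n) + (n - k)).
have u0 k : 0 <= u k by rewrite mulr_ge0 ?exprn_ge0// ltW.
have [N|t tab ht] := @radial_gap
    (fun k i => cmod (nth 0 (zeros (q k)) i)) m a b u ab u0.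
  rewrite /u (eq_bigr (fun k : 'I_N =>
    m%:R * 2 * eps * th ^+ ((k - n) + (n - k)))); last by move=> k _; ring.
  rewrite -mulr_sumr.
  apply: le_trans (ler_wpM2l _ (sum_geo_dist n N (ltW thp) tlt1)) _.
    by rewrite !mulr_ge0 ?ler0n// ltW.
  have e1 : eps * (8 * m.+1%:R) <= (b - a) * (1 - th).
    by rewrite -ler_pdivlMr ?ge_min ?lexx ?orbT// mulr_gt0// ltr0n.
  rewrite mulrA ler_pdivrMr ?subr_gt0//.
  move: e1; rewrite -natr1; have : 0 <= m%:R :> R by rewrite ler0n.
  move: eps0; nra.
exists t => // k z zt; have [qn qs] := hq k; have /andP[ta tb] := tab.
have tk1 : th ^+ ((k - n) + (n - k)) <= 1 by rewrite exprn_ile1// ltW.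
have u01 : 0 <= u k <= 1 by rewrite u0 mulr_ile1// ?exprn_ge0// ltW.
apply: le_trans (normalized_ge qn qs u01 _).
  have t0 : 0 < t by exact: lt_le_trans a0 ta.
  have A0 : 0 < 2 * (1 + t) by lra.
  have B0 : 0 < 2 * (1 + b) by lra.
  rewrite zt /u mulrAC [leRHS]exprMn; apply: ler_pM.
  - by rewrite exprn_ge0// divr_ge0 ?(ltW eps0)// (ltW B0).
  - by rewrite exprn_ge0// ltW.
  - apply: lerXn2r; rewrite ?nnegrE ?divr_ge0 ?(ltW eps0) ?(ltW A0) ?(ltW B0)//.
    by rewrite ler_pM2l// lef_pV2 ?posrE//; lra.
  - rewrite -exprM mulnC exprM; apply: lerXn2r thm; rewrite nnegrE ?ltW//.
    by rewrite exprn_gt0.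
move=> w; rewrite root_zeros ?normalized_neq0// => wz.
have iw : (index w (zeros (q k)) < m)%N.
  rewrite -ltnS; apply: leq_trans qs; rewrite (size_zeros (normalized_neq0 qn)).
  by rewrite ltnS index_mem.
have := ht k _ iw; rewrite nth_index// -zt => h.
exact: le_trans h (cmod_dist_norm _ _).
Qed.
End NormalizedPolynomials.

(** * Degrees and order of contact after cancelling common factors *)

Section PadeAlgebra.
Variable R : realType.
Local Notation C := R[i].
Implicit Types (x y z w : C) (p q P Q S T : {poly C}) (phi : nat -> C).

Lemma poly_eq0_horner p : (forall z, p.[z] = 0) -> p = 0.
Proof.
move=> h; apply/polyP => i; rewrite coef0; apply/eqP; rewrite -cmod_eq0.
rewrite eq_le cmod_ge0 andbT -[leLHS]mulr1 -[X in _ * X](expr1n _ i).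
by apply: cauchy_coef => // z _; rewrite h cmod0.
Qed.

Lemma pmul_poly q phi N k : (k < N)%N ->
  pmul q phi k = (q * \poly_(i < N) phi i)`_k.
Proof.
move=> kN; rewrite coefM; apply: eq_bigr => i _.
by rewrite coef_poly (leq_ltn_trans (leq_subr _ _) kN).
Qed.

(** Cancelling a factor [S] that vanishes at 0 to the exact order [l] costs [l] orders of contact:
    the cofactor of ['X^l] in [S] has a nonzero constant term and can be divided out recursively. *)
Lemma coef_eq0_mup S T l n : dvdp 'X^l S -> ~~ dvdp 'X^(l.+1) S ->
    (forall k, (k <= n)%N -> (S * T)`_k = 0) ->
  forall k, (k + l <= n)%N -> T`_k = 0.
Proof.
move=> /dvdpP[S1 ->] hl h.
have S10 : S1`_0 != 0.
  rewrite -horner_coef0; apply: contra hl => /factor_theorem[S2 ->].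
  by rewrite subr0 -mulrA -exprS dvdp_mulIr.
have {}h k : (k + l <= n)%N -> (S1 * T)`_k = 0.
  move=> /h; rewrite mulrAC coefMXn ltnNge leq_addl /= addnK.
  by [].
move=> k; elim/ltn_ind: k => k ih kl; have := h k kl.
rewrite coefM big_ord_recl subn0 big1 => [|i _].
  by rewrite addr0 => /eqP; rewrite mulf_eq0 (negbTE S10) /= => /eqP.
have := ltn_ord i; rewrite /= /bump /= => ik; rewrite ih ?mulr0//; lia.
Qed.

Variables (phi : nat -> C) (n m ms : nat) (P Q p q : {poly C}).
Hypothesis nm : (m <= n)%N.
Hypothesis ms1 : (1 <= ms)%N.
Hypothesis hPQ : incomplete_pade phi n m ms P Q.
Hypothesis hpq : reduced_fraction P Q p q.

Lemma reduced_factor : exists S, [/\ P = p * S, Q = q * S & S != 0].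
Proof.
case: hpq hPQ => cop PqpQ qn [_ _ Q0 _]; have q0 := normalized_neq0 qn.
have : dvdp q Q.
  have <- : (q %| p * Q)%R = (q %| Q)%R by apply: Gauss_dvdpr; rewrite coprimep_sym.
  by rewrite -PqpQ dvdp_mull.
move=> /divpK QE; exists (Q %/ q); rewrite mulrC in QE; split => //.
  by apply: (mulIf q0); rewrite PqpQ -[in LHS]QE; ring.
by apply: contraNneq Q0 => Q'0; rewrite -QE Q'0 mulr0.
Qed.

Lemma pade_reduced :
  [/\ (size p <= n.+1)%N, (common_zero_order P Q + size q <= m.+1)%N &
   forall k, (k + common_zero_order P Q <= n)%N -> pmul q phi k = p`_k].
Proof.
have [S [PE QE S0]] := reduced_factor.
case: (hpq) (hPQ) => cop PqpQ qn [sP sQ Q0 hk]; have q0 := normalized_neq0 qn.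
(* As [p] and [q] are coprime, [gcdp P Q] is [S] up to a constant, so the common zero order is the
   order of [S] at 0. *)
have dS l : dvdp 'X^l (gcdp P Q) = dvdp 'X^l S.
  apply: eqp_dvdr; rewrite PE QE; apply: eqp_trans (gcdp_mul2r _ _ _) _.
  rewrite -[X in _ %= X]mul1r; by apply: eqp_mulr; rewrite gcdp_eqp1.
have g0 : gcdp P Q != 0 by rewrite gcdp_eq0 (negbTE Q0) andbF.
set l := common_zero_order P Q.
have lS : dvdp 'X^l S by rewrite -dS; have := mup_geq 0 l g0; rewrite subr0 leqnn => <-.
have lS1 : ~~ dvdp 'X^(l.+1) S.
  by rewrite -dS; have := mup_geq 0 l.+1 g0; rewrite subr0 ltnn => <-.
have sS : (l < size S)%N by have := dvdp_leq S0 lS; rewrite size_polyXn.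
split.
- have [->|p0] := eqVneq p 0; first by rewrite size_poly0.
  have := size_mul p0 S0; rewrite -PE => E.
  have : (0 < size p)%N by rewrite size_poly_gt0.
  move: sS sP; rewrite E; move: (size p) (size S) => a b; clear -a b; lia.
- have := size_mul q0 S0; rewrite -QE => E.
  have : (0 < size q)%N by rewrite size_poly_gt0.
  move: sS sQ; rewrite E; move: (size q) (size S) => a b; clear -a b; lia.
- move=> k kl; rewrite (@pmul_poly q phi n.+1); last lia.
  apply/eqP; rewrite -subr_eq0 -coefB; apply/eqP.
  apply: (coef_eq0_mup lS lS1 _ kl) => j jn.
  rewrite mulrBr mulrA [S * q]mulrC -QE [S * p]mulrC -PE coefB -pmul_poly//.
  by apply/eqP; rewrite subr_eq0; apply/eqP; exact: hk.
Qed.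
End PadeAlgebra.

(** * The difference formula as an identity valid at every point *)

Section Difference.
Variable R : realType.
Local Notation C := R[i].

(** The formula is given only where [z], [q] and [q'] do not vanish. The polynomial [D] multiplied
    by ['X * (q * q')] vanishes everywhere, hence [D] is 0. The bound on [l + l'] makes the exponent
    of [z] a natural number. *)
Lemma difference_poly (p q p' q' qs : {poly C}) (l l' n : nat) (a : C) :
    q != 0 -> q' != 0 -> (l + l' <= n)%N ->
    difference_formula p q p' q' l l' n a qs ->
  forall z, p'.[z] * q.[z] - p.[z] * q'.[z] = a * z ^+ (n.+1 - l - l') * qs.[z].
Proof.
move=> q0 q'0 ln h z.
pose D := p' * q - p * q' - a *: ('X^(n.+1 - l - l') * qs).
have DE y : D.[y] =
    p'.[y] * q.[y] - p.[y] * q'.[y] - a * y ^+ (n.+1 - l - l') * qs.[y].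
  by rewrite /D !hornerE ?mulrA.
suff D0 : D = 0.
  by apply/eqP; rewrite -subr_eq0 -DE D0 horner0.
have X0 : 'X * (q * q') != 0 by rewrite !mulf_neq0// polyX_eq0.
apply: (mulIf X0); rewrite mul0r; apply: poly_eq0_horner => {}z.
rewrite hornerM [X in _ * X]hornerM hornerX [X in _ * (_ * X)]hornerM.
have [->|z0] := eqVneq z 0; first by rewrite mul0r mulr0.
have [->|qz] := eqVneq q.[z] 0; first by rewrite mul0r !mulr0.
have [->|q'z] := eqVneq q'.[z] 0; first by rewrite !mulr0.
suff -> : D.[z] = 0 by rewrite mul0r.
have := h z z0 qz q'z.
have -> : n.+1%:Z - l%:Z - l'%:Z = ((n.+1 - l - l')%N : int) by lia.
rewrite -exprnP DE => E; apply/eqP; rewrite subr_eq0; apply/eqP.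
have -> : p'.[z] * q.[z] - p.[z] * q'.[z] =
  (p'.[z] / q'.[z] - p.[z] / q.[z]) * (q.[z] * q'.[z]) by field; rewrite qz.
by rewrite E divfK// mulf_neq0.
Qed.
End Difference.

(* The data of the theorem from an index [N0] on, where the common zero orders
   no longer exceed the exponent of [z]; [a n] is [B_n^* / rho^n]. *)
Record pade_row (R : realType) (phi : nat -> R[i]) (m : nat)
    (p q qs : nat -> {poly R[i]}) (A : nat -> R[i]) (lam : nat -> nat)
    (rho : R) (a : nat -> R) (N0 : nat) : Prop := PadeRow {
  row_rho : 0 < rho;
  row_N0 : (2 * m < N0)%N;
  row_q : forall n, (N0 <= n)%N -> normalized (q n) /\ (size (q n) <= m.+1)%N;
  row_qs : forall n, (N0 <= n)%N -> normalized (qs n) /\ (size (qs n) <= m.+1)%N;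
  row_p : forall n, (N0 <= n)%N -> (size (p n) <= n.+1)%N;
  row_lam : forall n, (N0 <= n)%N -> (lam n + size (q n) <= m.+1)%N;
  row_coef : forall n k, (N0 <= n)%N -> (k + lam n <= n)%N ->
    pmul (q n) phi k = (p n)`_k;
  row_diff : forall n z, (N0 <= n)%N ->
    (p n.+1).[z] * (q n).[z] - (p n).[z] * (q n.+1).[z] =
    A n * z ^+ (n.+1 - lam n - lam n.+1) * (qs n).[z];
  row_a : forall n, (N0 <= n)%N -> 0 < a n;
  row_A : forall n, (N0 <= n)%N -> cmod (A n) <= a n;
  row_ratio : forall e, 0 < e -> exists K, forall n, (K <= n)%N ->
    `|a n / a n.+1 - rho| < e }.

(** * Growth of [a] and the size of [p n] outside the disk *)

Section Row.
Variables (R : realType) (phi : nat -> R[i]) (m : nat).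
Variables (p q qs : nat -> {poly R[i]}) (A : nat -> R[i]) (lam : nat -> nat).
Variables (rho : R) (a : nat -> R) (N0 : nat).
Hypothesis row : pade_row phi m p q qs A lam rho a N0.
Local Notation C := R[i].
Implicit Types (z : C) (t x y kap theta delta : R) (n k : nat).

Lemma row_lam_le n : (N0 <= n)%N -> (lam n <= m)%N.
Proof.
move=> n0; have := row_lam row n0; have [/normalized_neq0 q0 _] := row_q row n0.
by move: q0; rewrite -size_poly_gt0; lia.
Qed.

Lemma ratio_le kap : rho^-1 < kap -> exists2 K, (N0 <= K)%N &
  forall k j, (K <= k)%N -> a (k + j)%N <= a k * kap ^+ j.
Proof.
have rho0 := row_rho row => hk; have k0 : 0 < kap by apply: lt_trans hk; rewrite invr_gt0.
have krho : kap^-1 < rho by rewrite -[rho]invrK ltf_pV2// posrE invr_gt0.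
have [K hK] := row_ratio row (e := rho - kap^-1) ltac:(by rewrite subr_gt0).
exists (maxn K N0) => [|k j]; first by rewrite leq_maxr.
rewrite geq_max => /andP[Kk N0k]; elim: j => [|j ih].
  by rewrite addn0 expr0 mulr1.
have kj : (N0 <= k + j)%N by lia.
have a1 : 0 < a (k + j).+1 by apply: (row_a row); lia.
have := hK (k + j)%N ltac:(lia); rewrite ltr_distl => /andP[+ _].
rewrite subKr ltr_pdivlMr// mulrC ltr_pdivrMr// => /ltW h.
by rewrite addnS (le_trans h)// exprSr mulrA ler_wpM2r// ltW.
Qed.

Lemma ratio_ge kap : 0 < kap < rho^-1 -> exists2 K, (N0 <= K)%N &
  forall k j, (K <= k)%N -> a k * kap ^+ j <= a (k + j)%N.
Proof.
have rho0 := row_rho row => /andP[k0 hk].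
have krho : rho < kap^-1 by rewrite -[rho]invrK ltf_pV2// posrE invr_gt0.
have [K hK] := row_ratio row (e := kap^-1 - rho) ltac:(by rewrite subr_gt0).
exists (maxn K N0) => [|k j]; first by rewrite leq_maxr.
rewrite geq_max => /andP[Kk N0k]; elim: j => [|j ih].
  by rewrite addn0 expr0 mulr1.
have kj : (N0 <= k + j)%N by lia.
have a1 : 0 < a (k + j).+1 by apply: (row_a row); lia.
have := hK (k + j)%N ltac:(lia); rewrite ltr_distl => /andP[_].
rewrite addrC subrK ltr_pdivrMr// mulrC ltr_pdivlMr// => /ltW h.
by rewrite addnS (le_trans _ h)// exprSr mulrA ler_wpM2r// ltW.
Qed.

(** On [x <= |z| <= y] the factor [(1 + y)^m] bounds [qs n]; the other factors compare
    [z^(n + 1 - lam n - lam n.+1)] with [z^n], the shift being between [- 2 m] and 1. *)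
Definition term_cst x y : R := (1 + y) ^+ m.+1 * (1 + x^-1) ^+ (2 * m).

Lemma term_cst_ge0 x y : 0 <= x -> 0 <= y -> 0 <= term_cst x y.
Proof. by move=> x0 y0; rewrite mulr_ge0 ?exprn_ge0 ?addr_ge0 ?invr_ge0. Qed.

Lemma diff_bound n z x y : (N0 <= n)%N -> 0 < x -> x <= cmod z <= y ->
  cmod ((p n.+1).[z] * (q n).[z] - (p n).[z] * (q n.+1).[z]) <=
  term_cst x y * (a n * cmod z ^+ n).
Proof.
move=> n0 x0 /andP[xz zy]; rewrite (row_diff row)// !cmodM cmodX.
have [qsn qss] := row_qs row n0; have hqs := normalized_le z qsn qss.
have l1 := row_lam_le n0; have l2 := row_lam_le (leqW n0).
set L := (lam n + lam n.+1)%N; have N2 := row_N0 row.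
have -> : (n.+1 - lam n - lam n.+1 = n.+1 - L)%N by rewrite subnDA.
have Ln : (L <= n)%N by rewrite /L; lia.
have z0 : 0 < cmod z by exact: lt_le_trans xz.
have y0 : 0 < y by exact: lt_le_trans zy.
have i0 : 0 < x^-1 by rewrite invr_gt0.
have zL : cmod z ^+ (n.+1 - L) <= cmod z ^+ n * ((1 + y) * (1 + x^-1) ^+ (2 * m)).
  have -> : cmod z ^+ (n.+1 - L) = cmod z ^+ n * cmod z * (cmod z)^-1 ^+ L.
    apply: (mulIf (x := cmod z ^+ L)); first by rewrite expf_neq0// gt_eqF.
    rewrite -exprD subnK; last by rewrite leqW.
    by rewrite -exprSr -mulrA -exprMn mulVf ?gt_eqF// expr1n mulr1.
  rewrite -!mulrA ler_pM2l ?exprn_gt0//; apply: ler_pM; rewrite ?exprn_ge0 ?invr_ge0//.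
    by rewrite (le_trans zy)// lerDr.
  apply: (@le_trans _ _ ((1 + x^-1) ^+ L)).
    apply: lerXn2r; rewrite ?nnegrE ?invr_ge0 ?(addr_ge0 ler01 (ltW i0))//.
    by apply: (@le_trans _ _ x^-1); rewrite ?lerDr// lef_pV2.
  apply: ler_weXn2l; first by rewrite lerDl ltW.
  by rewrite /L; lia.
have hqs' : cmod (qs n).[z] <= (1 + y) ^+ m.
  apply: le_trans hqs _; apply: lerXn2r; rewrite ?nnegrE ?addr_ge0 ?(ltW y0)//.
  by rewrite lerD2l.
have -> : term_cst x y * (a n * cmod z ^+ n) =
  a n * (cmod z ^+ n * ((1 + y) * (1 + x^-1) ^+ (2 * m))) * (1 + y) ^+ m.
  by rewrite /term_cst exprS; ring.
apply: ler_pM; rewrite ?mulr_ge0 ?exprn_ge0//.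
by apply: ler_pM; rewrite ?exprn_ge0//; exact: (row_A row).
Qed.

Lemma term_bound n z x y : (N0 <= n)%N -> 0 < x -> x <= cmod z <= y ->
    (q n).[z] != 0 -> (q n.+1).[z] != 0 ->
  cmod ((p n.+1).[z] / (q n.+1).[z] - (p n).[z] / (q n).[z]) <=
  term_cst x y * (a n * cmod z ^+ n) / (cmod (q n).[z] * cmod (q n.+1).[z]).
Proof.
move=> n0 x0 xzy q0 q1.
rewrite ler_pdivlMr ?mulr_gt0 ?cmod_gt0//.
apply: le_trans (diff_bound n0 x0 xzy).
rewrite -!cmodM; apply: eq_ler; congr cmod; field; exact/andP.
Qed.

Lemma row_telescope n k z : (k <= n)%N ->
  (p n).[z] / (q n).[z] - (p k).[z] / (q k).[z] =
  \sum_(k <= i < n) ((p i.+1).[z] / (q i.+1).[z] - (p i).[z] / (q i).[z]).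
Proof. by move=> kn; rewrite telescope_sumr. Qed.

Lemma row_circle x y theta : 0 < x -> x < y -> 0 < theta < 1 ->
  exists2 delta, 0 < delta & forall n, (N0 <= n)%N -> exists2 t, x <= t <= y &
    forall k z, (N0 <= k)%N -> cmod z = t ->
      delta * theta ^+ ((k - n) + (n - k)) <= cmod (q k).[z].
Proof.
move=> x0 xy th; have [|delta d0 h] := @good_circle R (fun k => q (maxn N0 k)) m x y theta _ x0 xy th.
  by move=> k; apply: (row_q row); rewrite leq_maxl.
exists delta => // n n0; have [t txy ht] := h n; exists t => // k z k0 zt.
by have := ht k z zt; rewrite (maxn_idPr k0).
Qed.

(* On a circle avoiding the zeros of all [q k] at a geometric rate the
   telescoped series is dominated by its last term. *)
Lemma p_exterior_bound x y : rho < x -> x < y ->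
  exists2 M, 0 <= M & exists2 K, (N0 <= K)%N & forall n, (K <= n)%N ->
    exists2 t, x <= t <= y & forall z, cmod z = t ->
      cmod (p n).[z] <= M * (a n * t ^+ n).
Proof.
move=> rx xy; have rho0 := row_rho row; have x0 := lt_trans rho0 rx.
have y0 := lt_trans x0 xy.
(* With [kap] strictly between [1 / x] and [1 / rho], the quantities [a k * t^k] grow at least like
   [s^k] for [t >= x], where [s = kap * x > 1]. *)
pose kap := (rho^-1 + x^-1) / 2.
have ix : 0 < x^-1 by rewrite invr_gt0.
have xr : x^-1 < rho^-1 by rewrite ltf_pV2.
have kr : kap < rho^-1 by rewrite /kap; lra.
have kx : x^-1 < kap by rewrite /kap; lra.
have k0 : 0 < kap by exact: lt_trans kx.
pose s := kap * x; have s1 : 1 < s by rewrite /s -ltr_pdivrMr// mul1r.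
(* The two denominators of a term lose [theta^2] per index, which must stay below the gain [s];
   [theta^2 * s > 1] holds by the strict inequality of the means. *)
pose theta := (1 + s^-1) / 2.
have s0 : 0 < s by exact: lt_trans s1.
have is1 : s^-1 < 1 by rewrite invf_lt1.
have is0 : 0 < s^-1 by rewrite invr_gt0.
have th0 : 0 < theta by rewrite /theta; lra.
have th1 : theta < 1 by rewrite /theta; lra.
pose u := (theta ^+ 2 * s)^-1.
have th2s : 1 < theta ^+ 2 * s.
  have ss : s^-1 * s = 1 by rewrite mulVf// gt_eqF.
  have : 0 < (s - 1) ^+ 2 by rewrite exprn_gt0// subr_gt0.
  rewrite /theta; move: (s^-1) ss is0 is1 s1 => v; rewrite !expr2; nra.
have u0 : 0 < u by rewrite invr_gt0 (lt_trans ltr01).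
have u1 : u < 1 by rewrite invf_lt1// (lt_trans ltr01).
have [|delta d0 hd] := @row_circle x y theta x0 xy; first by rewrite th0.
have [|K N0K hK] := @ratio_ge kap; first by rewrite k0.
have [B B0 hB] := poly_bounded (p K) 0 y.
have aK : 0 < a K by apply: (row_a row).
pose Cx := term_cst x y.
have Cx0 : 0 <= Cx by apply: term_cst_ge0; exact: ltW.
pose M1 := B / delta / (a K * x ^+ K) + Cx / (delta ^+ 2 * theta) * (1 / (1 - u)).
have M10 : 0 <= M1.
  by rewrite /M1; pos.
exists ((1 + y) ^+ m * M1); first by pos.
exists K => // n Kn; have n0 := leq_trans N0K Kn.
have [t txy ht] := hd n n0; exists t => // z zt; have /andP[tx ty] := txy.
have t0 : 0 < t by exact: lt_le_trans tx.
have an : 0 < a n by exact: (row_a row).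
have qlow k : (K <= k <= n)%N -> delta * theta ^+ (n - k) <= cmod (q k).[z].
  move=> /andP[Kk kn]; have := ht k z (leq_trans N0K Kk) zt.
  by have -> : (k - n + (n - k) = n - k)%N by nlia.
have dth k : 0 < delta * theta ^+ k by rewrite mulr_gt0// exprn_gt0.
have qne k : (K <= k <= n)%N -> (q k).[z] != 0.
  by move=> /qlow h; rewrite -cmod_gt0; exact: lt_le_trans h.
have ank k : (K <= k <= n)%N -> a k * t ^+ k * s ^+ (n - k) <= a n * t ^+ n.
  move=> /andP[Kk kn]; have := hK k (n - k)%N Kk; rewrite subnKC// => h.
  have -> : t ^+ n = t ^+ (n - k) * t ^+ k by rewrite -exprD subnK.
  rewrite mulrA [leLHS]mulrAC ler_pM2r ?exprn_gt0//.
  apply: (@le_trans _ _ (a k * kap ^+ (n - k) * t ^+ (n - k))).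
    rewrite -mulrA -exprMn ler_wpM2l ?(ltW (row_a row (leq_trans N0K Kk)))//.
    by apply: lerXn2r; rewrite ?nnegrE /s; [pos|pos|rewrite ler_pM2l].
  by rewrite ler_wpM2r// exprn_ge0// ltW.
have main : cmod ((p n).[z] / (q n).[z]) <= M1 * (a n * t ^+ n).
  rewrite -(subrK ((p K).[z] / (q K).[z]) ((p n).[z] / (q n).[z])).
  rewrite (le_trans (cmodD _ _))// row_telescope// addrC /M1 mulrDl lerD//.
    have hKn := ank K ltac:(nlia).
    rewrite cmodM cmodV ler_pdivrMr ?cmod_gt0 ?qne ?leqnn//.
    apply: le_trans (hB z _) _; first by rewrite subr0 zt.
    apply: (@le_trans _ _ (B / delta / (a K * x ^+ K) * (a n * t ^+ n) * (delta * theta ^+ (n - K)))); last first.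
      by apply: ler_wpM2l; [pos|apply: qlow; nlia].
    have -> : B / delta / (a K * x ^+ K) * (a n * t ^+ n) * (delta * theta ^+ (n - K)) =
      B * ((a n * t ^+ n * theta ^+ (n - K)) / (a K * x ^+ K)).
      by field; rewrite !gt_eqF ?exprn_gt0.
    rewrite -[leLHS]mulr1 ler_wpM2l// ler_pdivlMr ?mulr_gt0 ?exprn_gt0// mul1r.
    apply: (@le_trans _ _ (a K * t ^+ K)).
      by rewrite ler_pM2l//; apply: lerXn2r; rewrite ?nnegrE; [pos|pos|].
    apply: le_trans (ler_wpM2r (exprn_ge0 _ (ltW th0)) hKn).
    rewrite -[leRHS]mulrA -exprMn; apply: ler_peMr; first by pos.
    rewrite exprn_ege1//; apply: ltW; apply: lt_le_trans th2s _.
    by rewrite expr2 -mulrA [leRHS]mulrC ler_piMl//; [pos|exact: ltW].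
  apply: le_trans (cmod_sum _ _ _) _.
  apply: (@le_trans _ _ (\sum_(K <= i < n) Cx / (delta ^+ 2 * theta) * (a n * t ^+ n) * u ^+ (n - i.+1))).
    apply: ler_sum_nat => i /andP[Ki iN].
    have i1 : (K <= i <= n)%N by rewrite Ki ltnW.
    have i2 : (K <= i.+1 <= n)%N by rewrite leqW.
    have xzy : x <= cmod z <= y by rewrite zt.
    apply: le_trans (term_bound (leq_trans N0K Ki) x0 xzy (qne _ i1) (qne _ i2)) _.
    rewrite zt -/Cx ler_pdivrMr ?mulr_gt0 ?cmod_gt0 ?qne//.
    have h1 := qlow _ i1; have h2 := qlow _ i2; have h3 := ank _ i1.
    have h4 : delta ^+ 2 * theta * theta ^+ 2 ^+ (n - i.+1) <=
        cmod (q i).[z] * cmod (q i.+1).[z].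
      apply: le_trans (ler_pM (ltW (dth _)) (ltW (dth _)) h1 h2).
      have -> : (n - i = (n - i.+1).+1)%N by nlia.
      apply: eq_ler; move: (n - i.+1)%N => j.
      by rewrite [theta ^+ j.+1]exprS exprAC [(theta ^+ j) ^+ 2]expr2; ring.
    apply: (@le_trans _ _ (Cx / (delta ^+ 2 * theta) * (a n * t ^+ n) * u ^+ (n - i.+1) *
       (delta ^+ 2 * theta * theta ^+ 2 ^+ (n - i.+1)))); last first.
      by apply: ler_wpM2l => //; pos.
    have -> : Cx / (delta ^+ 2 * theta) * (a n * t ^+ n) * u ^+ (n - i.+1) *
       (delta ^+ 2 * theta * theta ^+ 2 ^+ (n - i.+1)) =
       Cx * ((a n * t ^+ n) / s ^+ (n - i.+1)).
      have uJ : u ^+ (n - i.+1) * theta ^+ 2 ^+ (n - i.+1) = (s ^+ (n - i.+1))^-1.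
        by rewrite -exprMn /u invfM mulrAC mulVf ?mul1r ?exprVn// expf_neq0// gt_eqF.
      rewrite -uJ; move: (u ^+ _) (theta ^+ 2 ^+ _) (a n * t ^+ n) => e1 e2 e3.
      by field; rewrite !gt_eqF.
    rewrite ler_wpM2l// ler_pdivlMr ?exprn_gt0//; apply: le_trans h3.
    apply: ler_wpM2l; first by have := row_a row (leq_trans N0K Ki) => ?; pos.
    by apply: ler_weXn2l; [exact: ltW|nlia].
  rewrite -mulr_sumr [leRHS]mulrAC ler_wpM2l//.
    by rewrite //; pos.
  apply: le_trans (geo_sum_le 0 (n - K) (ltW u0) u1).
  rewrite -{1}[K]add0n big_addn big_nat_rev /= add0n.
  by apply: ler_sum_nat => i iK; apply: eq_ler; congr (_ ^+ _); nlia.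
have [qn qsz] := row_q row n0.
rewrite -[(p n).[z]](divfK (qne n _)) ?Kn ?leqnn// cmodM mulrC -mulrA.
apply: ler_pM => //; apply: le_trans (normalized_le z qn qsz) _.
apply: lerXn2r; rewrite ?nnegrE ?addr_ge0 ?(ltW y0)//.
by rewrite zt lerD2l.
Qed.
End Row.

(** * From small values of normalized polynomials to nearby zeros and back *)

Section NormalizedRoots.
Variable R : realType.
Local Notation C := R[i].
Implicit Types (z w zeta : C) (p : {poly C}) (e : R).

Lemma normalized_le_root p m z w : normalized p -> (size p <= m.+1)%N ->
  root p w -> cmod p.[z] <= cmod (z - w) * (1 + cmod z) ^+ m.
Proof.
move=> pn pm pw; have p0 := normalized_neq0 pn.
have z1 : 1 <= 1 + cmod z by rewrite lerDl.
have hc : (1 <= count (fun v => (cmod (z - v) <= cmod (z - w))%R) (zeros p))%N.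
  by rewrite -has_count; apply/hasP; exists w; rewrite -?root_zeros.
have m1 : (1 <= m)%N.
  apply: leq_trans hc _; apply: leq_trans (count_size _ _) _.
  by rewrite -ltnS -size_zeros.
apply: le_trans (normalized_le_near pn pm m1 (cmod_ge0 _) hc) _.
rewrite expr1 ler_wpM2l//; apply: ler_weXn2l => //; exact: leq_subr.
Qed.

(** The threshold [eta] depends on [m], [zeta] and [e] only, so it serves all the polynomials [qs n]
    at once. *)
Lemma roots_of_small m zeta e : 0 < e -> exists2 eta, 0 < eta &
  forall p z, normalized p -> (size p <= m.+1)%N -> cmod (z - zeta) <= e / 2 ->
    cmod p.[z] < eta -> exists2 w, root p w & cmod (zeta - w) < e.
Proof.
move=> e0; pose d := Num.min 1 (e / 2).
have d0 : 0 < d by rewrite lt_min ltr01 divr_gt0.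
have d1 : d <= 1 by rewrite ge_min lexx.
have de : d <= e / 2 by rewrite ge_min lexx orbT.
clearbody d; have z0 := cmod_ge0 zeta.
exists ((d / (2 * (1 + (cmod zeta + e)))) ^+ m); first by pos.
move=> p z pn pm ze hp; have z0' := cmod_ge0 z.
have [||w pw zw] := @normalized_root_near R p m z d pn pm; first by rewrite d0.
  apply: lt_le_trans hp _; apply: lerXn2r; rewrite ?nnegrE; [pos|pos|].
  rewrite ler_pM2l// lef_pV2 ?posrE; [|pos|pos].
  have := cmod_dist z zeta; lra.
exists w => //; have := cmod_tri zeta z w; rewrite cmodBC in ze; lra.
Qed.
End NormalizedRoots.

(** * Limit points of zeros outside the closed disk *)

Section Exterior.
Variables (R : realType) (phi : nat -> R[i]) (m : nat).
Variables (p q qs : nat -> {poly R[i]}) (A : nat -> R[i]) (lam : nat -> nat).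
Variables (rho : R) (a : nat -> R) (N0 : nat).
Hypothesis row : pade_row phi m p q qs A lam rho a N0.
Local Notation C := R[i].
Implicit Types (z w zeta : C) (t x y e : R) (n k : nat).

(** Distance to the zero set tending to 0 along [S]; [setT] gives the hypothesis on [q], and a
    superset of [Lambda] gives the conclusion for [qs]. *)
Definition roots_tend (r : nat -> {poly C}) (S : set nat) zeta :=
  forall e, 0 < e -> exists N, forall n, (N <= n)%N -> S n ->
    exists2 w, root (r n) w & cmod (zeta - w) < e.

Lemma roots_tend_small S zeta eta : roots_tend q S zeta -> 0 < eta ->
  exists2 d, 0 < d & exists2 N, (N0 <= N)%N & forall n z, (N <= n)%N -> S n ->
    cmod (z - zeta) < d -> cmod (q n).[z] <= eta.
Proof.
move=> hz eta0; pose B := (2 + cmod zeta) ^+ m.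
have B0 : 0 < B by have := cmod_ge0 zeta => h; rewrite /B; pos.
pose d := Num.min 1 (eta / (2 * B)).
have d0 : 0 < d by rewrite lt_min ltr01; apply: divr_gt0; pos.
have d1 : d <= 1 by rewrite ge_min lexx.
have dB : d * (2 * B) <= eta by rewrite -ler_pdivlMr ?ge_min ?lexx ?orbT//; pos.
exists d => //; have [N hN] := hz d d0.
exists (maxn N0 N); first exact: leq_maxl.
move=> n z; rewrite geq_max => /andP[n0 Nn] Sn zd.
have [w qw wd] := hN n Nn Sn; have [qn qm] := row_q row n0.
apply: le_trans (normalized_le_root z qn qm qw) (le_trans _ dB).
have zw : cmod (z - w) <= 2 * d by have := cmod_tri z zeta w; lra.
rewrite mulrCA mulrA; apply: ler_pM => //; first by have := cmod_ge0 z => h; pos.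
have h1 := cmod_dist z zeta; have h2 := cmod_ge0 zeta; have h3 := cmod_ge0 z.
by apply: lerXn2r; rewrite ?nnegrE; lra.
Qed.

Lemma expr_shift (x : R) n L : 0 < x -> (L <= 2 * m)%N -> (2 * m <= n)%N ->
  x ^+ n <= (1 + x^-1) * (1 + x) ^+ (2 * m) * x ^+ (n.+1 - L).
Proof.
move=> x0 Lm mn; have i0 : 0 < x^-1 by rewrite invr_gt0.
have -> : x ^+ n = x^-1 * x ^+ L * x ^+ (n.+1 - L).
  rewrite -mulrA -exprD subnKC; last by nlia.
  by rewrite exprS mulrA mulVf ?mul1r// gt_eqF.
rewrite ler_wpM2r//; first by pos.
apply: ler_pM; rewrite ?exprn_ge0 ?(ltW x0) ?(ltW i0)// ?lerDr//.
apply: (@le_trans _ _ ((1 + x) ^+ L)).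
  by apply: lerXn2r; rewrite ?nnegrE ?lerDr//; pos.
by apply: ler_weXn2l => //; rewrite lerDl ltW.
Qed.

Lemma mulr_half_inv_lt (u v : R) : 0 <= u -> 0 < v -> u * (v / (2 * (u + 1))) < v.
Proof.
move=> u0 v0; have u1 : 0 < 2 * (u + 1) by rewrite mulr_gt0// ltr_wpDl.
by rewrite mulrA ltr_pdivrMr// mulrC ltr_pM2l//; lra.
Qed.

(** At a zero [w] of [q n] near [zeta] the left-hand side of the identity is reduced to
    [- p n * q n.+1]. Here [p n] is [O(a n * |w|^n)] and [q n.+1] is small, while [A n] is
    comparable to [a n]; so [qs n] is small at [w]. *)
Lemma exterior_roots c zeta : 0 < c -> rho < cmod zeta ->
  roots_tend q setT zeta ->
  roots_tend qs [set n | c * a n <= cmod (A n)] zeta.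
Proof.
move=> c0 rz hz e e0; have rho0 := row_rho row.
(* The bound for [p n] is known on a circle between [x] and [y]. Since [y < y' < |w|], Cauchy's
   estimates for the coefficients of [p n] can be summed at [w] with ratio [y / y']. *)
pose x := (2 * rho + cmod zeta) / 3; pose y := (rho + 2 * cmod zeta) / 3.
pose y' := (rho + 5 * cmod zeta) / 6.
have rx : rho < x by rewrite /x; lra.
have xy : x < y by rewrite /x /y; lra.
have yy' : y < y' by rewrite /y /y'; lra.
have y'z : y' < cmod zeta by rewrite /y'; lra.
clearbody x y y'.
have x0 : 0 < x by lra. have y0 : 0 < y by lra. have y'0 : 0 < y' by lra.
have yy1 : y / y' < 1 by rewrite ltr_pdivrMr// mul1r.
have [M M0 [K N0K hK]] := p_exterior_bound row rx xy.
have [eta eta0 heta] := roots_of_small m zeta e0.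
pose G := (1 + x^-1) * (2 + cmod zeta) ^+ (2 * m).
have z0 := cmod_ge0 zeta.
have G0 : 0 < G by rewrite /G; pos.
pose M2 := M / (1 - y / y').
have M20 : 0 <= M2 by rewrite /M2; pos.
pose eta' := eta * c / (2 * (M2 * G + 1)).
have eta'0 : 0 < eta' by rewrite /eta'; pos.
have [d d0 [N N0N hN]] := roots_tend_small hz eta'0.
pose r := Num.min d (Num.min 1 (Num.min (e / 2) (cmod zeta - y'))).
have r0 : 0 < r by rewrite !lt_min d0 ltr01 divr_gt0// subr_gt0.
have rd : r <= d by rewrite ge_min lexx.
have r1 : r <= 1 by rewrite !ge_min lexx !orbT.
have re : r <= e / 2 by rewrite !ge_min lexx !orbT.
have ry : r <= cmod zeta - y' by rewrite !ge_min lexx !orbT.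
clearbody r; have [N' hN'] := hz r r0.
exists (maxn K (maxn N N')) => n; rewrite !geq_max => /and3P[Kn Nn N'n] /= cA.
have n0 := leq_trans N0K Kn; have an := row_a row n0.
have [w qw zw] := hN' n N'n I.
have wz : cmod (w - zeta) < r by rewrite cmodBC.
have wy' : y' < cmod w by have := cmod_dist zeta w; lra.
have w0 : 0 < cmod w by lra.
have w1 : cmod w <= 1 + cmod zeta by have := cmod_dist w zeta; lra.
have qn1 : cmod (q n.+1).[w] <= eta' by apply: hN => //; [exact: leqW|lra].
have [t /andP[xt ty] ht] := hK n Kn.
have t0 : 0 < t := lt_le_trans x0 xt.
have pw : cmod (p n).[w] <= M2 * (a n * cmod w ^+ n).
  apply: le_trans (cmod_horner _ _) _.
  apply: (@le_trans _ _ (\sum_(i < n.+1) M * (a n * cmod w ^+ n) * (y / y') ^+ (n - i))).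
    rewrite -(big_mkord xpredT (fun i => cmod (p n)`_i * cmod w ^+ i)).
    rewrite -(big_mkord xpredT (fun i => M * (a n * cmod w ^+ n) * (y / y') ^+ (n - i))).
    have sp := row_p row n0.
    rewrite [leRHS](big_cat_nat _ (n := size (p n)))//= -[leLHS]addr0 lerD//; last first.
      by apply: sumr_ge0 => i _; pos.
    apply: ler_sum_nat => i /andP[_ ip].
    have iN : (i <= n)%N by rewrite -ltnS (leq_trans ip).
    have hc := cauchy_coef i (ltW t0) ht.
    have hc' : cmod (p n)`_i <= M * a n * t ^+ (n - i).
      rewrite -(ler_pM2r (x := t ^+ i)) ?exprn_gt0// (le_trans hc)//.
      by rewrite -!mulrA -exprD subnK.
    apply: le_trans (ler_wpM2r (exprn_ge0 i (ltW w0)) hc') _.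
    have -> : cmod w ^+ n = cmod w ^+ (n - i) * cmod w ^+ i by rewrite -exprD subnK.
    have tw : t ^+ (n - i) <= cmod w ^+ (n - i) * (y / y') ^+ (n - i).
      rewrite -exprMn; apply: lerXn2r; rewrite ?nnegrE; [pos|pos|].
      rewrite mulrA ler_pdivlMr// [cmod w * y]mulrC.
      by apply: ler_pM => //; exact: ltW.
    have := ler_wpM2l (_ : 0 <= M * a n * cmod w ^+ i) tw => /(_ ltac:(pos)).
    move: (t ^+ _) (cmod w ^+ (n - i)) (cmod w ^+ i) ((y / y') ^+ _) => e1 e2 e3 e4; lra.
  rewrite -mulr_sumr /M2 [leRHS]mulrAC ler_wpM2l//; first by pos.
  rewrite -(big_mkord xpredT (fun i => (y / y') ^+ (n - i))).
  apply: (@le_trans _ _ (\sum_(0 <= i < n.+1) (y / y') ^+ i)).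
    rewrite big_nat_rev /= add0n; apply: ler_sum_nat => i iN; apply: eq_ler.
    by congr (_ ^+ _); nlia.
  apply: le_trans (geo_sum_le 0 n.+1 _ yy1) _; first by pos.
  by rewrite expr0 mul1r.
have [qsn qsm] := row_qs row n0.
apply: (heta (qs n) w qsn qsm); first by lra.
have := row_diff row w n0; rewrite (rootP qw) mulr0 sub0r => /(congr1 (@cmod R)).
rewrite cmodN !cmodM cmodX -subnDA => E.
set L := (lam n + lam n.+1)%N in E.
have l1 := row_lam_le row n0; have l2 := row_lam_le row (leqW n0).
have Lm : (L <= 2 * m)%N by rewrite /L; nlia.
have mn : (2 * m <= n)%N by have := row_N0 row; nlia.
have hG : cmod w ^+ n <= G * cmod w ^+ (n.+1 - L).
  apply: le_trans (expr_shift w0 Lm mn) _; rewrite ler_wpM2r//; first by pos.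
  apply: ler_pM; rewrite ?exprn_ge0 ?addr_ge0 ?invr_ge0//.
    by rewrite lerD2l lef_pV2 ?posrE//; exact: ltW (lt_trans xy (lt_trans yy' wy')).
  apply: lerXn2r; rewrite ?nnegrE ?addr_ge0//.
  by apply: le_trans (lerD (lexx 1) w1) _; rewrite addrA.
have wL : 0 < cmod w ^+ (n.+1 - L) by rewrite exprn_gt0.
have : c * a n * cmod w ^+ (n.+1 - L) * cmod (qs n).[w] <=
    M2 * (a n * (G * cmod w ^+ (n.+1 - L))) * eta'.
  apply: (@le_trans _ _ (cmod (A n) * cmod w ^+ (n.+1 - L) * cmod (qs n).[w])).
    by rewrite !ler_wpM2r// ltW.
  rewrite -E; apply: ler_pM => //; apply: le_trans pw _.
  by rewrite ler_wpM2l// ler_wpM2l// ltW.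
have -> : M2 * (a n * (G * cmod w ^+ (n.+1 - L))) * eta' =
  (M2 * G * eta') * (a n * cmod w ^+ (n.+1 - L)) by ring.
have -> : c * a n * cmod w ^+ (n.+1 - L) * cmod (qs n).[w] =
  c * cmod (qs n).[w] * (a n * cmod w ^+ (n.+1 - L)) by ring.
rewrite ler_pM2r ?mulr_gt0//.
have : M2 * G * eta' < c * eta.
  by rewrite [c * eta]mulrC; apply: mulr_half_inv_lt; [exact: mulr_ge0 (ltW G0)|exact: mulr_gt0].
by move=> h1 h2; have := le_lt_trans h2 h1; rewrite ltr_pM2l.
Qed.
End Exterior.

(** * Associativity and size of products with a polynomial *)

Section Convolution.
Variable R : realType.
Local Notation C := R[i].
Implicit Types (q s : {poly C}) (c : nat -> C) (t M B : R).

Lemma pmulA q s c j : pmul (q * s) c j = pmul q (pmul s c) j.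
Proof.
rewrite (@pmul_poly _ _ _ j.+1)// -mulrA coefM; apply: eq_bigr => i _.
by rewrite (@pmul_poly _ s c j.+1)// ltnS leq_subr.
Qed.

Lemma pmul_bound q c t M B m j : 0 <= t -> (size q <= m.+1)%N ->
  (forall i, cmod q`_i * t ^+ i <= B) -> (forall i, cmod (c i) * t ^+ i <= M) ->
  cmod (pmul q c j) * t ^+ j <= m.+1%:R * (B * M).
Proof.
move=> t0 qm hB hM; have B0 := bound_ge0 hB; have M0 := bound_ge0 hM.
have hi (i : 'I_j.+1) : cmod (q`_i * c (j - i)%N) * t ^+ j <= B * M.
  have -> : t ^+ j = t ^+ i * t ^+ (j - i) by rewrite -exprD subnKC// -ltnS.
  by rewrite cmodM mulrACA; apply: ler_pM => //; pos.
apply: (@le_trans _ _ (\sum_(i < j.+1) cmod (q`_i * c (j - i)%N) * t ^+ j)).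
  by rewrite -mulr_suml ler_wpM2r ?exprn_ge0// cmod_sum.
apply: (@le_trans _ _ (\sum_(i < j.+1 | (i < m.+1)%N) B * M)).
  rewrite [leRHS]big_mkcond; apply: ler_sum => i _; case: ifPn => [_|].
    exact: hi.
  rewrite -leqNgt => mi; rewrite nth_default ?(leq_trans qm)// mul0r cmod0 mul0r//.
rewrite sumr_const -(mulr_natl (B * M)); apply: ler_wpM2r; first by pos.
rewrite ler_nat -[leqRHS]card_ord -sum1_card.
rewrite (eq_bigl (fun i : 'I_j.+1 => (i < m.+1)%N))//.
have [jm|mj] := leqP j m.
  rewrite (eq_bigl xpredT) => [|i]; first by rewrite sum1_card !card_ord.
  by rewrite (leq_trans (ltn_ord i)).
by rewrite -(big_ord_widen j.+1 (fun=> 1%N)) ?sum1_card// ltnW.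
Qed.
End Convolution.

(** * The telescoping series inside the disk *)

Section Interior.
Variables (R : realType) (phi : nat -> R[i]) (m : nat).
Variables (p q qs : nat -> {poly R[i]}) (A : nat -> R[i]) (lam : nat -> nat).
Variables (rho : R) (a : nat -> R) (N0 : nat).
Hypothesis row : pade_row phi m p q qs A lam rho a N0.
Local Notation C := R[i].
Implicit Types (z : C) (w : {poly C}) (t x y e kap theta delta : R) (n k : nat).

(** Provides the rate for [good_circle]: with [theta = (1 + s) / 2] a series of ratio [s] still
    converges after losing [theta] or [theta^2] per index in the denominators. *)
Lemma square_gap (s : R) : 0 <= s -> s < 1 ->
  [/\ 0 < (1 + s) / 2, (1 + s) / 2 < 1, s < (1 + s) / 2 & s < ((1 + s) / 2) ^+ 2].
Proof.
move=> s0 s1; split; try lra.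
have : 0 < (1 - s) ^+ 2 by rewrite exprn_gt0// subr_gt0.
rewrite !expr2; nra.
Qed.

Lemma kappa_exists y : 0 < y -> y < rho ->
  exists2 kap, rho^-1 < kap & 0 < kap * y < 1.
Proof.
move=> y0 yr; have rho0 := row_rho row; exists ((rho^-1 + y^-1) / 2).
  have : rho^-1 < y^-1 by rewrite ltf_pV2.
  lra.
have i0 : 0 < rho^-1 by rewrite invr_gt0.
have i1 : y^-1 * y = 1 by rewrite mulVf// gt_eqF.
have i2 : rho^-1 * y < 1 by rewrite mulrC ltr_pdivrMr// mul1r.
have i3 : 0 < rho^-1 * y by pos.
rewrite mulrAC mulrDl i1; lra.
Qed.

(** Successive terms decay like [kap * y], and the denominators lose [theta^2] per index, counted
    from the index [c0] at which the avoiding circle is centred. The first term dominates, and the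
    bound is uniform in [N]. *)
Lemma series_bound K c0 n N z x y kap theta delta :
    (N0 <= K)%N -> (c0 <= K)%N -> (K <= n)%N -> (n <= N)%N ->
    0 < x -> x <= cmod z <= y -> 0 < delta -> 0 < theta -> 0 < kap ->
    kap * y < theta ^+ 2 ->
    (forall k j, (K <= k)%N -> a (k + j)%N <= a k * kap ^+ j) ->
    (forall k, (K <= k)%N -> delta * theta ^+ (k - c0) <= cmod (q k).[z]) ->
  cmod ((p N).[z] / (q N).[z] - (p n).[z] / (q n).[z]) <=
  term_cst m x y / (delta ^+ 2 * theta * theta ^+ 2 ^+ (n - c0)) *
    (a n * cmod z ^+ n) / (1 - kap * y / theta ^+ 2).
Proof.
move=> N0K cK Kn nN x0 xzy d0 th0 k0 hu hK hq.
have /andP[xz zy] := xzy.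
have z0 : 0 < cmod z by lra. have y0 : 0 < y by lra.
set u := kap * y / theta ^+ 2.
have u0 : 0 <= u by rewrite /u; pos.
have u1 : u < 1 by rewrite /u ltr_pdivrMr ?mul1r//; pos.
have dth k : 0 < delta * theta ^+ k by pos.
have qne k : (K <= k)%N -> (q k).[z] != 0.
  by move=> /hq h; rewrite -cmod_gt0; exact: lt_le_trans h.
rewrite row_telescope//; apply: le_trans (cmod_sum _ _ _) _.
set Cx := term_cst m x y.
have Cx0 : 0 <= Cx by apply: term_cst_ge0; pos.
have an : 0 < a n by apply: (row_a row); exact: leq_trans Kn.
set D := delta ^+ 2 * theta * theta ^+ 2 ^+ (n - c0).
have D0 : 0 < D by rewrite /D; pos.
apply: (@le_trans _ _ (\sum_(n <= i < N) Cx / D * (a n * cmod z ^+ n) * u ^+ (i - n))).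
  apply: ler_sum_nat => i /andP[ni iN].
  have Ki : (K <= i)%N by exact: leq_trans ni.
  have hi : (N0 <= i)%N by exact: leq_trans Ki.
  have Ki1 : (K <= i.+1)%N by exact: leqW.
  apply: le_trans (term_bound row hi x0 xzy (qne _ Ki) (qne _ Ki1)) _.
  rewrite -/Cx ler_pdivrMr ?mulr_gt0 ?cmod_gt0 ?qne//.
  have h1 := hq _ Ki; have h2 := hq _ Ki1.
  have h4 : D * theta ^+ 2 ^+ (i - n) <= cmod (q i).[z] * cmod (q i.+1).[z].
    apply: le_trans (ler_pM (ltW (dth _)) (ltW (dth _)) h1 h2).
    have -> : (i.+1 - c0 = (i - c0).+1)%N by clear -ni Kn cK; lia.
    have -> : (i - c0 = (n - c0) + (i - n))%N by clear -ni Kn cK; lia.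
    apply: eq_ler; rewrite /D; move: (n - c0)%N (i - n)%N => e1 e2.
    have E k : theta ^+ 2 ^+ k = theta ^+ k * theta ^+ k by rewrite exprAC expr2.
    by rewrite !E [theta ^+ (e1 + e2).+1]exprS !exprD; ring.
  apply: (@le_trans _ _ (Cx / D * (a n * cmod z ^+ n) * u ^+ (i - n) *
      (D * theta ^+ 2 ^+ (i - n)))); last first.
    by apply: ler_wpM2l => //; pos.
  have -> : Cx / D * (a n * cmod z ^+ n) * u ^+ (i - n) * (D * theta ^+ 2 ^+ (i - n)) =
     Cx * (a n * cmod z ^+ n * (kap * y) ^+ (i - n)).
    have -> : (kap * y) ^+ (i - n) = u ^+ (i - n) * theta ^+ 2 ^+ (i - n).
      by rewrite -exprMn /u divfK// expf_neq0// gt_eqF.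
    move: (u ^+ _) (theta ^+ 2 ^+ _) (cmod z ^+ n) => e1 e2 e3.
    by field; rewrite gt_eqF.
  apply: ler_wpM2l => //.
  have := hK n (i - n)%N Kn; rewrite subnKC// => hai.
  have -> : cmod z ^+ i = cmod z ^+ n * cmod z ^+ (i - n) by rewrite -exprD subnKC.
  apply: (@le_trans _ _ (a n * kap ^+ (i - n) * (cmod z ^+ n * cmod z ^+ (i - n)))).
    by apply: ler_wpM2r => //; pos.
  have -> : a n * kap ^+ (i - n) * (cmod z ^+ n * cmod z ^+ (i - n)) =
     a n * cmod z ^+ n * (kap * cmod z) ^+ (i - n) by rewrite exprMn; ring.
  apply: ler_wpM2l; first by pos.
  by apply: lerXn2r; rewrite ?nnegrE; [pos|pos|rewrite ler_pM2l].
rewrite -mulr_sumr; apply: ler_wpM2l; first by pos.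
rewrite -{1}[n]add0n big_addn.
apply: (@le_trans _ _ (\sum_(0 <= i < N - n) u ^+ i)).
  by apply: ler_sum_nat => i _; rewrite addnK.
apply: le_trans (geo_sum_le 0 (N - n) u0 u1) _.
by rewrite expr0 mul1r.
Qed.

(** Inside the disk one circle, centred at [N0], serves all [n]: the telescoping series converges
    there, so the quotients [p n / q n] stay bounded. *)
Lemma p_interior_bound x y : 0 < x -> x < y -> y < rho ->
  exists2 M, 0 <= M & exists2 K, (N0 <= K)%N & exists2 t, x <= t <= y &
    forall n z, (K <= n)%N -> cmod z = t -> cmod (p n).[z] <= M.
Proof.
move=> x0 xy yr; have y0 := lt_trans x0 xy; have rho0 := row_rho row.
have [kap hk /andP[ky0 ky1]] := kappa_exists y0 yr.
have k0 : 0 < kap by apply: lt_trans hk; rewrite invr_gt0.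
have [th0 th1 _ th2] := square_gap (ltW ky0) ky1.
set theta := (1 + kap * y) / 2 in th0 th1 th2; clearbody theta.
have [|delta d0 hd] := @row_circle R phi m p q qs A lam rho a N0 row x y theta x0 xy.
  by rewrite th0.
have [t txy ht] := hd N0 (leqnn _).
have [K N0K hK] := ratio_le row hk.
have [B B0 hB] := poly_bounded (p K) 0 y.
have /andP[tx ty] := txy; have t0 : 0 < t by lra.
have aK : 0 < a K by apply: (row_a row).
have hq k z : cmod z = t -> (K <= k)%N -> delta * theta ^+ (k - N0) <= cmod (q k).[z].
  move=> zt Kk; have := ht k z (leq_trans N0K Kk) zt.
  by have -> : (k - N0 + (N0 - k) = k - N0)%N by clear -Kk N0K; lia.
pose S := term_cst m x y / (delta ^+ 2 * theta * theta ^+ 2 ^+ (K - N0)) *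
    (a K * y ^+ K) / (1 - kap * y / theta ^+ 2).
have u1 : kap * y / theta ^+ 2 < 1 by rewrite ltr_pdivrMr ?mul1r//; pos.
have tc0 : 0 <= term_cst m x y by apply: term_cst_ge0; pos.
have S0 : 0 <= S by rewrite /S; pos.
pose M1 := B / (delta * theta ^+ (K - N0)) + S.
have M10 : 0 <= M1 by rewrite /M1; apply: addr_ge0 => //; pos.
exists ((1 + y) ^+ m * M1); first by apply: mulr_ge0 => //; pos.
exists K => //; exists t => // n z Kn zt.
have n0 := leq_trans N0K Kn; have [qn qsz] := row_q row n0.
have qnn : (q n).[z] != 0.
  by rewrite -cmod_gt0; apply: lt_le_trans (hq n z zt Kn); pos.
rewrite -[(p n).[z]](divfK qnn) cmodM mulrC.
apply: ler_pM => //.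
  apply: le_trans (normalized_le z qn qsz) _.
  by apply: lerXn2r; rewrite ?nnegrE ?zt; pos.
rewrite -(subrK ((p K).[z] / (q K).[z]) ((p n).[z] / (q n).[z])).
apply: le_trans (cmodD _ _) _; rewrite addrC; apply: lerD.
  rewrite cmodM cmodV; apply: ler_pM => //; first by pos.
    by apply: hB; rewrite subr0 zt.
  have h := hq K z zt (leqnn _).
  rewrite lef_pV2 ?posrE//; last by pos.
  by apply: lt_le_trans h; pos.
have hz : x <= cmod z <= y by rewrite zt.
apply: le_trans (series_bound (K := K) (c0 := N0) N0K N0K (leqnn _) Kn x0 hz d0 th0 k0 th2 hK _) _.
  by move=> k Kk; exact: hq.
rewrite /S; apply: ler_wpM2r; first by pos.
apply: ler_wpM2l; first by pos.
apply: ler_wpM2l; first by pos.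
by apply: lerXn2r; rewrite ?nnegrE ?zt; pos.
Qed.
End Interior.

(** * Remainders with respect to a limit denominator *)

Section Remainder.
Variables (R : realType) (phi : nat -> R[i]) (m : nat).
Variables (p q qs : nat -> {poly R[i]}) (A : nat -> R[i]) (lam : nat -> nat).
Variables (rho : R) (a : nat -> R) (N0 : nat).
Hypothesis row : pade_row phi m p q qs A lam rho a N0.
Local Notation C := R[i].
Implicit Types (z : C) (w : {poly C}) (t x y e kap theta delta : R) (n k : nat).

(** Says in terms of coefficients that the product of [w] and the formal series is holomorphic in
    the disk, without reference to the extension of [f]. *)
Definition denominator_of w := forall t, 0 < t -> t < rho -> pbound (pmul w phi) t.

Definition cluster_poly w := (size w <= m.+1)%N /\
  forall e N, 0 < e -> exists2 n, (N <= n)%N & forall i, cmod ((q n)`_i - w`_i) < e.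

(** The [j]-th coefficient of [w * phi] is approximated by that of [p n] for suitable large [n], and
    those coefficients obey a Cauchy estimate uniform in [n]. *)
Lemma cluster_denominator w : cluster_poly w -> denominator_of w.
Proof.
move=> [_ hw] t0 t00 t0r; pose y := (t0 + rho) / 2.
have ty : t0 < y by rewrite /y; lra.
have yr : y < rho by rewrite /y; lra.
have [M M0 [K N0K [t /andP[tt ty'] hK]]] := p_interior_bound row t00 ty yr.
have t0' : 0 < t by lra.
apply: (@pbound_le _ _ t); last by rewrite (ltW t00).
exists M => j; apply/ler_addgt0Pr => e e0.
pose S := (\sum_(i < j.+1) cmod (phi (j - i)%N)) * t ^+ j.
have S0 : 0 <= S by rewrite /S; apply: mulr_ge0; [exact: sumr_ge0|pos].
(* The index exceeds [j + m] so that the [j]-th coefficients of [q n * phi] and [p n] agree,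
   whatever [lam n] is. *)
have [n nn hn] := hw (e / (S + 1)) (maxn K (j + m)) ltac:(apply: divr_gt0; lra).
move: nn; rewrite geq_max => /andP[Kn jn]; have n0 := leq_trans N0K Kn.
have lamn := row_lam_le row n0.
have E : pmul (q n) phi j = (p n)`_j by apply: (row_coef row) => //; nlia.
have hp : cmod (p n)`_j * t ^+ j <= M.
  by apply: cauchy_coef (ltW t0') _ => z; exact: hK.
have hd : cmod (pmul w phi j - pmul (q n) phi j) * t ^+ j <= e.
  rewrite /pmul -sumrB; apply: (@le_trans _ _ (e / (S + 1) * S)); last first.
    rewrite mulrAC ler_pdivrMr; [|lra]; apply: ler_wpM2l; lra.
  rewrite /S mulrA; apply: ler_wpM2r; first by pos.
  rewrite mulr_sumr; apply: le_trans (cmod_sum _ _ _) _; apply: ler_sum => i _.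
  rewrite -mulrBl cmodM; apply: ler_wpM2r => //.
  by rewrite cmodBC; exact: ltW.
have := cmodD (pmul w phi j - pmul (q n) phi j) (pmul (q n) phi j).
rewrite subrK {2}E => /(ler_wpM2r (exprn_ge0 j (ltW t0'))); rewrite mulrDl.
by move=> h; apply: le_trans h _; rewrite addrC; apply: lerD.
Qed.

Lemma remainder_coef w n j : (N0 <= n)%N -> (j + lam n <= n)%N ->
  pmul (q n) (pmul w phi) j = (w * p n)`_j.
Proof.
move=> n0 jn; rewrite -pmulA mulrC pmulA coefM; apply: eq_bigr => i _.
have ij := ltn_ord i; rewrite (row_coef row)//.
by move: (nat_of_ord i) ij => {}i ij; nlia.
Qed.

Lemma psum_pmul_sub v (b : {poly C}) c t z : 0 < t -> pbound c t -> cmod z < t ->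
  psum (fun j => pmul v c j + (- 1) * b`_j) z = v.[z] * psum c z - b.[z].
Proof.
move=> t0 hc zt.
rewrite (psumD t0 (pbound_pmul v t0 hc) (pboundZ _ (pbound_poly b t)) zt).
rewrite (psum_pmul v t0 hc zt) (psumZ _ t0 (pbound_poly b t) zt) psum_poly.
by rewrite mulN1r.
Qed.

(** A crude bound that does not involve [a n]: the remainder has bounded coefficients and starts at
    the index [n - m] or later. It serves to let the upper index tend to infinity in
    [remainder_bound]. *)
Lemma remainder_far w t y : denominator_of w -> 0 < t -> t < y -> y < rho ->
  exists2 D, 0 <= D & exists2 K, (N0 <= K)%N & forall n z, (K <= n)%N ->
    cmod z <= t ->
    cmod ((q n).[z] * psum (pmul w phi) z - (w * p n).[z]) <=
    D * (t / y) ^+ (n - m).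
Proof.
move=> hw t0 ty yr; pose y' := (y + rho) / 2.
have yy' : y < y' by rewrite /y'; lra.
have y'r : y' < rho by rewrite /y'; lra.
have y0 := lt_trans t0 ty.
have [M M0 [K N0K [s /andP[ys sy] hK]]] := p_interior_bound row y0 yy' y'r.
have s0 : 0 < s by lra. have sr : s < rho by lra.
have [Mc hMc] := hw s s0 sr; have Mc0 := bound_ge0 hMc.
have [Bw Bw0 hBw] := poly_bounded w 0 s.
pose D := m.+1%:R * ((1 + s) ^+ m * Mc) + Bw * M.
have D0 : 0 <= D.
  by rewrite /D; apply: addr_ge0; apply: mulr_ge0 => //; apply: mulr_ge0 => //; pos.
have ts : t / s < 1 by rewrite ltr_pdivrMr ?mul1r; lra.
exists (D / (1 - t / s)); first by apply: mulr_ge0 => //; pos.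
exists K => // n z Kn zt.
have n0 := leq_trans N0K Kn; have zs : cmod z < s by lra.
rewrite -(psum_pmul_sub (q n) (w * p n) s0 (hw s s0 sr) zs).
have [qn qsz] := row_q row n0.
have hF j : cmod (pmul (q n) (pmul w phi) j + -1 * (w * p n)`_j) * s ^+ j <= D.
  apply: (@le_trans _ _ (cmod (pmul (q n) (pmul w phi) j) * s ^+ j + cmod (w * p n)`_j * s ^+ j)).
    rewrite -mulrDl; apply: ler_wpM2r; first by pos.
    by rewrite mulN1r cmodB.
  apply: lerD.
    apply: (pmul_bound _ (ltW s0) qsz _ hMc) => i.
    apply: cauchy_coef (ltW s0) _ => v vs.
    by apply: le_trans (normalized_le v qn qsz) _; rewrite vs.
  apply: cauchy_coef (ltW s0) _ => v vs; rewrite hornerM cmodM; apply: ler_pM => //.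
    by apply: hBw; rewrite subr0 vs.
  exact: hK.
have := psum_tail (n - m) s0 hF zs.
rewrite {1}/psums big1 ?subr0 => [h|i _].
  apply: le_trans h _; rewrite -!mulrA; apply: ler_wpM2l => //.
  rewrite mulrC; have zs1 : cmod z / s <= t / s by apply: ler_wpM2r => //; pos.
  have zs0 : 0 <= cmod z / s by pos.
  apply: ler_pM; [pos|pos| |].
    by rewrite lef_pV2 ?posrE; lra.
  apply: lerXn2r; rewrite ?nnegrE; [pos|pos|].
  apply: le_trans zs1 _; apply: ler_wpM2l; first by pos.
  by rewrite lef_pV2.
have lamn := row_lam_le row n0.
rewrite remainder_coef//; first by rewrite mulN1r subrr mul0r.
by move: (nat_of_ord i) (ltn_ord i) => {}i im; nlia.
Qed.

(** On a circle avoiding zeros, centred at [n], the difference of [W] and [w * p n / q n] is the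
    telescoping tail from [n] on, because the remainder at a far index [k] vanishes in the limit.
    Cauchy's estimates then carry the bound to [|z| <= r], where the vanishing of the low
    coefficients yields the power of [|z|]. *)
Lemma remainder_bound w r : denominator_of w -> 0 < r -> r < rho ->
  exists2 D, 0 <= D & exists2 K, (N0 <= K)%N & forall n z, (K <= n)%N ->
    cmod z <= r ->
    cmod ((q n).[z] * psum (pmul w phi) z - w.[z] * (p n).[z]) <=
    D * (a n * cmod z ^+ (n.+1 - lam n)).
Proof.
move=> hw r0 rr.
pose x := (2 * r + rho) / 3; pose y := (r + 2 * rho) / 3; pose y' := (r + 5 * rho) / 6.
have rx : r < x by rewrite /x; lra. have xy : x < y by rewrite /x /y; lra.
have yy' : y < y' by rewrite /y /y'; lra. have y'r : y' < rho by rewrite /y'; lra.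
clearbody x y y'; have x0 := lt_trans r0 rx; have y0 := lt_trans x0 xy.
have y'0 := lt_trans y0 yy'.
have [kap hk /andP[ky0 ky1]] := kappa_exists row y0 (lt_trans yy' y'r).
have k0 : 0 < kap by apply: lt_trans hk; rewrite invr_gt0 (row_rho row).
(* [theta] has to satisfy [theta^2 > kap * y], for the telescoping tail, and [theta > y / y'], for
   the remainder at the far index divided by [q k]. *)
pose s := Num.max (kap * y) (y / y').
have s0 : 0 <= s by rewrite /s le_max (ltW ky0).
have s1 : s < 1 by rewrite /s gt_max ky1 ltr_pdivrMr// mul1r.
have sk : kap * y <= s by rewrite /s le_max lexx.
have sy : y / y' <= s by rewrite /s le_max lexx orbT.
have [th0 th1 sth sth2] := square_gap s0 s1; clearbody s.
set theta := (1 + s) / 2 in th0 th1 sth sth2; clearbody theta.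
have [|delta d0 hd] := @row_circle R phi m p q qs A lam rho a N0 row x y theta x0 xy.
  by rewrite th0.
have hu : kap * y < theta ^+ 2 by lra.
have u1 : kap * y / theta ^+ 2 < 1 by rewrite ltr_pdivrMr ?mul1r//; pos.
have [K1 N0K1 hK1] := ratio_le row hk.
have [D1 D10 [K2 N0K2 hK2]] := remainder_far hw y0 yy' y'r.
have [Bw Bw0 hBw] := poly_bounded w 0 y.
have tc0 : 0 <= term_cst m x y by apply: term_cst_ge0; pos.
pose S := term_cst m x y / (delta ^+ 2 * theta) / (1 - kap * y / theta ^+ 2).
have S0 : 0 <= S by rewrite /S; pos.
pose M := (1 + y) ^+ m * (Bw * S).
have M0 : 0 <= M by rewrite /M; apply: mulr_ge0; [pos|apply: mulr_ge0].
have rx1 : r / x < 1 by rewrite ltr_pdivrMr ?mul1r.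
exists (M * ((1 + y) ^+ m / x) / (1 - r / x)); first by apply: mulr_ge0; pos.
exists (maxn K1 K2); first by rewrite leq_max N0K1.
move=> n z; rewrite geq_max => /andP[K1n K2n] zr.
have n0 := leq_trans N0K1 K1n; have an := row_a row n0.
have [t txy ht] := hd n n0; have /andP[tx ty] := txy; have t0 : 0 < t := lt_le_trans x0 tx.
have [qn qsz] := row_q row n0.
have hq k v : cmod v = t -> (n <= k)%N -> delta * theta ^+ (k - n) <= cmod (q k).[v].
  move=> vt nk; have := ht k v (leq_trans n0 nk) vt.
  by have -> : (k - n + (n - k) = k - n)%N by clear -nk; lia.
have circle v : cmod v = t ->
    cmod ((q n).[v] * psum (pmul w phi) v - (w * p n).[v]) <= M * (a n * t ^+ n).
  move=> vt; have qne k : (n <= k)%N -> (q k).[v] != 0.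
    move=> nk; rewrite -cmod_gt0; apply: lt_le_trans (hq k v vt nk).
    by apply: mulr_gt0 => //; exact: exprn_gt0.
  have hv : x <= cmod v <= y by rewrite vt.
  set W := psum (pmul w phi) v.
  have -> : (q n).[v] * W - (w * p n).[v] =
      (q n).[v] * (W - w.[v] * ((p n).[v] / (q n).[v])).
    by rewrite hornerM; field; exact: qne.
  rewrite cmodM /M -mulrA; apply: ler_pM => //.
    apply: le_trans (normalized_le v qn qsz) _.
    apply: lerXn2r; rewrite ?nnegrE; [by rewrite addr_ge0|by rewrite addr_ge0// ltW|].
    by rewrite lerD2l vt.
  (* The far index [k] is chosen so that [D1 * (y / y')^(k - m) / (delta * theta^(k - n))] is below
     [e]. *)
  apply/ler_addgt0Pr => e e0.
  have yk : y / y' / theta < 1 by rewrite ltr_pdivrMr ?mul1r//; lra.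
  have yk0 : 0 <= y / y' / theta by pos.
  have [N hN] := geo_small (D1 / delta * theta ^+ (n - m)) yk0 yk e0.
  pose k := (maxn n m + N)%N.
  have nk : (n <= k)%N by rewrite /k; clear; lia.
  have mk : (m <= k)%N by rewrite /k; clear; lia.
  have -> : W - w.[v] * ((p n).[v] / (q n).[v]) =
      ((q k).[v] * W - (w * p k).[v]) / (q k).[v] +
      w.[v] * ((p k).[v] / (q k).[v] - (p n).[v] / (q n).[v]).
    by rewrite hornerM; field; rewrite (qne n)// (qne k).
  apply: le_trans (cmodD _ _) _; rewrite addrC; apply: lerD.
    rewrite cmodM -mulrA; apply: ler_pM => //; first by apply: hBw; rewrite subr0 vt.
    apply: le_trans (series_bound row (K := n) (c0 := n) n0 (leqnn _) (leqnn _) nk x0 hv d0 th0 k0 hu _ _) _.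
    - by move=> i j ni; apply: hK1; exact: leq_trans ni.
    - by move=> i ni; exact: hq.
    by rewrite subnn expr0 mulr1 /S vt; apply: eq_ler; ring.
  rewrite cmodM cmodV; have h1 := hq k v vt nk.
  have dk : 0 < delta * theta ^+ (k - n) by apply: mulr_gt0 => //; exact: exprn_gt0.
  have h2 : cmod ((q k).[v] * W - (w * p k).[v]) <= D1 * (y / y') ^+ (k - m).
    by apply: hK2; [exact: leq_trans nk|rewrite vt].
  apply: (@le_trans _ _ (D1 * (y / y') ^+ (k - m) / (delta * theta ^+ (k - n)))).
    apply: ler_pM => //; first by pos.
    by rewrite lef_pV2 ?posrE//; apply: lt_le_trans h1.
  apply: le_trans (ltW (hN (k - m)%N _)); last by rewrite /k; clear; lia.
  rewrite ler_pdivrMr// [(y / y' / theta) ^+ _]expr_div_n.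
  have thn : theta ^+ (k - m) <= theta ^+ (k - n) * theta ^+ (n - m).
    rewrite -exprD; apply: ler_wiXn2l; [exact: ltW|exact: ltW|].
    by have mn := row_N0 row; clear -nk mk mn n0; lia.
  have thk : 0 < theta ^+ (k - m) by exact: exprn_gt0.
  have -> : D1 / delta * theta ^+ (n - m) * ((y / y') ^+ (k - m) / theta ^+ (k - m)) *
     (delta * theta ^+ (k - n)) =
     D1 * (y / y') ^+ (k - m) * ((theta ^+ (k - n) * theta ^+ (n - m)) / theta ^+ (k - m)).
    move: thk; move: (theta ^+ (k - m)) ((y / y') ^+ _) (theta ^+ _) (theta ^+ _) => e1 e2 e3 e4 thk.
    by field; rewrite !gt_eqF.
  rewrite -[leLHS]mulr1; apply: ler_wpM2l; first by apply: mulr_ge0 => //; pos.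
  by rewrite ler_pdivlMr// mul1r.
have zt : cmod z < t := lt_le_trans (le_lt_trans zr rx) tx.
pose Fc j := pmul (q n) (pmul w phi) j + -1 * (w * p n)`_j.
have yr : y < rho := lt_trans yy' y'r.
have hb : pbound (pmul w phi) y by exact: hw.
have hFb : pbound Fc y.
  apply: pboundD; [exact: pbound_pmul|exact: pboundZ (pbound_poly _ _)|exact: ltW].
have ty' : t < y' := le_lt_trans ty yy'.
have hb' : pbound (pmul w phi) y' by exact: hw.
have hFb' : pbound Fc y'.
  apply: pboundD; [exact: pbound_pmul|exact: pboundZ (pbound_poly _ _)|exact: ltW].
have hF j : cmod (Fc j) * t ^+ j <= M * (a n * t ^+ n).
  apply: (@psum_cauchy_coef R Fc y' t _ j y'0 hFb' (ltW t0) ty') => v vt.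
  have vy' : cmod v < y' by rewrite vt.
  rewrite /Fc (psum_pmul_sub (q n) (w * p n) y'0 hb' vy'); exact: circle.
have zy' : cmod z < y' := lt_trans zt ty'.
rewrite -[w.[z] * _]hornerM -(psum_pmul_sub (q n) (w * p n) y'0 hb' zy').
(* The coefficients of index at most [n - lam n] vanish, so this tail is the whole sum. *)
have := psum_tail (n.+1 - lam n) t0 hF zt.
have lamn := row_lam_le row n0.
rewrite {1}/psums big1 ?subr0 => [h|i _]; last first.
  rewrite /Fc remainder_coef//; first by rewrite mulN1r subrr mul0r.
  by move: (nat_of_ord i) (ltn_ord i) => {}i im; have := row_N0 row; nlia.
apply: le_trans h _.
have ztr : cmod z / t <= r / x.
  by apply: ler_pM => //; [pos|rewrite lef_pV2].
have lz : 0 < 1 - cmod z / t by rewrite subr_gt0 (le_lt_trans ztr).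
have -> : M * (a n * t ^+ n) * (cmod z / t) ^+ (n.+1 - lam n) / (1 - cmod z / t) =
   M * (t ^+ n / t ^+ (n.+1 - lam n)) / (1 - cmod z / t) * (a n * cmod z ^+ (n.+1 - lam n)).
  by rewrite expr_div_n; ring.
apply: ler_wpM2r; first by pos.
have rx0 : 0 < 1 - r / x by rewrite subr_gt0.
apply: ler_pM; [|by pos| |by rewrite lef_pV2 ?posrE// lerD2l lerN2].
  by apply: mulr_ge0 => //; pos.
apply: ler_wpM2l => //.
rewrite ler_pdivrMr ?exprn_gt0//.
have -> : t ^+ n = t^-1 * t ^+ lam n * t ^+ (n.+1 - lam n).
  rewrite -mulrA -exprD subnKC; last by have := row_N0 row; nlia.
  by rewrite exprS mulrA mulVf ?mul1r// gt_eqF.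
apply: ler_wpM2r; first by pos.
rewrite mulrC; apply: ler_pM; [pos|pos| |by rewrite lef_pV2].
apply: (@le_trans _ _ ((1 + y) ^+ lam n)); last first.
  by apply: ler_weXn2l => //; rewrite lerDl ltW.
apply: lerXn2r; rewrite ?nnegrE; [exact: ltW|by rewrite addr_ge0// ltW|].
by rewrite (le_trans ty)// lerDr.
Qed.
End Remainder.

(** * Limit points of the denominators and removal of common zeros *)

Section Cluster.
Variables (R : realType) (phi : nat -> R[i]) (m : nat).
Variables (p q qs : nat -> {poly R[i]}) (A : nat -> R[i]) (lam : nat -> nat).
Variables (rho : R) (a : nat -> R) (N0 : nat).
Hypothesis row : pade_row phi m p q qs A lam rho a N0.
Local Notation C := R[i].
Implicit Types (z : C) (w : {poly C}) (t x y e : R) (n k : nat).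

(** Normalization bounds the coefficients by [2^m], which gives compactness. It also keeps the limit
    from vanishing, since each [q n] is at least [delta] on some circle of radius between 1 and
    2. *)
Lemma cluster_exists : exists2 w, cluster_poly m q w & w != 0.
Proof.
(* The first [m + 1] entries hold the real parts of the coefficients, the last [m + 1] the imaginary
   parts. *)
pose v n : 'rV[R]_((m + m.+1).+1) := \row_i (if (i <= m)%N
  then complex.Re (q (maxn N0 n))`_i else complex.Im (q (maxn N0 n))`_(i - m.+1)).
have hq n := row_q row (leq_maxl N0 n).
have bnd n i : cmod (q (maxn N0 n))`_i <= 2 ^+ m.
  have [qn qm] := hq n; rewrite -[leLHS]mulr1 -[X in _ * X](expr1n R i).
  apply: cauchy_coef => // z z1; apply: le_trans (normalized_le z qn qm) _.
  by rewrite z1.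
have vb n i : v n ord0 i \in `[- (2 ^+ m : R), 2 ^+ m].
  rewrite mxE in_itv /= -ler_norml; case: ifP => _; apply: le_trans (bnd _ _).
    exact: cmod_Re.
  exact: cmod_Im.
have cpt : compact [set u : 'rV[R]_((m + m.+1).+1) |
    forall i, u ord0 i \in `[- (2 ^+ m : R), 2 ^+ m]].
  apply: (@rV_compact _ _ (fun=> `[- (2 ^+ m : R), 2 ^+ m]%classic)) => i.
  exact: segment_compact.
have FA : (v @ \oo) [set u : 'rV[R]_((m + m.+1).+1) |
    forall i, u ord0 i \in `[- (2 ^+ m : R), 2 ^+ m]].
  by exists 0%N => // n _ i /=; exact: vb.
have [u [_ hu]] := cpt (v @ \oo) _ FA.
pose w := \poly_(i < m.+1) (u ord0 (inord i) +i* u ord0 (inord (m.+1 + i))).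
have hw e N : 0 < e -> exists2 n, (N <= n)%N & (N0 <= n)%N /\
    forall i, cmod ((q n)`_i - w`_i) < e.
  move=> e0; have e2 : 0 < e / 2 by rewrite divr_gt0.
  have [||_ [[n /= nN <-] vu]] := hu (v @` [set n | (maxn N0 N <= n)%N]) (ball u (e / 2)).
  - by exists (maxn N0 N) => // n /= h; exists n.
  - exact: nbhsx_ballx.
  move: nN; rewrite geq_max => /andP[n0 nN]; exists n => //; split => // i.
  have [qn qm] := row_q row n0; rewrite coef_poly; case: ltnP => im; last first.
    by rewrite nth_default ?subr0 ?cmod0// (leq_trans qm).
  have [_ {}vu] := vu; have h1 := vu ord0 (inord i); have h2 := vu ord0 (inord (m.+1 + i)).
  rewrite /ball /= !mxE !inordK in h1 h2; [|lia|lia].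
  rewrite (maxn_idPr n0) in h1 h2.
  rewrite -ltnS im in h1; rewrite leqNgt ltnS leq_addr /= addKn in h2.
  apply: le_lt_trans (cmod_le_ReIm _) _.
  rewrite (raddfB (@complex.Re R)) (raddfB (@complex.Im R)) /=.
  rewrite distrC in h1; rewrite distrC in h2; lra.
exists w.
  split=> [|e N e0]; first exact: size_poly.
  by have [n nN [_ hn]] := hw e N e0; exists n.
(* On the circle centred at [n] itself the exponent of [theta] is 0, so the lower bound for [q n] is
   [delta]; coefficients that are too small contradict it. *)
apply/eqP => w0; have [delta d0 hd] := row_circle row (x := 1) (y := 2) (theta := 1 / 2)
  ltr01 ltac:(lra) ltac:(lra).
have [n _ [n0 hn]] := hw (delta / (m.+1%:R * 2 ^+ m)) 0%N ltac:(pos).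
have [t /andP[t1 t2] ht] := hd n n0; have [qn qm] := row_q row n0.
have t0 : 0 <= t by lra.
have := ht n t%:C n0 (cmod_real t0); rewrite subnn expr0 mulr1 leNgt => /negP; apply.
apply: le_lt_trans (cmod_horner _ _) _; rewrite cmod_real//.
have [s0|s0] := posnP (size (q n)); first by rewrite s0 big_ord0.
apply: (@lt_le_trans _ _ (\sum_(i < size (q n)) delta / (m.+1%:R * 2 ^+ m) * 2 ^+ m)).
  have lt_i (i : 'I_(size (q n))) : cmod (q n)`_i * t ^+ i < delta / (m.+1%:R * 2 ^+ m) * 2 ^+ m.
    have h := hn i; rewrite w0 coef0 subr0 in h.
    apply: le_lt_trans (_ : _ <= cmod (q n)`_i * 2 ^+ m) _; last by rewrite ltr_pM2r//; pos.
    apply: ler_wpM2l => //; apply: (@le_trans _ _ (2 ^+ i)).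
      by apply: lerXn2r; rewrite ?nnegrE.
    apply: ler_weXn2l; first lra.
    by rewrite -ltnS (leq_trans (ltn_ord i)).
  rewrite (bigD1 (Ordinal s0)) // [ltRHS](bigD1 (Ordinal s0)) //.
  by apply: ltr_leD; [exact: (lt_i (Ordinal s0))|apply: ler_sum => i _; exact: ltW (lt_i i)].
rewrite sumr_const card_ord -(mulr_natr _ (size (q n))).
have E : delta / (m.+1%:R * 2 ^+ m) * 2 ^+ m * m.+1%:R = delta.
  rewrite -mulrA [2 ^+ m * _]mulrC divfK//; apply: lt0r_neq0; pos.
by rewrite -{2}E; apply: ler_wpM2l; [pos|rewrite ler_nat].
Qed.

Local Notation denominator_of := (denominator_of phi rho).

(** The coefficients [d] of [w * phi] and the divided difference [pdiv c z0] satisfy the same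
    recursion of order one. For [z0 != 0] it determines a sequence from its first entry, and the
    vanishing at [z0] makes the first entries equal. *)
Lemma denominator_divide w z0 : cmod z0 < rho -> denominator_of (w * ('X - z0%:P)) ->
  psum (pmul (w * ('X - z0%:P)) phi) z0 = 0 -> denominator_of w.
Proof.
move=> z0r hw W0 t0 t00 t0r; pose c := pmul (w * ('X - z0%:P)) phi.
pose d := pmul w phi.
have cE j : c j = (if j is k.+1 then d k else 0) - z0 * d j.
  rewrite /c mulrC pmulA -polyCN.
  rewrite -['X]mul1r pmulMXaddC mulNr; congr (_ - _).
  by case: j => // j; rewrite pmul1.
pose t := (Num.max t0 (cmod z0) + rho) / 2.
have mt : Num.max t0 (cmod z0) < rho by rewrite gt_max t0r.
have tm : Num.max t0 (cmod z0) < t by rewrite /t; lra.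
have tr : t < rho by rewrite /t; lra.
move: tm; rewrite gt_max => /andP[t0t zt].
have tp : 0 < t by exact: lt_trans t0t.
have hc := hw t tp tr.
suff dE : d = pdiv c z0.
  by apply: (@pbound_le _ _ t); [rewrite -/d dE; exact: pbound_pdiv|rewrite !ltW].
have S j := pdivS j tp hc zt.
have [z00|z00] := eqVneq z0 0.
  by apply/funext => j; rewrite S -/c cE z00 !mul0r subr0 addr0.
have V0 : c 0%N + z0 * pdiv c z0 0%N = 0.
  rewrite -[RHS]W0 -/c (psum_shift tp hc zt); congr (_ + _ * _).
  by rewrite /pdiv; under eq_fun do rewrite addn0.
apply/funext; elim=> [|j ih].
  apply: (mulfI z00); apply/eqP; rewrite -subr_eq0 -oppr_eq0; apply/eqP.
  by rewrite -[RHS]V0 cE; ring.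
apply: (mulfI z00); have := S j; rewrite -ih -/c cE => E.
by apply: (addrI (d j - z0 * d j.+1)); rewrite -E; ring.
Qed.

Lemma coprime_denominator : exists w, [/\ w != 0, denominator_of w &
  forall z, cmod z < rho -> root w z -> psum (pmul w phi) z != 0].
Proof.
have [w0 cw0 w00] := cluster_exists; have := cluster_denominator row cw0.
have [k] := ubnP (size w0); elim: k w0 {cw0} w00 => // k ih w w0 wk hw.
have [h|] := pselect (forall z, cmod z < rho -> root w z -> psum (pmul w phi) z != 0).
  by exists w.
move=> /existsNP[z /not_implyP[zr /not_implyP[wz /negP/negPn/eqP W0]]].
have [w' wE] := factor_theorem _ _ wz.
have w'0 : w' != 0 by apply: contraNneq w0 => w'0; rewrite wE w'0 mul0r.
apply: (ih w') => //.
  by move: wk; rewrite wE size_mul ?polyXsubC_eq0// size_XsubC addn2 /= ltnS.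
by apply: (denominator_divide zr); rewrite -wE.
Qed.
End Cluster.
Lemma mup_factor (R : realType) (z : R[i]) (w : {poly R[i]}) : w != 0 ->
  exists2 w1 : {poly R[i]}, w1.[z] != 0 & w = w1 * ('X - z%:P) ^+ mup z w.
Proof.
move=> w0; have [w1 w1E] : exists w1, w = w1 * ('X - z%:P) ^+ mup z w.
  by apply/dvdpP; rewrite -mup_geq.
exists w1 => //; apply/negP => w1r; have : dvdp (('X - z%:P) ^+ (mup z w).+1) w.
  by rewrite {2}w1E exprS; apply: dvdp_mul => //; rewrite dvdp_XsubCl.
by rewrite -mup_geq// ltnn.
Qed.

(** * The identity [w f = W] in the whole disk and the poles of [f] *)

Section Identity.
Variables (R : realType) (phi : nat -> R[i]) (rho : R).
Local Notation C := R[i].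
Implicit Types (z : C) (w b : {poly C}) (t e d : R) (F g h : C -> C).

(** Identities for meromorphic functions hold off the centre only, where their values are
    meaningful; this carries them over to the centre for analytic functions. *)
Lemma pseries_eq g h z0 t : 0 < t -> has_pseries g z0 t -> has_pseries h z0 t ->
  (forall z, z != z0 -> cmod (z - z0) < t -> g z = h z) -> g z0 = h z0.
Proof.
move=> t0 hg hh E.
have hD := has_pseriesD t0 hg (has_pseriesM (-1)%:P t0 hh).
have := pseries_zero t0 hD _ (z := z0); rewrite subrr cmod0 hornerC mulN1r.
move=> H; apply/eqP; rewrite -subr_eq0; apply/eqP; apply: H => // e e0.
pose s := Num.min e t / 2.
have mt : 0 < Num.min e t by rewrite lt_min e0.
have s0 : 0 < s by rewrite /s; lra.
have sm : s < Num.min e t by rewrite /s; lra.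
move: sm; rewrite lt_min => /andP[se st].
have E1 : z0 + s%:C - z0 = s%:C by rewrite addrC addKr.
exists (z0 + s%:C); rewrite E1 cmod_real ?ltW//; split => //.
  by rewrite -subr_eq0 E1 -cmod_gt0 cmod_real// ltW.
rewrite hornerC mulN1r E ?subrr//; last by rewrite E1 cmod_real// ltW.
by rewrite -subr_eq0 E1 -cmod_gt0 cmod_real// ltW.
Qed.

(** The neighbourhood is punctured because [F] may take an arbitrary value at the centre. *)
Definition agrees w F z0 := exists2 d, 0 < d & forall z, z != z0 ->
  cmod (z - z0) < d -> w.[z] * F z = psum (pmul w phi) z.

Variable w : {poly C}.
Hypothesis rho0 : 0 < rho.
Hypothesis hw : denominator_of phi rho w.
Local Notation W := (psum (pmul w phi)).

Lemma numerator_pseries z0 : cmod z0 < rho -> exists2 t, 0 < t & has_pseries W z0 t.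
Proof.
move=> zr; pose t := (cmod z0 + rho) / 2.
have zt : cmod z0 < t by rewrite /t; lra.
have tr : t < rho by rewrite /t; lra.
have z00 := cmod_ge0 z0.
have t0 : 0 < t by lra.
exists (t - cmod (z0 - 0)); first by rewrite subr0; lra.
apply: has_pseries_recentre; first by rewrite subr0.
apply: has_pseries_psum; exact: hw.
Qed.

(** After multiplication by [(z - z0)^k] both sides are power series, and the identity theorem
    applies to their difference. *)
Lemma agrees_of_frequently F z0 : cmod z0 < rho -> meromorphic_at F z0 ->
    (forall e, 0 < e -> exists z, [/\ z != z0, cmod (z - z0) < e &
       w.[z] * F z = W z]) ->
  agrees w F z0.
Proof.
move=> zr [k [g [/analytic_atP[t1 t10 hg] /dnearCP[r r0 hF]]]] acc.
have [t2 t20 hW] := numerator_pseries zr.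
pose t := Num.min r (Num.min t1 t2).
have t0 : 0 < t by rewrite /t !lt_min r0 t10.
have tr : t <= r by rewrite /t ge_min lexx.
have tt1 : t <= t1 by rewrite /t !ge_min lexx orbT.
have tt2 : t <= t2 by rewrite /t !ge_min lexx !orbT.
have hg' : has_pseries g z0 t by apply: has_pseries_le hg; rewrite ltW.
have hW' : has_pseries W z0 t by apply: has_pseries_le hW; rewrite ltW.
have hD := has_pseriesD t0 (has_pseriesM w t0 hg')
  (has_pseriesM (- ('X - z0%:P) ^+ k) t0 hW').
have DE z : z != z0 -> cmod (z - z0) < t ->
    (w.[z] * g z + (- ('X - z0%:P) ^+ k).[z] * W z = 0) <-> (w.[z] * F z = W z).
  move=> zz0 zt; rewrite hF//; last by lra.
  have zk : (z - z0) ^+ k != 0 by rewrite expf_neq0// subr_eq0.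
  have -> : (- ('X - z0%:P) ^+ k).[z] = - (z - z0) ^+ k by rewrite !hornerE.
  split=> [/eqP|<-]; last by field.
  rewrite mulNr subr_eq0 => /eqP E; apply: (mulIf zk).
  by rewrite mulrA divfK// E mulrC.
exists t => // z zz0 zt; apply/DE => //.
apply: (pseries_zero t0 hD _ zt) => e e0.
have [|y [yz0 ye yE]] := acc (Num.min e t); first by rewrite lt_min e0.
by move: ye; rewrite lt_min => /andP[ye yt]; exists y; split => //; apply/DE.
Qed.

Lemma agrees_near F z0 : agrees w F z0 ->
  exists2 d, 0 < d & forall z, cmod (z - z0) < d -> agrees w F z.
Proof.
move=> [d d0 h]; exists d => // z zd.
have [->|zz0] := eqVneq z z0; first by exists d.
have zp : 0 < cmod (z - z0) by rewrite cmod_gt0 subr_eq0.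
exists (Num.min (d - cmod (z - z0)) (cmod (z - z0))); first by rewrite lt_min subr_gt0 zd.
move=> y yz; rewrite lt_min => /andP[y1 y2]; apply: h.
  by apply: contraTneq y2 => ->; rewrite cmodBC ltxx.
have := cmod_tri y z z0; lra.
Qed.

(** Continuation along the segment from 0 to [z0]: the supremum of the parameters up to which
    agreement holds is attained by the identity theorem, and passed by openness unless it is 1. *)
Lemma agrees_segment F z0 : cmod z0 < rho ->
    (forall z, cmod z < rho -> meromorphic_at F z) -> agrees w F 0 ->
  agrees w F z0.
Proof.
move=> zr mF a0; have [->//|z00] := eqVneq z0 0.
have zp : 0 < cmod z0 by rewrite cmod_gt0.
pose G (s : R) := agrees w F (s%:C * z0).
pose S : set R := [set s | 0 <= s <= 1 /\ forall s', 0 <= s' <= s -> G s'].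
have S0 : S 0.
  split=> [|s /andP[s0 s0']]; first by rewrite lexx ler01.
  by rewrite /G (_ : s = 0) ?mul0r//; apply/eqP; rewrite eq_le s0'.
have supS : has_sup S by split; [exists 0|exists 1 => s [/andP[]]].
pose u := sup S.
have u0 : 0 <= u by apply: ub_le_sup => //; case: supS.
have u1 : u <= 1 by apply: ge_sup => [|s [/andP[]]//]; exists 0.
have low s : 0 <= s -> s < u -> G s.
  move=> s0 su; have us : 0 < u - s by rewrite subr_gt0.
  have [v [_ Sv]] := sup_adherent us supS; rewrite -/u subKr => sv.
  by apply: Sv; rewrite s0 ltW.
have zs s s' : cmod (s%:C * z0 - s'%:C * z0) = `|s - s'| * cmod z0.
  rewrite -mulrBl cmodM -rmorphB /= ; congr (_ * _).
  by rewrite /cmod /= expr0n addr0 sqrtr_sqr.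
have Gu : G u.
  have [un|u_0] := leP u 0.
    by rewrite /G (_ : u = 0) ?mul0r//; apply/eqP; rewrite eq_le un.
  have ur : cmod (u%:C * z0) < rho.
    by rewrite cmodM cmod_real//; apply: le_lt_trans zr; rewrite ler_piMl.
  apply: agrees_of_frequently => //; first exact: mF.
  (* The parameter [s < u] is so close to [u] that [s * z0] lies within [e / 2] of [u * z0], and
     [u / 2] keeps it nonnegative. *)
  move=> e e0; pose s := Num.max (u / 2) (u - e / (2 * cmod z0)).
  have e20 : 0 < e / (2 * cmod z0) by pos.
  have su : s < u by rewrite /s gt_max; lra.
  have s1 : u / 2 <= s by rewrite /s le_max lexx.
  have s2 : u - e / (2 * cmod z0) <= s by rewrite /s le_max lexx orbT.
  clearbody s; have s0 : 0 <= s by lra.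
  have [d d0 hd] := low s s0 su.
  pose y := (u - s) * cmod z0.
  have y0 : 0 < y by rewrite /y; apply: mulr_gt0; lra.
  (* Agreement at [s * z0] holds on a punctured disk only, so the point is shifted by [r]: small
     enough to stay in that disk and near [u * z0], and to miss [u * z0] itself. *)
  pose r := Num.min d (Num.min y (e / 2)) / 2.
  have r0 : 0 < r by rewrite /r; apply: divr_gt0 => //; rewrite !lt_min d0 y0 divr_gt0.
  have rd : r < d.
    have : 2 * r <= d by rewrite /r mulrC divfK ?pnatr_eq0// ge_min lexx.
    lra.
  have ry : r < y.
    have : 2 * r <= y by rewrite /r mulrC divfK ?pnatr_eq0// !ge_min lexx orbT.
    lra.
  have re : r < e / 2.
    have : 2 * r <= e / 2 by rewrite /r mulrC divfK ?pnatr_eq0// !ge_min lexx !orbT.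
    lra.
  clearbody r; have E1 : s%:C * z0 + r%:C - s%:C * z0 = r%:C by rewrite addrC addKr.
  have yE : cmod (s%:C * z0 - u%:C * z0) = y.
    by rewrite zs distrC gtr0_norm ?subr_gt0.
  have ye : y <= e / 2.
    have : (u - s) * (2 * cmod z0) <= e by rewrite -ler_pdivlMr; [lra|pos].
    rewrite /y; lra.
  exists (s%:C * z0 + r%:C); split.
  - apply/eqP => E2; have := yE; rewrite -E2 cmodBC E1 cmod_real; lra.
  - have := cmod_tri (s%:C * z0 + r%:C) (s%:C * z0) (u%:C * z0).
    rewrite E1 yE cmod_real; lra.
  - apply: hd; last by rewrite E1 cmod_real// ltW.
    by rewrite -subr_eq0 E1 -cmod_gt0 cmod_real// ltW.
have [u_1|u_1] := ltP u 1; last first.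
  have -> : z0 = u%:C * z0 by rewrite (_ : u = 1) ?mul1r//; apply/eqP; rewrite eq_le u1.
  exact: Gu.
have [d d0 hd] := agrees_near Gu.
pose v := Num.min 1 (u + d / (2 * cmod z0)).
have d20 : 0 < d / (2 * cmod z0) by pos.
have uv : u < v by rewrite /v lt_min u_1; lra.
have v1 : v <= 1 by rewrite /v ge_min lexx.
have v2 : v <= u + d / (2 * cmod z0) by rewrite /v ge_min lexx orbT.
clearbody v; suff Sv : S v.
  have : v <= u by apply: ub_le_sup => //; case: supS.
  lra.
split=> [|s /andP[s0 sv]]; first lra.
have [su|us] := ltP s u; first exact: low.
apply: hd; rewrite zs ger0_norm ?subr_ge0//.
have : (v - u) * (2 * cmod z0) <= d by rewrite -ler_pdivlMr; [lra|pos].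
have : (s - u) * cmod z0 <= (v - u) * cmod z0 by apply: ler_wpM2r; lra.
lra.
Qed.

Lemma agrees_origin F : meromorphic_extension phi (disk rho) F -> agrees w F 0.
Proof.
move=> [/nearCP[r r0 h] _].
have hc z : cmod z < r -> ccvg (psums phi z) (F z).
  move=> zr; have := h z; rewrite subr0 => /(_ zr) /cvg_ccvg.
  by apply: ccvg_ext => n; rewrite /series /= big_mkord.
have r2 : 0 < r / 2 by rewrite divr_gt0.
exists (r / 2) => // z _; rewrite subr0 => zr.
rewrite (psum_pmul w r2 (pbound_of_cvg r0 hc) zr); congr (_ * _).
by apply/esym/psumE/hc; lra.
Qed.

Lemma agrees_disk F z0 : meromorphic_extension phi (disk rho) F ->
  cmod z0 < rho -> agrees w F z0.
Proof.
by move=> hF zr; apply: agrees_segment => //; [case: hF|exact: agrees_origin].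
Qed.

(* Comparing orders at [z0] in [w F = W] shows that all the poles of [F] come
   from the zeros of [w]. *)
Lemma denominator_order F z0 : w != 0 -> cmod z0 < rho ->
    meromorphic_extension phi (disk rho) F ->
  (exists2 t, 0 < t & forall z, z != z0 -> cmod (z - z0) < t -> F z = 0) \/
  exists i k h t, [/\ 0 < t, has_pseries h z0 t, h z0 != 0,
    (k <= mup z0 w + i)%N /\ (W z0 != 0 -> k = (mup z0 w + i)%N) &
    forall z, z != z0 -> cmod (z - z0) < t ->
      F z = (z - z0) ^+ i / (z - z0) ^+ k * h z].
Proof.
move=> w0 zr hF; have [|//|[i [k [h [t1 [t10 hh h0 FE]]]]]] := @meromorphic_order R F z0.
  by case: hF => _; apply.
  by left.
right; exists i, k, h, t1.
have [d d0 hd] := agrees_disk hF zr; have [t2 t20 hW] := numerator_pseries zr.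
pose t := Num.min d (Num.min t1 t2).
have t0 : 0 < t by rewrite /t !lt_min d0 t10.
have td : t <= d by rewrite /t ge_min lexx.
have tt1 : t <= t1 by rewrite /t !ge_min lexx orbT.
have tt2 : t <= t2 by rewrite /t !ge_min lexx !orbT.
have hh' : has_pseries h z0 t by apply: has_pseries_le hh; rewrite ltW.
have hW' : has_pseries W z0 t by apply: has_pseries_le hW; rewrite ltW.
have [w1 w1z w1E] := mup_factor z0 w0.
move: w1E; move: (mup z0 w) => nu w1E.
have key z : z != z0 -> cmod (z - z0) < t ->
    (z - z0) ^+ (nu + i) * (w1.[z] * h z) = (z - z0) ^+ k * W z.
  move=> zz0 zt; have zt1 : cmod (z - z0) < t1 by lra.
  have zd : cmod (z - z0) < d by lra.
  have zk : (z - z0) ^+ k != 0 by rewrite expf_neq0// subr_eq0.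
  have wz : w.[z] = w1.[z] * (z - z0) ^+ nu by rewrite {1}w1E !hornerE.
  rewrite -(hd z zz0 zd) FE// wz exprD.
  by field.
have XE (e : nat) z : (('X - z0%:P) ^+ e).[z] = (z - z0) ^+ e by rewrite horner_exp hornerXsubC.
have hX (e : nat) : has_pseries (fun z => (('X - z0%:P) ^+ e * w1).[z] * h z) z0 t by exact: has_pseriesM.
have hXW (e : nat) : has_pseries (fun z => (('X - z0%:P) ^+ e).[z] * W z) z0 t by exact: has_pseriesM.
have sub0 (e1 e2 : nat) : (e1 < e2)%N -> (z0 - z0) ^+ (e2 - e1) = 0.
  by move=> e12; rewrite subrr expr0n subn_eq0 leqNgt e12.
have le : (k <= nu + i)%N.
  rewrite leqNgt; apply/negP => lt; have := pseries_eq t0 (hX 0%N) (hXW (k - (nu + i))%N).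
  rewrite XE sub0// mul0r expr0 mul1r => E.
  suff /eqP : w1.[z0] * h z0 = 0 by rewrite mulf_eq0 (negbTE w1z) (negbTE h0).
  apply: E => z zz0 zt; have zk : (z - z0) ^+ (nu + i) != 0 by rewrite expf_neq0// subr_eq0.
  by apply: (mulfI zk); rewrite XE key// [RHS]mulrA -exprD subnKC// ltnW.
split=> //; split=> // W0; apply/eqP; rewrite eqn_leq le /= leqNgt; apply/negP => lt.
have := pseries_eq t0 (hX (nu + i - k)%N) (hXW 0%N).
rewrite !hornerM !XE sub0// !mul0r expr0 mul1r => E.
suff /eqP : W z0 = 0 by rewrite (negbTE W0).
rewrite -E// => z zz0 zt; have zk : (z - z0) ^+ k != 0 by rewrite expf_neq0// subr_eq0.
rewrite hornerM XE hornerC mul1r.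
apply: (mulfI zk); rewrite -key// -!mulrA [LHS]mulrA -exprD subnKC//.
Qed.

Lemma denominator_pole F z0 : w != 0 -> cmod z0 < rho -> root w z0 -> W z0 != 0 ->
  meromorphic_extension phi (disk rho) F -> pole_of_order F z0 (mup z0 w).
Proof.
move=> w0 zr wz W0 hF; have nu0 : (0 < mup z0 w)%N.
  by rewrite -XsubC_dvd// dvdp_XsubCl.
have [[t t0 F0]|[i [k [h [t [t0 hh h0 [_ /(_ W0) kE] FE]]]]]] := denominator_order w0 zr hF.
  have [d d0 hd] := agrees_disk hF zr; have [t2 t20 hW] := numerator_pseries zr.
  pose t' := Num.min t (Num.min d t2).
  have t'0 : 0 < t' by rewrite /t' !lt_min t0 d0.
  have tt : t' <= t by rewrite /t' ge_min lexx.
  have td : t' <= d by rewrite /t' !ge_min lexx orbT.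
  have tt2 : t' <= t2 by rewrite /t' !ge_min lexx !orbT.
  case/eqP: W0; have hW' : has_pseries W z0 t' by apply: has_pseries_le hW; rewrite ltW.
  have := pseries_eq t'0 hW' (has_pseries_poly 0 z0 t'); rewrite horner0; apply.
  move=> z zz0 zt; have zd := lt_le_trans zt td; have zt1 := lt_le_trans zt tt.
  by rewrite horner0 -(hd z zz0 zd) (F0 z zz0 zt1) mulr0.
split=> //; exists h; split=> //; first by apply/analytic_atP; exists t.
apply/dnearCP; exists t => // z zz0 zt; rewrite (FE z zz0 zt) kE exprD.
rewrite mulrC; congr (h z * _); rewrite invfM mulrCA mulfV ?mulr1//.
by rewrite expf_neq0// subr_eq0.
Qed.
End Identity.

(** * Limit points of zeros inside the disk *)

Section InteriorRoots.
Variables (R : realType) (phi : nat -> R[i]) (m : nat).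
Variables (p q qs : nat -> {poly R[i]}) (A : nat -> R[i]) (lam : nat -> nat).
Variables (rho : R) (a : nat -> R) (N0 : nat).
Hypothesis row : pade_row phi m p q qs A lam rho a N0.
Local Notation C := R[i].
Implicit Types (z zeta : C) (w : {poly C}) (t x y e c : R) (n k : nat).

(** The negation in usable form: along infinitely many indices of [S] the polynomials are bounded
    below on one fixed disk, by the contrapositive of [roots_of_small]. *)
Lemma not_roots_tend (r : nat -> {poly C}) (S : set nat) zeta :
    (forall n, (N0 <= n)%N -> normalized (r n) /\ (size (r n) <= m.+1)%N) ->
    ~ roots_tend r S zeta ->
  exists2 kap, 0 < kap & exists2 d, 0 < d & forall N, exists n,
    [/\ (N <= n)%N, S n & forall z, cmod (z - zeta) <= d -> kap <= cmod (r n).[z]].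
Proof.
move=> hr /existsNP[e /not_implyP[e0 /forallNP he]].
have [eta eta0 heta] := roots_of_small m zeta e0.
exists eta => //; exists (e / 2); first by rewrite divr_gt0.
move=> N; have /existsNP[n /not_implyP[Nn /not_implyP[Sn nr]]] := he (maxn N0 N).
move: Nn; rewrite geq_max => /andP[n0 Nn]; have [rn rm] := hr n n0.
exists n; split=> // z zd; rewrite leNgt; apply/negP => h.
by apply: nr; exact: (heta (r n) z).
Qed.

(** Evaluated at [zeta + s] with a small real [s], a smaller multiplicity would make the cofactor
    [w1] be [O(s)], although [w1] does not vanish at [zeta]. *)
Lemma multiplicity_ge w zeta l B s0 : w != 0 -> 0 < s0 ->
    (forall z, z != zeta -> cmod (z - zeta) < s0 ->
      cmod w.[z] <= B * cmod (z - zeta) ^+ l) ->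
  (l <= mup zeta w)%N.
Proof.
move=> w0 s00 h; rewrite leqNgt; apply/negP => lt.
have [w1 w1E] : exists w1, w = w1 * ('X - zeta%:P) ^+ mup zeta w.
  by apply/dvdpP; rewrite -mup_geq.
move: lt w1E; set nu := mup zeta w => lt w1E.
have w1z : w1.[zeta] != 0.
  apply/negP => w1r; have : dvdp (('X - zeta%:P) ^+ nu.+1) w.
    by rewrite w1E exprS; apply: dvdp_mul => //; rewrite dvdp_XsubCl.
  by rewrite -mup_geq// ltnn.
clearbody nu; have [K K0 hK] := has_pseries_lip ltr01 (has_pseries_poly w1 zeta 1).
have W0 : 0 < cmod w1.[zeta] by rewrite cmod_gt0.
pose T := `|B| + K + 1; have T0 : 0 < T.
  by rewrite /T; have := normr_ge0 B => hB; lra.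
pose s := Num.min (s0 / 2) (Num.min (1 / 4) (cmod w1.[zeta] / (2 * T))).
have s0' : 0 < s by rewrite /s !lt_min divr_gt0//=; apply/andP; split; [lra|pos].
have s1 : s <= s0 / 2 by rewrite /s ge_min lexx.
have s2 : s <= 1 / 4 by rewrite /s !ge_min lexx orbT.
have s3 : s * (2 * T) <= cmod w1.[zeta].
  rewrite -ler_pdivlMr; [by rewrite /s !ge_min lexx !orbT|pos].
clearbody s; pose z : C := zeta + s%:C.
have zE : z - zeta = s%:C by rewrite /z addrC addKr.
have zs : cmod (z - zeta) = s by rewrite zE cmod_real// ltW.
have zz : z != zeta by rewrite -subr_eq0 -cmod_gt0 zs.
have h1 : cmod w.[z] <= B * s ^+ l by rewrite -zs; apply: h => //; rewrite zs; lra.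
have h2 : cmod (w1.[z] - w1.[zeta]) <= K * s by rewrite -zs; apply: hK; rewrite zs; lra.
have wz : cmod w.[z] = cmod w1.[z] * s ^+ nu.
  by rewrite {1}w1E !hornerE cmodM cmodX zs.
have snu : 0 < s ^+ nu by rewrite exprn_gt0.
have h3 : cmod w1.[z] <= `|B| * s.
  rewrite -(ler_pM2r snu) -wz; apply: le_trans h1 _.
  have -> : `|B| * s * s ^+ nu = `|B| * s ^+ nu.+1 by rewrite exprS mulrA.
  apply: (@le_trans _ _ (`|B| * s ^+ l)).
    by apply: ler_wpM2r; [pos|exact: ler_norm].
  have s_1 : s <= 1 by lra.
  by apply: ler_wpM2l; [exact: normr_ge0|exact: ler_wiXn2l (ltW s0') s_1 _ _ lt].
have h4 := cmod_dist w1.[zeta] w1.[z]; rewrite cmodBC in h4.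
have h5 : 0 <= `|B| * s by pos. have h6 : 0 <= K * s by pos.
have h7 : s * (2 * T) = 2 * (`|B| * s) + 2 * (K * s) + 2 * s by rewrite /T; ring.
rewrite h7 in s3; lra.
Qed.

(** The identity multiplied by [w] expresses [w * A n * z^e * qs n] through [q n.+1] times the
    remainder at [n] and [q n] times the remainder at [n + 1]. If [qs n] stays away from 0, dividing
    by [a n * |z|^e] bounds [w z] by a constant times [|z - zeta|^l]; the index [n] may depend on
    [z], the constant does not. *)
Lemma interior_multiplicity w zeta l c B r0 :
    w != 0 -> denominator_of phi rho w -> cmod zeta < rho -> 0 < c ->
    ~ roots_tend qs [set n | c * a n <= cmod (A n)] zeta ->
    0 <= B -> 0 < r0 ->
    (forall z, z != zeta -> cmod (z - zeta) < r0 -> exists N, forall n, (N <= n)%N ->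
      cmod (q n).[z] <= B * cmod (z - zeta) ^+ l) ->
  (l <= mup zeta w)%N.
Proof.
move=> w0 hw zr c0 nstar B0 r00 hq; have rho0 := row_rho row.
have [kap kap0 [d d0 hd]] := not_roots_tend (row_qs row) nstar.
pose r := (cmod zeta + rho) / 2.
have z0 := cmod_ge0 zeta.
have zr' : cmod zeta < r by rewrite /r; lra. have rr : r < rho by rewrite /r; lra.
have r_0 : 0 < r by lra.
have [D D0 [K N0K hK]] := remainder_bound row hw r_0 rr.
have [kp hkp] : exists kp : R, rho^-1 < kp by exists (rho^-1 + 1); lra.
have kp0 : 0 < kp by apply: lt_trans hkp; rewrite invr_gt0.
have [K' N0K' hK'] := ratio_le row hkp.
(* The last entry keeps [z] away from 0 when [zeta] is not 0; for [zeta = 0] the condition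
   [z != zeta] does this and 1 is a dummy. *)
pose s0 := Num.min r0 (Num.min d (Num.min (r - cmod zeta) (if zeta == 0 then 1 else cmod zeta))).
have s00 : 0 < s0.
  rewrite /s0 !lt_min r00 d0 subr_gt0 zr' /=; case: ifP => [|/negbT h]; first by [].
  by rewrite cmod_gt0.
have s01 : s0 <= r0 by rewrite /s0 ge_min lexx.
have s02 : s0 <= d by rewrite /s0 !ge_min lexx orbT.
have s03 : s0 <= r - cmod zeta by rewrite /s0 !ge_min lexx !orbT.
have s04 : s0 <= (if zeta == 0 then 1 else cmod zeta) by rewrite /s0 !ge_min lexx !orbT.
clearbody s0.
pose T := D * (1 + r) ^+ m.+1 * (1 + kp) * (2 * B) / (c * kap).
apply: (@multiplicity_ge w zeta l T s0) => // z zz zs.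
have z_0 : 0 < cmod z.
  rewrite cmod_gt0; apply: contraTneq zs => zE; rewrite -leNgt zE sub0r cmodN.
  move: s04; case: eqP => [h|//]; move: zz; rewrite zE h eqxx//.
have zr2 : cmod z <= r by have := cmod_dist z zeta; lra.
have zr0 : cmod (z - zeta) < r0 by lra.
have [N hN] := hq z zz zr0.
have [n [nn Sn hn]] := hd (maxn (maxn K K') N).
move: nn; rewrite !geq_max => /andP[/andP[Kn K'n] Nn].
have n0 := leq_trans N0K Kn; have an := row_a row n0; have an1 := row_a row (leqW n0).
have hqs : kap <= cmod (qs n).[z] by apply: hn; lra.
have q0 := hN n Nn; have q1 := hN n.+1 (leqW Nn).
have F0 := hK n z Kn zr2; have F1 := hK n.+1 z (leqW Kn) zr2.
have a1 := hK' n 1%N K'n; rewrite addn1 expr1 in a1.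
set W := psum (pmul w phi) z in F0 F1.
have E : w.[z] * (A n * z ^+ (n.+1 - lam n - lam n.+1) * (qs n).[z]) =
    (q n.+1).[z] * ((q n).[z] * W - w.[z] * (p n).[z]) -
    (q n).[z] * ((q n.+1).[z] * W - w.[z] * (p n.+1).[z]).
  by rewrite -(row_diff row)//; ring.
have l0 := row_lam_le row n0; have l1 := row_lam_le row (leqW n0).
have N2 := row_N0 row.
set e := (n.+1 - lam n - lam n.+1)%N in E.
have e0 : (n.+1 - lam n = e + lam n.+1)%N by rewrite /e; clear -l0 l1 N2 n0; lia.
have e1 : (n.+2 - lam n.+1 = e + (lam n).+1)%N by rewrite /e; clear -l0 l1 N2 n0; lia.
rewrite e0 exprD in F0; rewrite e1 exprD in F1.
have pw j : (j <= m.+1)%N -> cmod z ^+ j <= (1 + r) ^+ m.+1.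
  move=> jm; apply: (@le_trans _ _ ((1 + r) ^+ j)).
    apply: lerXn2r; rewrite ?nnegrE//; first by rewrite addr_ge0// ltW.
    by rewrite (le_trans zr2)// lerDr.
  by apply: ler_weXn2l => //; rewrite lerDl ltW.
have ze : 0 < cmod z ^+ e by rewrite exprn_gt0.
set Q := B * cmod (z - zeta) ^+ l in q0 q1.
have Q0 : 0 <= Q by exact: le_trans q0.
pose M := (1 + r) ^+ m.+1; have M0 : 0 < M by rewrite /M; pos.
have G0 : cmod ((q n).[z] * W - w.[z] * (p n).[z]) <= D * M * (a n * cmod z ^+ e).
  apply: le_trans F0 _; have := pw (lam n.+1) (leqW l1); rewrite -/M => h.
  apply: (@le_trans _ _ (D * (a n * (cmod z ^+ e * M)))); last first.
    by apply: eq_ler; ring.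
  apply: ler_wpM2l => //; apply: ler_wpM2l; first by pos.
  by apply: ler_wpM2l => //; pos.
have G1 : cmod ((q n.+1).[z] * W - w.[z] * (p n.+1).[z]) <=
    D * M * kp * (a n * cmod z ^+ e).
  apply: le_trans F1 _; have := pw (lam n).+1 l0; rewrite -/M => h.
  apply: (@le_trans _ _ (D * (a n * kp * (cmod z ^+ e * M)))); last first.
    by apply: eq_ler; ring.
  apply: ler_wpM2l => //; apply: ler_pM => //; [pos|pos|].
  by apply: ler_wpM2l => //; pos.
have := congr1 (@cmod R) E; rewrite !cmodM cmodX => {}E.
have : cmod w.[z] * (c * a n * cmod z ^+ e * kap) <=
    D * M * (1 + kp) * Q * (a n * cmod z ^+ e).
  apply: (@le_trans _ _ (cmod w.[z] * (cmod (A n) * cmod z ^+ e * cmod (qs n).[z]))).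
    apply: ler_wpM2l => //; apply: ler_pM => //; [pos|pos|].
    by apply: ler_wpM2r => //; pos.
  rewrite E; apply: le_trans (cmodB _ _) _; rewrite !cmodM.
  apply: (@le_trans _ _ (Q * (D * M * (a n * cmod z ^+ e)) +
      Q * (D * M * kp * (a n * cmod z ^+ e)))); last by apply: eq_ler; ring.
  by apply: lerD; apply: ler_pM.
have an_e : 0 < a n * cmod z ^+ e by pos.
have -> : cmod w.[z] * (c * a n * cmod z ^+ e * kap) =
  cmod w.[z] * (c * kap) * (a n * cmod z ^+ e) by ring.
rewrite ler_pM2r// => h.
have ck : 0 < c * kap by pos.
rewrite /T mulrAC ler_pdivlMr//; apply: le_trans h _.
have : 0 <= D * M * (1 + kp) * Q.
  by apply: mulr_ge0 => //; apply: mulr_ge0; [apply: mulr_ge0 => //; exact: ltW|by rewrite addr_ge0// ltW].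
rewrite -/M /Q => h1.
have -> : D * M * (1 + kp) * (2 * B) * cmod (z - zeta) ^+ l =
  2 * (D * M * (1 + kp) * (B * cmod (z - zeta) ^+ l)) by ring.
by rewrite ler_peMl// ler1n.
Qed.

(* [dist(zeta, P_n) -> 0] is the case [l = 1] of the hypothesis. *)
Lemma roots_tend_order1 zeta : roots_tend q setT zeta ->
  exists2 B, 0 <= B & exists2 r0 : R, 0 < r0 & forall z, z != zeta ->
    cmod (z - zeta) < r0 -> exists N, forall n, (N <= n)%N ->
      cmod (q n).[z] <= B * cmod (z - zeta) ^+ 1.
Proof.
move=> hz; have z0 := cmod_ge0 zeta; exists (2 * (2 + cmod zeta) ^+ m); first by pos.
exists 1 => // z zz zs; have zp : 0 < cmod (z - zeta) by rewrite cmod_gt0 subr_eq0.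
have [N hN] := hz _ zp; exists (maxn N0 N) => n; rewrite geq_max => /andP[n0 Nn].
have [v qv zv] := hN n Nn I; have [qn qm] := row_q row n0.
apply: le_trans (normalized_le_root z qn qm qv) _; rewrite expr1 mulrAC.
apply: ler_pM => //; first by have := cmod_ge0 z => h; pos.
  have := cmod_tri z zeta v; lra.
have := cmod_dist z zeta => h; have := cmod_ge0 z => h'.
by apply: lerXn2r; rewrite ?nnegrE; lra.
Qed.

(** Zeros within [|z - zeta|] of [zeta] are within twice that distance of [z], whence the factor
    [2^l]. *)
Lemma many_roots_order zeta l :
    (forall e, 0 < e -> exists N, forall n, (N <= n)%N ->
      (l <= count (fun v => (cmod (v - zeta) <= e)%R) (zeros (q n)))%N) ->
  exists2 B, 0 <= B & exists2 r0 : R, 0 < r0 & forall z, z != zeta ->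
    cmod (z - zeta) < r0 -> exists N, forall n, (N <= n)%N ->
      cmod (q n).[z] <= B * cmod (z - zeta) ^+ l.
Proof.
move=> hz; have z0 := cmod_ge0 zeta.
exists (2 ^+ l * (2 + cmod zeta) ^+ m); first by pos.
exists 1 => // z zz zs; have zp : 0 < cmod (z - zeta) by rewrite cmod_gt0 subr_eq0.
have [N hN] := hz _ zp; exists (maxn N0 N) => n; rewrite geq_max => /andP[n0 Nn].
have hc := hN n Nn; have [qn qm] := row_q row n0.
have hc' : (l <= count (fun v => (cmod (z - v) <= 2 * cmod (z - zeta))%R) (zeros (q n)))%N.
  apply: leq_trans hc _; apply: sub_count => v /= hv.
  by have := cmod_tri z zeta v; rewrite (cmodBC zeta v); lra.
have lm : (l <= m)%N.
  apply: leq_trans hc (leq_trans (count_size _ _) _).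
  by rewrite -ltnS -size_zeros// normalized_neq0.
apply: le_trans (normalized_le_near qn qm lm _ hc') _; first by pos.
rewrite exprMn [leRHS]mulrAC; apply: ler_wpM2l; first by pos.
have := cmod_dist z zeta => h; have := cmod_ge0 z => h'.
apply: (@le_trans _ _ ((1 + cmod z) ^+ m)).
  by apply: ler_weXn2l; [lra|exact: leq_subr].
by apply: lerXn2r; rewrite ?nnegrE; lra.
Qed.
End InteriorRoots.

(** * A quadratic multiplier that is small in the tangential directions *)

Section RadialMultiplier.
Variable R : realType.
Local Notation C := R[i].
Implicit Types (x y e : C) (r : R).

(** For a unit [e] of argument [s] the square is [17/16 + cos(2 s) / 2]. *)
Lemma cmod_one_quarter_sqr e : cmod e = 1 ->
  cmod (1 + e ^+ 2 / 4) ^+ 2 = 9 / 16 + complex.Re e ^+ 2.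
Proof.
move=> e1; have := sqr_cmod e; rewrite e1 expr1n => E.
have -> : (4 : C)^-1 = ((4 : R)^-1)%:C by rewrite fmorphV rmorph_nat.
rewrite sqr_cmod; case: e {e1} E => u v /= E.
rewrite !expr2 /=; have vE : v ^+ 2 = 1 - u ^+ 2 by rewrite E addrC addKr.
transitivity ((1 + (u ^+ 2 - v ^+ 2) / 4) ^+ 2 + (2 * u) ^+ 2 * v ^+ 2 / 16).
  by field.
by rewrite vE; field.
Qed.

(* At distance [r] from [x] the value at [y] is [1 + e^2 / 4], where [e] is the
   direction of [y - x] relative to the radial direction at [x]; it is small
   where [|y| = |x|], since [e] is then close to [+-i]. *)
Definition radial x r : {poly C} :=
  1 + ((x^* * ((r * cmod x)^-1)%:C) ^+ 2 / 4)%:P * ('X - x%:P) ^+ 2.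

Lemma radialE x y r :
  (radial x r).[y] = 1 + (x^* * ((r * cmod x)^-1)%:C * (y - x)) ^+ 2 / 4.
Proof.
rewrite /radial hornerD hornerC hornerM hornerC horner_exp hornerXsubC.
by rewrite [in RHS]exprMn mulrAC.
Qed.

Lemma radial_center x r : (radial x r).[x] = 1.
Proof. by rewrite radialE subrr mulr0 expr0n mul0r addr0. Qed.

Lemma radial_arg_cmod x y r : x != 0 -> 0 < r -> cmod (y - x) = r ->
  cmod (x^* * ((r * cmod x)^-1)%:C * (y - x)) = 1.
Proof.
move=> x0 r0 yr; have X0 : 0 < cmod x by rewrite cmod_gt0.
rewrite !cmodM cmod_conj yr cmod_real; last by pos.
by field; rewrite !gt_eqF.
Qed.

(** The law of cosines in the triangle with vertices 0, [x], [y] expresses the real part of the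
    direction through the moduli. *)
Lemma radial_sqr x y r : x != 0 -> 0 < r -> cmod (y - x) = r ->
  cmod (radial x r).[y] ^+ 2 =
  9 / 16 + ((cmod y ^+ 2 - cmod x ^+ 2 - r ^+ 2) / (2 * r * cmod x)) ^+ 2.
Proof.
move=> x0 r0 yr; have X0 : 0 < cmod x by rewrite cmod_gt0.
rewrite radialE cmod_one_quarter_sqr ?radial_arg_cmod//; congr (_ + _ ^+ 2).
have h3 := sqr_cmod (y - x); rewrite yr in h3; rewrite h3 !sqr_cmod.
transitivity ((complex.Re x * complex.Re (y - x) + complex.Im x * complex.Im (y - x)) /
  (r * cmod x)).
  case: x y {x0 yr h3} X0 => x1 x2 [y1 y2] X0 /=; ring.
rewrite !raddfB /=; field; rewrite !gt_eqF//.
Qed.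

Lemma radial_le x y r : x != 0 -> 0 < r -> cmod (y - x) = r ->
  cmod (radial x r).[y] <= 5 / 4.
Proof.
move=> x0 r0 yr; rewrite radialE; apply: le_trans (cmodD _ _) _.
rewrite cmod1 cmodM cmodX radial_arg_cmod// expr1n mul1r cmodV.
rewrite (cmod_nat R 4); lra.
Qed.

(** The real part of the direction is at most [1/5] in modulus, and [9/16 + 1/25 < (4/5)^2]. *)
Lemma radial_tangential x y r : x != 0 -> 0 < r -> cmod (y - x) = r ->
  10 * r <= cmod x -> `|cmod y - cmod x| <= r / 40 ->
  cmod (radial x r).[y] <= 4 / 5.
Proof.
move=> x0 r0 yr rx yx; have X0 : 0 < cmod x by rewrite cmod_gt0.
have h := radial_sqr x0 r0 yr; set u := _ / (2 * r * cmod x) in h.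
have D0 : 0 < 2 * r * cmod x by pos.
have hu : `|u| <= 1 / 5.
  rewrite /u normrM normfV (gtr0_norm D0) ler_pdivrMr//.
  have -> : cmod y ^+ 2 - cmod x ^+ 2 - r ^+ 2 =
    (cmod y - cmod x) * (cmod y + cmod x) - r ^+ 2 by ring.
  apply: le_trans (ler_normB _ _) _; rewrite normrM.
  rewrite [`|r ^+ 2|]ger0_norm; last by pos.
  have s0 : 0 <= cmod y + cmod x by apply: addr_ge0.
  rewrite (ger0_norm s0).
  have yle : cmod y + cmod x <= 2 * cmod x + r.
    have := cmodD (y - x) x; rewrite subrK yr; lra.
  apply: (@le_trans _ _ (r / 40 * (2 * cmod x + r) + r * r)); last first.
    have : r * (10 * r) <= r * cmod x by apply: ler_wpM2l => //; exact: ltW.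
    have : 0 <= r * r by pos.
    move: (cmod x) => X; clear; move=> h h'; lra.
  by rewrite expr2 lerD2r; apply: ler_pM.
have u2 : u ^+ 2 <= 1 / 25.
  rewrite -real_normK ?num_real// (_ : 1 / 25 = (1 / 5) ^+ 2); last by field.
  by apply: lerXn2r; rewrite ?nnegrE//; lra.
clearbody u; rewrite -(@ler_pXn2r _ 2%N) ?nnegrE//; lra.
Qed.
End RadialMultiplier.

Lemma quadratic_ge0 (R : realType) (k : R) : 0 <= 2 + 100 * k ^+ 2 * 512.
Proof. by have := sqr_ge0 k; lra. Qed.

(** * Bounds for the remainders near a boundary point *)

Section Bootstrap.
Variables (R : realType) (a : nat -> R) (F : nat -> R[i] -> R[i]).
Variables (zeta : R[i]) (rho rho0 K0 : R) (N0 : nat).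
Local Notation C := R[i].
Implicit Types (x y z : C) (t r b v V : R) (n k i j J : nat).

Hypothesis rhoE : cmod zeta = rho.
Hypothesis rho_gt0 : 0 < rho.
Hypothesis rho0_gt0 : 0 < rho0.
Hypothesis rho0_le : 8 * rho0 <= rho.
Hypothesis K0_ge1 : 1 <= K0.
Hypothesis a_gt0 : forall n, (N0 <= n)%N -> 0 < a n.
Hypothesis a_ratio : forall e, 0 < e -> exists K, forall n, (K <= n)%N ->
  `|a n / a n.+1 - rho| < e.
Hypothesis a_conc : forall n, (N0 <= n)%N ->
  n.+1%:R * (a n / a n.+1) <= n.+2%:R * (a n.+1 / a n.+2).
Hypothesis F_lim : forall n, (N0 <= n)%N -> poly_limit zeta (2 * rho0) (F n).
Definition annulus x := rho0 / 2 <= cmod (x - zeta) <= 3 * rho0 / 2.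
Hypothesis F_rec : forall n k x, (N0 <= n)%N -> (n <= k)%N -> annulus x ->
  cmod (F n x) <= K0 * (\sum_(n <= i < k) a i * cmod x ^+ i + cmod (F k x)) /\
  cmod (F k x) <= K0 * (\sum_(n <= i < k) a i * cmod x ^+ i + cmod (F n x)).
Hypothesis F_apriori : forall e, 0 < e -> exists K, forall n x, (K <= n)%N ->
  annulus x -> cmod (F n x) <= expR (e * n%:R) * (a n * cmod x ^+ n).

Definition bounded_by n x V := cmod (F n x) <= V * (a n * cmod x ^+ n).

Local Notation slope n := (a n / a n.+1).

Lemma slope_mono n k : (N0 <= n)%N -> (n <= k)%N ->
  n.+1%:R * slope n <= k.+1%:R * slope k.
Proof.
move=> n0 /subnKC <-; elim: (k - n)%N => [|j ih]; first by rewrite addn0.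
rewrite addnS; apply: le_trans ih _; apply: a_conc; exact: leq_trans (leq_addr _ _).
Qed.

Lemma slope_gt0 n : (N0 <= n)%N -> 0 < slope n.
Proof. by move=> n0; rewrite divr_gt0// a_gt0// leqW. Qed.

(** Monotonicity of [(n + 1) * slope n] lets the slope drop at most by the factor [exp(j / n)]
    between [n] and [n + j]; these factors accumulate to a quadratic exponent. *)
Lemma growth_up n j : (N0 <= n)%N -> (0 < n)%N ->
  a (n + j)%N * slope n ^+ j <= a n * expR (2 * j%:R ^+ 2 / n%:R).
Proof.
move=> n0 n1; have sn := slope_gt0 n0; have an1 := a_gt0 (leqW n0); elim: j => [|j ih].
  by rewrite addn0 expr0 mulr1 expr0n /= mulr0 mul0r expR0 mulr1.
have nj : (N0 <= n + j)%N by exact: leq_trans (leq_addr _ _).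
have anj := a_gt0 nj; have anj1 := a_gt0 (leqW nj); have an := a_gt0 n0.
have np : 0 < n%:R :> R by rewrite ltr0n.
have h := slope_mono n0 (leq_addr j n).
have h1 : slope n <= slope (n + j) * expR (j%:R / n%:R).
  have hn : 0 < n.+1%:R :> R by rewrite ltr0n.
  rewrite -(ler_pM2l hn); apply: le_trans h _.
  rewrite [leRHS]mulrCA [leLHS]mulrC; apply: ler_wpM2l; first exact: ltW (slope_gt0 nj).
  apply: (@le_trans _ _ (n.+1%:R * (1 + j%:R / n%:R))); last first.
    by apply: ler_wpM2l; [pos|exact: expR_ge1Dx].
  rewrite mulrC mulrDl mul1r -[(n + j).+1%:R]natr1 -[n.+1%:R]natr1 natrD.
  have -> : j%:R / n%:R * (n%:R + 1) = j%:R + j%:R / n%:R :> R by field; rewrite gt_eqF.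
  have : 0 <= j%:R / n%:R :> R by pos.
  lra.
rewrite addnS exprSr.
have -> : a (n + j).+1 * (slope n ^+ j * slope n) = (a (n + j).+1 * slope n) * slope n ^+ j.
  by ring.
apply: (@le_trans _ _ (a (n + j)%N * expR (j%:R / n%:R) * slope n ^+ j)).
  apply: ler_wpM2r; first by pos.
  apply: (@le_trans _ _ (a (n + j).+1 * (slope (n + j) * expR (j%:R / n%:R)))).
    by apply: ler_wpM2l => //; exact: ltW.
  by rewrite mulrA [a (n + j).+1 * _]mulrC divfK// gt_eqF.
rewrite mulrAC; apply: le_trans (ler_wpM2r (expR_ge0 _) ih) _.
rewrite -[leLHS]mulrA -expRD; apply: ler_wpM2l; first exact: ltW.
rewrite ler_expR -mulrDl; apply: ler_wpM2r; first by pos.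
rewrite -[j.+1%:R]natr1 !expr2; have : 0 <= j%:R :> R by rewrite ler0n.
by move: (j%:R : R) => u u0; lra.
Qed.

Lemma growth_down n j : (0 < n)%N -> (2 * j <= n)%N -> (N0 <= n - j)%N ->
  a (n - j)%N <= a n * slope n ^+ j * expR (2 * j%:R ^+ 2 / n%:R).
Proof.
move=> n1; elim: j => [|j ih] jn nj.
  by rewrite subn0 expr0 mulr1 expr0n /= mulr0 mul0r expR0 mulr1.
have nj' : (N0 <= n - j)%N by nlia.
have {}ih := ih ltac:(nlia) nj'.
have n0 : (N0 <= n)%N by nlia.
have sn := slope_gt0 n0; have an := a_gt0 n0; have an1 := a_gt0 (leqW n0).
have E : (n - j = (n - j.+1).+1)%N by nlia.
have aj := a_gt0 nj'; have aj1 := a_gt0 nj.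
have h := @slope_mono (n - j.+1) n nj ltac:(nlia).
have np : 0 < n%:R :> R by rewrite ltr0n.
have j0 : 0 <= j%:R :> R by rewrite ler0n.
have jr : 2 * (j%:R + 1) <= n%:R :> R.
  by rewrite natr1 -natrM ler_nat.
rewrite -E natrB ?(leq_trans _ jn)// in h; last by nlia.
have njp : 0 < n%:R - j%:R :> R by lra.
have h1 : slope (n - j.+1) <= slope n * expR (2 * (j%:R + 1) / n%:R).
  rewrite -(ler_pM2l njp); apply: le_trans (le_trans _ h) _.
    by rewrite E.
  rewrite mulrC mulrCA; apply: ler_wpM2l; first exact: ltW.
  apply: (@le_trans _ _ ((n%:R - j%:R) * (1 + 2 * (j%:R + 1) / n%:R))); last first.
    by apply: ler_wpM2l; [exact: ltW|exact: expR_ge1Dx].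
  rewrite -[n.+1%:R]natr1 [leRHS]mulrDr mulr1.
  suff : j%:R + 1 <= (n%:R - j%:R) * (2 * (j%:R + 1) / n%:R) :> R.
    by move: (_ * (2 * _ / _)) => Z; lra.
  rewrite mulrA ler_pdivlMr//.
  have -> : (n%:R - j%:R) * (2 * (j%:R + 1)) = (j%:R + 1) * (2 * (n%:R - j%:R)) :> R by ring.
  apply: ler_wpM2l; lra.
have -> : a (n - j.+1)%N = slope (n - j.+1) * a (n - j)%N.
  by rewrite -E divfK// gt_eqF.
apply: le_trans (ler_wpM2r (ltW aj) h1) _.
apply: le_trans (ler_wpM2l _ ih) _.
  by apply: mulr_ge0; [exact: ltW|exact: expR_ge0].
have -> : slope n * expR (2 * (j%:R + 1) / n%:R) *
   (a n * slope n ^+ j * expR (2 * j%:R ^+ 2 / n%:R)) =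
   a n * slope n ^+ j.+1 * (expR (2 * (j%:R + 1) / n%:R) * expR (2 * j%:R ^+ 2 / n%:R)).
  by rewrite [slope n ^+ j.+1]exprS; ring.
rewrite -expRD; apply: ler_wpM2l; first by pos.
rewrite ler_expR -mulrDl; apply: ler_wpM2r; first by pos.
rewrite -[j.+1%:R]natr1 !expr2; move: (j%:R : R) j0 => u u0; lra.
Qed.

(** Delimits the number of steps for which the drift costs at most half of the linear gain. *)
Lemma exp_quadratic b n j : (0 < n)%N -> 4 * j%:R <= b * n%:R ->
  - (b * j%:R) + 2 * j%:R ^+ 2 / n%:R <= - (b * j%:R / 2).
Proof.
move=> n1 h; have np : 0 < n%:R :> R by rewrite ltr0n.
have j0 : 0 <= j%:R :> R by rewrite ler0n.
suff : 2 * j%:R ^+ 2 / n%:R <= b * j%:R / 2 by lra.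
rewrite ler_pdivrMr//; have := ler_wpM2r j0 h; rewrite expr2.
move: (j%:R : R) (n%:R : R) => u w; lra.
Qed.

Lemma term_up n j b x : (N0 <= n)%N -> (0 < n)%N -> 4 * j%:R <= b * n%:R ->
    cmod x <= slope n * expR (- b) ->
  a (n + j)%N * cmod x ^+ (n + j) <= expR (- (b * j%:R / 2)) * (a n * cmod x ^+ n).
Proof.
move=> n0 n1 jb xs; have sn := slope_gt0 n0; have an := a_gt0 n0; have an1 := a_gt0 (leqW n0).
have anj := a_gt0 (leq_trans n0 (leq_addr j n)).
rewrite exprD mulrCA [leRHS]mulrA [leRHS]mulrC; apply: ler_wpM2l; first by pos.
apply: (@le_trans _ _ (a (n + j)%N * (slope n ^+ j * expR (- b) ^+ j))).
  apply: ler_wpM2l; first exact: ltW.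
  rewrite -exprMn; apply: lerXn2r; rewrite ?nnegrE//.
  by apply: mulr_ge0; [exact: ltW|exact: expR_ge0].
rewrite mulrA; apply: le_trans (ler_wpM2r (exprn_ge0 j (expR_ge0 _)) (growth_up j n0 n1)) _.
rewrite -[leLHS]mulrA [leRHS]mulrC; apply: ler_wpM2l; first exact: ltW.
rewrite -expRM_natr -expRD ler_expR; have := exp_quadratic n1 jb.
rewrite mulNr; lra.
Qed.

Lemma term_down n j b x : (0 < n)%N -> (2 * j <= n)%N -> (N0 <= n - j)%N ->
    4 * j%:R <= b * n%:R -> slope n <= cmod x * expR (- b) ->
  a (n - j)%N * cmod x ^+ (n - j) <= expR (- (b * j%:R / 2)) * (a n * cmod x ^+ n).
Proof.
move=> n1 jn nj jb xs; have n0 : (N0 <= n)%N by nlia.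
have sn := slope_gt0 n0; have an := a_gt0 n0; have an1 := a_gt0 (leqW n0).
have -> : cmod x ^+ n = cmod x ^+ (n - j) * cmod x ^+ j by rewrite -exprD subnK//; nlia.
have -> : expR (- (b * j%:R / 2)) * (a n * (cmod x ^+ (n - j) * cmod x ^+ j)) =
  a n * cmod x ^+ j * expR (- (b * j%:R / 2)) * cmod x ^+ (n - j) by ring.
apply: ler_wpM2r; first by pos.
apply: le_trans (growth_down n1 jn nj) _; rewrite -[leLHS]mulrA -[leRHS]mulrA.
apply: ler_wpM2l; first exact: ltW.
apply: (@le_trans _ _ ((cmod x ^+ j * expR (- b) ^+ j) * expR (2 * j%:R ^+ 2 / n%:R))).
  apply: ler_wpM2r; first exact: expR_ge0.
  by rewrite -exprMn; apply: lerXn2r; rewrite ?nnegrE//; [exact: ltW|exact: le_trans (ltW sn) xs].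
rewrite -[leLHS]mulrA; apply: ler_wpM2l; first by pos.
rewrite -expRM_natr -expRD ler_expR; have := exp_quadratic n1 jb.
rewrite mulNr; lra.
Qed.

Lemma sum_exp_le b J : 0 < b -> \sum_(0 <= i < J) expR (- (b * i%:R / 2)) <= 1 + 2 / b.
Proof.
move=> b0; have e0 := expR_gt0 (- (b / 2)).
have e1 : expR (- (b / 2)) * (1 + b / 2) <= 1.
  have E : expR (- (b / 2)) * expR (b / 2) = 1 by rewrite -expRD addNr expR0.
  by rewrite -[leRHS]E; apply: ler_wpM2l; [exact: ltW|exact: expR_ge1Dx].
have e2 : expR (- (b / 2)) < 1 by nra.
have -> : \sum_(0 <= i < J) expR (- (b * i%:R / 2)) = \sum_(0 <= i < J) expR (- (b / 2)) ^+ i.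
  by apply: eq_bigr => i _; rewrite -expRM_natr; congr expR; ring.
apply: le_trans (geo_sum_le 0 J (ltW e0) e2) _.
rewrite expr0 ler_pdivrMr ?subr_gt0//.
have : 0 < 2 / b by pos. have bb : 2 / b * b = 2 by rewrite divfK// gt_eqF.
move: (expR (- (b / 2))) (2 / b) e0 e1 e2 bb => u w; nra.
Qed.

(* Off the circle [|x| = slope n] the recursion is a contraction, upwards inside
   and downwards outside. *)
Lemma side_bound n J b x V : (0 < n)%N -> (2 * J <= n)%N -> (N0 <= n - J)%N ->
    0 < b -> 4 * J%:R <= b * n%:R -> annulus x -> 0 <= V ->
    cmod x <= slope n * expR (- b) \/ slope n <= cmod x * expR (- b) ->
    bounded_by (n - J) x V -> bounded_by (n + J) x V ->
  bounded_by n x (K0 * (1 + 2 / b + expR (- (b * J%:R / 2)) * V)).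
Proof.
move=> n1 Jn nJ b0 Jb xA V0 side hd hu; have n0 : (N0 <= n)%N by nlia.
have an := a_gt0 n0; have axn : 0 <= a n * cmod x ^+ n by pos.
have Kp : 0 <= K0 := le_trans ler01 K0_ge1.
have jb i : (i <= J)%N -> 4 * i%:R <= b * n%:R.
  by move=> iJ; apply: le_trans Jb; rewrite ler_pM2l ?ler_nat.
have fin S G : S <= (1 + 2 / b) * (a n * cmod x ^+ n) ->
    G <= V * (expR (- (b * J%:R / 2)) * (a n * cmod x ^+ n)) ->
    cmod (F n x) <= K0 * (S + G) ->
    bounded_by n x (K0 * (1 + 2 / b + expR (- (b * J%:R / 2)) * V)).
  move=> hS hG h; apply: le_trans h _; rewrite -mulrA; apply: ler_wpM2l => //.
  by rewrite mulrDl; apply: lerD => //; apply: le_trans hG _; apply: eq_ler; ring.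
case: side => side.
- apply: (fin _ _ _ _ (F_rec n0 (leq_addr J n) xA).1); last first.
    apply: le_trans hu _; apply: ler_wpM2l => //; exact: term_up.
  rewrite -{1}[n]add0n big_addn addKn.
  apply: (@le_trans _ _ (\sum_(0 <= i < J) expR (- (b * i%:R / 2)) * (a n * cmod x ^+ n))).
    apply: ler_sum_nat => i /andP[_ iJ]; rewrite addnC.
    by apply: term_up => //; apply: jb; exact: ltnW.
  by rewrite -mulr_suml; apply: ler_wpM2r => //; exact: sum_exp_le.
- apply: (fin _ _ _ _ (F_rec nJ (leq_subr J n) xA).2); last first.
    apply: le_trans hd _; apply: ler_wpM2l => //; exact: term_down.
  rewrite big_nat_rev /= -{1}[(n - J)%N]add0n big_addn.
  have -> : (n - (n - J) = J)%N by nlia.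
  apply: (@le_trans _ _ (\sum_(0 <= i < J) expR (- (b * i%:R / 2)) * (a n * cmod x ^+ n))).
    apply: ler_sum_nat => i /andP[_ iJ].
    have -> : (n - J + n - (i + (n - J)).+1 = n - i.+1)%N by nlia.
    apply: le_trans (term_down (j := i.+1) (b := b) n1 _ _ _ side) _; [nlia|nlia|exact: jb|].
    apply: ler_wpM2r => //; rewrite ler_expR lerN2 ler_pM2r ?invr_gt0//.
    by rewrite ler_pM2l// ler_nat.
  by rewrite -mulr_suml; apply: ler_wpM2r => //; exact: sum_exp_le.
Qed.

Tactic Notation "restrict_to" hyp_list(hs) := clear - hs
  rhoE rho_gt0 rho0_gt0 rho0_le K0_ge1 a_gt0 a_ratio a_conc F_lim F_rec F_apriori.

Lemma bounded_by_le n x V V' : (N0 <= n)%N -> V <= V' -> bounded_by n x V -> bounded_by n x V'.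
Proof.
move=> n0 VV h; apply: le_trans h _; apply: ler_wpM2r => //.
by have an := a_gt0 n0; pos.
Qed.

Lemma slope_range : exists2 N, (N0 < N)%N & forall n, (N <= n)%N ->
  rho / 2 <= slope n <= 2 * rho.
Proof.
have [|K hK] := a_ratio (e := rho / 2); first by pos.
exists (maxn N0.+1 K) => [|n]; first exact: leq_maxl.
rewrite geq_max => /andP[_ /hK]; rewrite ltr_distl => /andP[h1 h2].
by apply/andP; split; lra.
Qed.

(** The window covers indices within [40 v n] of [n] and points within [Kx v] of [x0]. All three
    quantities scale with [v], so one improvement can be iterated. *)
Definition window Kx n x0 v := forall n1 x,
  `|n1%:R - n%:R| <= 40 * v * n%:R -> cmod (x - x0) <= Kx * v ->
  bounded_by n1 x (expR (v ^+ 2 * n%:R)).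

Lemma expR_pow_le (c e : R) N Y : 0 <= c -> c <= expR e -> 0 <= e -> N%:R <= Y ->
  c ^+ N <= expR (e * Y).
Proof.
move=> c0 ce e0 NY; apply: (@le_trans _ _ (expR e ^+ N)).
  by apply: lerXn2r; rewrite ?nnegrE//; exact: expR_ge0.
by rewrite -expRM_natr ler_expR; apply: ler_wpM2l.
Qed.

Lemma expR_pow_le_neg (c e : R) N Y : 0 <= c -> c <= expR (- e) -> 0 <= e -> Y <= N%:R ->
  c ^+ N <= expR (- (e * Y)).
Proof.
move=> c0 ce e0 NY; apply: (@le_trans _ _ (expR (- e) ^+ N)).
  by apply: lerXn2r; rewrite ?nnegrE//; exact: expR_ge0.
by rewrite -expRM_natr ler_expR mulNr lerN2; apply: ler_wpM2l.
Qed.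

(** Off the band of relative width [4 v] around the critical circle, [side_bound] replaces [exp(Y)],
    with [Y = v^2 n], by [5 K0 n <= exp(Y / 2)]. Inside the band a mean over a small circle is taken
    with a power of [radial]. The result [exp(361 Y / 400)] is the bound for [19/20 v], since
    [(19/20)^2 = 361/400]. The constant in [Kx] makes the band, of width [16 rho v], thin compared
    with that circle. *)
Lemma window_step Kx N1 n x0 v : (N0 < N1)%N ->
    (forall k, (N1 <= k)%N -> rho / 2 <= slope k <= 2 * rho) ->
    (4 * N1 <= n)%N -> cmod (x0 - zeta) = rho0 ->
    0 < v -> 80 * v <= 1 -> 160 * (80 * rho) <= Kx -> 2 * (Kx * v) <= rho0 ->
    2 <= v ^+ 2 * n%:R ->
    5 * K0 * n%:R <= expR (v ^+ 2 * n%:R / 2) ->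
  window Kx n x0 v -> window Kx n x0 (19 / 20 * v).
Proof.
move=> N01 hs N1n x0r v0 v80 hKx vr Y2 hY win n1 x.
have r8 := rho0_le; have rp := rho_gt0; have r0p := rho0_gt0; have K1 := K0_ge1.
have hs2 : 160 * (80 * (rho * v)) <= Kx * v.
  have : 160 * (80 * rho) * v <= Kx * v by rewrite ler_pM2r.
  by apply: le_trans; apply: eq_ler; ring.
have -> : Kx * (19 / 20 * v) = 19 / 20 * (Kx * v) by ring.
have -> : 40 * (19 / 20 * v) * n%:R = 38 * (v * n%:R) by field.
move: win; rewrite /window; move: (Kx * v) vr hs2 => s vr hs2 win hn hx.
have rvp : 0 < rho * v by pos.
have s0 : 0 < s by restrict_to rvp hs2; lra.
have [nr nrE] : exists nr : R, nr = n%:R by exists n%:R.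
have [n1r n1rE] : exists nr : R, nr = n1%:R by exists n1%:R.
rewrite -nrE in Y2 hY hn win *; rewrite -n1rE in hn.
have [Y YE] : exists Y, Y = v * (v * nr) by exists (v * (v * nr)).
have YE' : v ^+ 2 * nr = Y by rewrite YE expr2 mulrA.
rewrite YE' in Y2 hY win.
have nr1 : 4 * N1%:R <= nr by rewrite nrE -natrM ler_nat.
have N1r : 1 <= N1%:R :> R by rewrite ler1n; nlia.
have nr4 : 4 <= nr by restrict_to nr1 N1r; lra.
have nr0 : 0 < nr by restrict_to nr4; lra.
have vn0 : 0 < v * nr by pos.
have vn : 80 * (v * nr) <= nr.
  by rewrite mulrA -[leRHS]mul1r ler_pM2r.
move: hn; rewrite ler_norml => /andP[hn1 hn2].
have n1lo : nr / 2 <= n1r by restrict_to hn1 vn nr0; lra.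
have n1hi : n1r <= 3 / 2 * nr by restrict_to hn2 vn nr0; lra.
have n1r0 : 0 < n1r by restrict_to n1lo nr0; lra.
have n1N : (2 * N1 <= n1)%N by rewrite -(ler_nat R) natrM -n1rE; restrict_to nr1 n1lo; lra.
have vn1 : 0 <= v * n1r by pos.
(* With [J] about [v n1], the indices [n1 - J] and [n1 + J] remain within [40 v n] of [n], and the
   gain [exp(- 2 v J)] cancels [exp(Y)]. *)
have [J [J1 J2]] : exists J : nat, J%:R <= v * n1r /\ v * n1r < J%:R + 1.
  exists (Num.truncn (v * n1r)); have /andP[h1 h2] := truncn_itv vn1.
  by rewrite natr1.
have J0 : 0 <= J%:R :> R by rewrite ler0n.
have Jn : v * n1r <= 3 / 2 * (v * nr).
  have : v * n1r <= v * (3 / 2 * nr) by rewrite ler_pM2l.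
  by move/le_trans; apply; apply: eq_ler; ring.
have J80 : 80 * J%:R <= n1r.
  have : 80 * (v * n1r) <= 1 * n1r by rewrite mulrA ler_pM2r.
  by restrict_to J1; lra.
have J80n : (80 * J <= n1)%N by rewrite -(ler_nat R) natrM -n1rE.
have n10 : (0 < n1)%N by nlia.
have n1J : (N0 <= n1 - J)%N by nlia.
have n1N0 : (N0 <= n1)%N by nlia.
have an1 := a_gt0 n1N0.
have ann y : cmod (y - x0) <= s -> annulus y.
  move=> yx; have h1 := cmod_tri y x0 zeta; have h2 := cmod_tri x0 y zeta.
  rewrite (cmodBC x0 y) in h2; rewrite /annulus.
  by apply/andP; split; restrict_to h1 h2 yx x0r vr; lra.
have big y : cmod (y - x0) <= s -> rho / 2 <= cmod y /\ cmod y <= 2 * rho.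
  move=> /ann /andP[_ h]; have h1 := cmod_dist y zeta; have h2 := cmod_dist zeta y.
  rewrite (cmodBC zeta y) in h2; rewrite rhoE in h1 h2.
  by split; restrict_to h1 h2 h r8 rp; lra.
have near y : cmod (y - x0) <= s ->
    cmod y <= slope n1 * expR (- (4 * v)) \/ slope n1 <= cmod y * expR (- (4 * v)) ->
    bounded_by n1 y (5 * K0 * nr).
  move=> yx side; have hb : 0 < 4 * v by pos.
  have J4 : 4 * J%:R <= 4 * v * n1%:R.
    by rewrite -n1rE -mulrA ler_pM2l.
  have Y0 : 0 <= expR Y by exact: expR_ge0.
  have w1 : bounded_by (n1 - J) y (expR Y).
    apply: win => //; rewrite natrB; last by nlia.
    rewrite -n1rE -?nrE -?mulrA ler_norml.
    by apply/andP; split; restrict_to hn1 hn2 J0 J1 Jn vn0; lra.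
  have w2 : bounded_by (n1 + J) y (expR Y).
    apply: win => //; rewrite natrD.
    rewrite -n1rE -?nrE -?mulrA ler_norml.
    by apply/andP; split; restrict_to hn1 hn2 J0 J1 Jn vn0; lra.
  have J2n : (2 * J <= n1)%N by nlia.
  have := side_bound n10 J2n n1J hb J4 (ann y yx) Y0 side w1 w2.
  apply: bounded_by_le => //; rewrite [leRHS]mulrAC [leRHS]mulrC; apply: ler_wpM2l.
    exact: le_trans ler01 K0_ge1.
  have e1 : expR (- (4 * v * J%:R / 2)) * expR Y <= 1.
    rewrite -expRD -[leRHS]expR0 ler_expR.
    have h1 : v * (v * n1r) <= v * (J%:R + 1) by rewrite ler_pM2l//; exact: ltW.
    have h2 : v * (v * (21 / 40 * nr)) <= v * (v * n1r).
      by rewrite !ler_pM2l//; restrict_to hn1 vn nr0; lra.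
    by restrict_to h1 h2 YE Y2 v80; lra.
  have e2 : 2 / (4 * v) <= nr.
    rewrite ler_pdivrMr//.
    have h1 : v * (v * nr) <= 1 / 80 * (v * nr) by rewrite ler_pM2r//; restrict_to v80; lra.
    by restrict_to h1 YE Y2 nr0 vn0; lra.
  by restrict_to e1 e2 nr4; lra.
have hx1 : cmod (x - x0) <= s by restrict_to hx s0; lra.
have Y95 : (19 / 20 * v) ^+ 2 * nr = 361 / 400 * Y by rewrite YE expr2; field.
rewrite Y95; have half : expR (Y / 2) <= expR (361 / 400 * Y).
  by rewrite ler_expR; restrict_to Y2; lra.
have [sx|nsx] := pselect (cmod x <= slope n1 * expR (- (4 * v)) \/
                          slope n1 <= cmod x * expR (- (4 * v))).
  by apply: bounded_by_le (near x hx1 sx) => //; apply: le_trans hY half.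
have xb := big x hx1; have [x_lo x_hi] := xb.
have /andP[t_lo t_hi] := hs n1 ltac:(nlia).
have e14 : 1 - 4 * v <= expR (- (4 * v)) by exact: expR_ge1Dx.
have t0 := slope_gt0 n1N0.
have band y : rho / 2 <= cmod y /\ cmod y <= 2 * rho ->
    ~ (cmod y <= slope n1 * expR (- (4 * v)) \/ slope n1 <= cmod y * expR (- (4 * v))) ->
    `|cmod y - slope n1| <= 8 * (rho * v).
  move=> [y_lo y_hi] /not_orP[/negP + /negP].
  rewrite -!ltNge => h1 h2.
  have h3 : slope n1 * (1 - 4 * v) <= cmod y.
    by apply: le_trans (ltW h1); apply: ler_wpM2l => //; exact: ltW.
  have h4 : cmod y * (1 - 4 * v) <= slope n1.
    by apply: le_trans (ltW h2); apply: ler_wpM2l.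
  have h5 : slope n1 * v <= 2 * rho * v by rewrite ler_pM2r.
  have h6 : cmod y * v <= 2 * rho * v by rewrite ler_pM2r.
  move: (slope n1) (cmod y) h3 h4 h5 h6; restrict_to rvp v80 y_lo; move=> t Z h3 h4 h5 h6.
  by rewrite ler_norml; apply/andP; split; lra.
(* The radius is the margin [s / 20] by which the new window is smaller than the old one. *)
have [r [r0 rE]] : exists r : R, 0 < r /\ r = s / 20.
  by exists (s / 20); split => //; pos.
have x_p : 0 < cmod x by restrict_to x_lo rp; lra.
have x_0 : x != 0 by rewrite -cmod_gt0.
have Y0 : 0 <= Y by restrict_to Y2; lra.
(* A power [N] close to [Y] balances the two arcs. Off the band [(5/4)^N <= exp(Y / 4)] is
   affordable next to [exp(Y / 2)]; on it [(4/5)^N <= exp(- (Y - 1) / 5)] is the gain, and [Y >= 2]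
   absorbs the rounding. *)
have [N [N_1 N_2]] : exists N : nat, N%:R <= Y /\ Y - 1 <= N%:R.
  exists (Num.truncn Y); have /andP[h1 h2] := truncn_itv Y0; split=> //.
  by rewrite lerBlDr natr1; exact: ltW.
pose G y := F n1 y * (y^-1) ^+ n1 * (radial x r).[y] ^+ N.
have GB y V : 0 < cmod y -> 0 <= V -> bounded_by n1 y V ->
    cmod (G y) <= V * cmod (radial x r).[y] ^+ N * a n1.
  move=> y0 V0 h; rewrite /G !cmodM !cmodX cmodV.
  have -> : V * cmod (radial x r).[y] ^+ N * a n1 = V * a n1 * cmod (radial x r).[y] ^+ N by ring.
  apply: ler_wpM2r; first by pos.
  by rewrite exprVn ler_pdivrMr ?exprn_gt0// -mulrA.
have r10 : 10 * r <= cmod x by rewrite rE; restrict_to x_lo vr r8 s0; lra.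
have circle y : cmod (y - x) = r -> cmod (G y) <= expR (361 / 400 * Y) * a n1.
  move=> yr; have yx0 : cmod (y - x0) <= s.
    by have h1 := cmod_tri y x x0; rewrite yr rE in h1; restrict_to h1 hx; lra.
  have yb := big y yx0; have [y_lo y_hi] := yb.
  have y0 : 0 < cmod y by restrict_to y_lo rp; lra.
  have M54 := radial_le x_0 r0 yr.
  have [sy|nsy] := pselect (cmod y <= slope n1 * expR (- (4 * v)) \/
                            slope n1 <= cmod y * expR (- (4 * v))).
    have K5 : 0 <= 5 * K0 * nr.
      by apply: mulr_ge0; [apply: mulr_ge0; restrict_to K1; lra|exact: ltW].
    apply: le_trans (GB y _ y0 K5 (near y yx0 sy)) _; apply: ler_wpM2r; first exact: ltW.
    apply: (@le_trans _ _ (expR (Y / 2) * expR (1 / 4 * Y))).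
      apply: ler_pM => //; first exact: exprn_ge0.
      apply: (@le_trans _ _ ((5 / 4) ^+ N)).
        by apply: lerXn2r; rewrite ?nnegrE//; restrict_to rhoE; lra.
      apply: expR_pow_le N_1; [by restrict_to rhoE; lra| |by restrict_to rhoE; lra].
      by apply: le_trans (expR_ge1Dx _); restrict_to rhoE; lra.
    by rewrite -expRD ler_expR; restrict_to Y0; lra.
  have hy := band y yb nsy; have hx2 := band x xb nsx.
  have yxr : `|cmod y - cmod x| <= r / 40.
    move: hy hx2; rewrite rE !ler_norml => /andP[a1 a2] /andP[a3 a4].
    move: (slope n1) (cmod x) (cmod y) a1 a2 a3 a4; restrict_to hs2; move=> t X Z a1 a2 a3 a4.
    by apply/andP; split; lra.
  have M45 := radial_tangential x_0 r0 yr r10 yxr.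
  have wy : bounded_by n1 y (expR Y).
    apply: win => //; rewrite -n1rE -?nrE -?mulrA ler_norml.
    by apply/andP; split; restrict_to hn1 hn2 vn0; lra.
  apply: le_trans (GB y _ y0 (expR_ge0 _) wy) _; apply: ler_wpM2r; first exact: ltW.
  apply: (@le_trans _ _ (expR Y * expR (- (1 / 5 * (Y - 1))))).
    apply: ler_wpM2l; first exact: expR_ge0.
    apply: (@le_trans _ _ ((4 / 5) ^+ N)).
      by apply: lerXn2r; rewrite ?nnegrE//; restrict_to rhoE; lra.
    apply: expR_pow_le_neg N_2; [by restrict_to rhoE; lra| |by restrict_to rhoE; lra].
    by apply: le_trans (expR_ge1Dx _); restrict_to rhoE; lra.
  by rewrite -expRD ler_expR; restrict_to Y2; lra.
have Glim : poly_limit zeta (2 * rho0) G.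
  apply: poly_limitM; last by apply: poly_limitX; exact: poly_poly_limit.
  apply: poly_limitM; first exact: F_lim.
  apply: poly_limitX; apply: (@pseries_poly_limit _ _ _ _ rho).
  - by restrict_to r0p; lra.
  - by restrict_to r0p r8; lra.
  - by rewrite -rhoE; apply: has_pseries_inv; rewrite -cmod_gt0 rhoE.
have xz : cmod (x - zeta) + r <= 2 * rho0.
  by have h1 := cmod_tri x x0 zeta; rewrite x0r in h1; rewrite rE; restrict_to h1 hx vr s0; lra.
have := poly_limit_mean (ltW r0) xz Glim circle.
rewrite /G radial_center expr1n mulr1 cmodM cmodX cmodV exprVn.
by move=> h; rewrite /bounded_by [leRHS]mulrA -ler_pdivrMr ?exprn_gt0.
Qed.

(** The step is repeated until one of its last two hypotheses fails. Then [exp(Y / 2)] is at most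
    [5 K0 n], directly or because [Y < 2], and the bound [exp(Y)] at the centre is its square. *)
Lemma window_bound Kx N1 n x0 v : (N0 < N1)%N ->
    (forall k, (N1 <= k)%N -> rho / 2 <= slope k <= 2 * rho) ->
    (4 * N1 <= n)%N -> cmod (x0 - zeta) = rho0 ->
    0 < v -> 80 * v <= 1 -> 160 * (80 * rho) <= Kx -> 2 * (Kx * v) <= rho0 ->
    window Kx n x0 v ->
  bounded_by n x0 (25 * K0 ^+ 2 * n%:R ^+ 2).
Proof.
move=> N01 hs N1n x0r v0 v80 hKx vr win; have K1 := K0_ge1.
have r8 := rho0_le; have rp := rho_gt0; have r0p := rho0_gt0.
have n1 : 1 <= n%:R :> R by rewrite ler1n; nlia.
have n0 : (N0 <= n)%N by nlia.
pose u i := (19 / 20) ^+ i * v; pose Y i := u i ^+ 2 * n%:R.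
pose good i := (2 <= Y i) && (5 * K0 * n%:R <= expR (Y i / 2)).
have ui i : 0 < u i /\ u i <= v.
  rewrite /u; split; first by pos.
  by rewrite ler_piMl//; [exact: ltW|apply: exprn_ile1; lra].
have ex : exists i, ~~ good i.
  have [N hN] := @geo_small R (v ^+ 2 * n%:R) ((19 / 20) ^+ 2) 2 ltac:(pos)
    ltac:(rewrite expr2; lra) ltac:(lra).
  exists N; rewrite /good negb_and -ltNge; apply/orP; left.
  have -> : Y N = v ^+ 2 * n%:R * (19 / 20) ^+ 2 ^+ N.
    rewrite /Y /u exprMn [(19 / 20) ^+ 2 ^+ N]exprAC.
    by move: ((19 / 20) ^+ N) => X; ring.
  exact: hN.
have [i ngood imin] := ex_minnP ex.
have S j : (j <= i)%N -> window Kx n x0 (u j).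
  elim: j => [|j ih] ji; first by rewrite /u expr0 mul1r.
  have /andP[g1 g2] : good j by apply: contraTT ji => /imin; rewrite -ltnNge.
  have [u0 uv] := ui j; rewrite /u exprS -mulrA -/(u j).
  apply: (window_step N01 hs N1n x0r u0 _ hKx _ g1 g2); last by apply: ih; exact: ltnW.
    by restrict_to v80 uv; lra.
  have Kx0 : 0 < Kx by restrict_to hKx rp; lra.
  by apply: le_trans vr; rewrite !ler_pM2l.
have [u0 _] := ui i.
have := S i (leqnn _) n x0; rewrite !subrr normr0 cmod0.
have K5 : 5 <= 5 * K0 * n%:R by rewrite -mulrA -[leLHS]mulr1 ler_pM2l// mulr_ege1.
have Kx0 : 0 < Kx by restrict_to hKx rp; lra.
move=> /(_ ltac:(pos) ltac:(pos)); rewrite -/(Y i).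
apply: bounded_by_le => //.
have -> : 25 * K0 ^+ 2 * n%:R ^+ 2 = (5 * K0 * n%:R) ^+ 2 by rewrite !exprMn; ring.
have EE : expR (Y i) = expR (Y i / 2) ^+ 2 by rewrite expr2 -expRD; congr expR; field.
move: ngood; rewrite /good negb_and -!ltNge => /orP[Y2|hY].
  have e1 : expR (Y i / 2) <= 5.
    have : expR (Y i / 2) <= expR 1 by rewrite ler_expR; lra.
    have : expR (1 / 2) * (1 - 1 / 2) <= 1 :> R.
      have E : expR (1 / 2) * expR (- (1 / 2)) = 1 :> R by rewrite -expRD subrr expR0.
      by rewrite -[leRHS]E; apply: ler_wpM2l; [exact: expR_ge0|exact: expR_ge1Dx].
    have -> : expR 1 = expR (1 / 2) ^+ 2 :> R by rewrite expr2 -expRD; congr expR; field.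
    have := expR_ge0 (1 / 2 : R); move: (expR (1 / 2)) => e; rewrite expr2; nra.
  rewrite EE; apply: lerXn2r; rewrite ?nnegrE ?expR_ge0//; lra.
by rewrite EE; apply: lerXn2r; rewrite ?nnegrE ?expR_ge0//; [lra|exact: ltW].
Qed.

Lemma circle_bound : exists N, forall n x, (N <= n)%N -> cmod (x - zeta) = rho0 ->
  bounded_by n x (25 * K0 ^+ 2 * n%:R ^+ 2).
Proof.
have [N1 N01 hs] := slope_range.
have r8 := rho0_le; have rp := rho_gt0; have r0p := rho0_gt0.
have [Kx KxE] : exists Kx : R, Kx = 160 * (80 * rho) by exists (160 * (80 * rho)).
have hKx : 160 * (80 * rho) <= Kx by rewrite KxE.
have Kx0 : 0 < Kx by rewrite KxE; pos.
clear KxE; pose v := Num.min (1 / 80) (rho0 / (2 * Kx)).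
have v0 : 0 < v by rewrite /v lt_min; apply/andP; split; [lra|pos].
have v80 : 80 * v <= 1.
  have : v <= 1 / 80 by rewrite /v ge_min lexx.
  by restrict_to rhoE; lra.
have vr : 2 * (Kx * v) <= rho0.
  rewrite mulrA mulrC -ler_pdivlMr; last by pos.
  by rewrite /v ge_min lexx orbT.
(* Half of [v^2] suffices as a rate because the indices [n1] of the window are at most [2 n]. *)
clearbody v; have [|K hK] := F_apriori (e := v ^+ 2 / 2); first by pos.
exists (maxn (4 * N1) (2 * K)) => n x; rewrite geq_max => /andP[N1n Kn] xr.
apply: (window_bound N01 hs N1n xr v0 v80 hKx vr) => n1 y.
rewrite ler_norml => /andP[h1 h2] hy.
have np : 0 < n%:R :> R by rewrite ltr0n; nlia.
have h3 : 40 * v * n%:R <= 1 / 2 * n%:R by rewrite ler_pM2r//; lra.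
have n1lo : (n <= 2 * n1)%N by rewrite -(ler_nat R) natrM; lra.
have n1hi : (n1 <= 2 * n)%N by rewrite -(ler_nat R) natrM; lra.
have ann : annulus y.
  have t1 := cmod_tri y x zeta; have t2 := cmod_tri x y zeta.
  by rewrite (cmodBC x y) in t2; rewrite /annulus; apply/andP; split; lra.
apply: bounded_by_le (hK n1 y _ ann); [nlia| |nlia].
rewrite ler_expR -mulrA; apply: ler_wpM2l; first by pos.
by rewrite mulrC ler_pdivrMr// -natrM ler_nat mulnC.
Qed.

(* On [|x - zeta| = rho0] this polynomial has modulus [rho0 * ||x|^2 - t^2|]. *)
Definition tangency t : {poly C} :=
  (zeta^*)%:P * 'X * ('X - zeta%:P) + (rho0 ^+ 2)%:C *: 'X
  - (t ^+ 2)%:C *: ('X - zeta%:P).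

Lemma tangency_horner t x : (tangency t).[x] =
  zeta^* * x * (x - zeta) + (rho0 ^+ 2)%:C * x - (t ^+ 2)%:C * (x - zeta).
Proof. by rewrite /tangency !hornerE. Qed.

Lemma tangency_center t : cmod (tangency t).[zeta] = rho0 ^+ 2 * rho.
Proof.
rewrite tangency_horner subrr !mulr0 add0r subr0 cmodM rhoE cmod_real//.
exact: exprn_ge0 (ltW rho0_gt0).
Qed.

(** On this circle [rho0^2] is the product of [x - zeta] and its conjugate, so the factor [x - zeta]
    comes out and [|x|^2 - t^2] remains. At the centre the value has modulus [rho0^2 * rho],
    independent of [t]. *)
Lemma tangency_circle t x : cmod (x - zeta) = rho0 ->
  cmod (tangency t).[x] = rho0 * `|cmod x ^+ 2 - t ^+ 2|.
Proof.
move=> xr; have E : (tangency t).[x] = (x - zeta) * (cmod x ^+ 2 - t ^+ 2)%:C.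
  have h1 : (rho0 ^+ 2)%:C = (x - zeta) * (x^* - zeta^*).
    by rewrite -xr sqr_cmod_conj; congr (_ * _); rewrite rmorphB.
  have h2 := sqr_cmod_conj x.
  have -> : (cmod x ^+ 2 - t ^+ 2)%:C = (cmod x ^+ 2)%:C - (t ^+ 2)%:C :> C.
    by rewrite rmorphB.
  rewrite tangency_horner h1 h2; ring.
rewrite E cmodM xr; congr (_ * _).
by rewrite /cmod /= expr0n addr0 sqrtr_sqr.
Qed.

Lemma sqr_expR_le (s : R) : 0 <= s -> s ^+ 2 * expR (- s) <= 4.
Proof.
move=> s0; have E : expR (s / 2) ^+ 2 * expR (- s) = 1.
  by rewrite expr2 -!expRD -[RHS]expR0; congr expR; field.
have h : s / 2 <= expR (s / 2) by apply: le_trans (expR_ge1Dx _); lra.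
have h2 : (s / 2) ^+ 2 <= expR (s / 2) ^+ 2.
  by apply: lerXn2r; rewrite ?nnegrE ?expR_ge0//; lra.
have := ler_wpM2r (expR_ge0 (- s)) h2; rewrite E expr_div_n.
have -> : s ^+ 2 / 2 ^+ 2 * expR (- s) = (s ^+ 2 * expR (- s)) / 4 by field.
by rewrite ler_pdivrMr// mul1r.
Qed.

(** With [s = b^2 n / 8] the exponential is at most [2 exp(- s)] and [b^4 n^2 = 64 s^2]; the
    constant 512 is [64 * 2 * 4], by [sqr_expR_le]. *)
Lemma weighted_bound b n J : 0 < b -> b <= 1 / 2 -> (0 < n)%N ->
    b * n%:R / 4 < J%:R + 1 ->
  b ^+ 4 * (K0 * (1 + 2 / b + expR (- (b * J%:R / 2)) * (100 * K0 ^+ 2 * n%:R ^+ 2))) <=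
  K0 * (2 + 100 * K0 ^+ 2 * 512).
Proof.
move=> b0 b2 n0 hJ; have K1 := K0_ge1; have Kp : 0 <= K0 by exact: le_trans ler01 K1.
have -> : b ^+ 4 * (K0 * (1 + 2 / b + expR (- (b * J%:R / 2)) * (100 * K0 ^+ 2 * n%:R ^+ 2))) =
  K0 * (b ^+ 4 + 2 * b ^+ 3 + 100 * K0 ^+ 2 * (b ^+ 4 * n%:R ^+ 2 * expR (- (b * J%:R / 2)))).
  by field; rewrite gt_eqF.
apply: ler_wpM2l => //; apply: lerD.
  have h3 : b ^+ 3 <= (1 / 2) ^+ 3 by apply: lerXn2r; rewrite ?nnegrE; lra.
  have h4 : b ^+ 4 <= (1 / 2) ^+ 4 by apply: lerXn2r; rewrite ?nnegrE; lra.
  have e3 : (1 / 2 : R) ^+ 3 = 1 / 8 by field.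
  have e4 : (1 / 2 : R) ^+ 4 = 1 / 16 by field.
  rewrite e3 in h3; rewrite e4 in h4; restrict_to h3 h4; lra.
apply: ler_wpM2l; first by apply: mulr_ge0 => //; exact: exprn_ge0.
pose s := b ^+ 2 * n%:R / 8; have s0 : 0 <= s by rewrite /s; pos.
have sE : b ^+ 4 * n%:R ^+ 2 = 64 * s ^+ 2 by rewrite /s; field.
have e1 : expR (- (b * J%:R / 2)) <= 2 * expR (- s).
  have h : expR (- (b * J%:R / 2)) <= expR (b / 2) * expR (- s).
    rewrite -expRD ler_expR; have := ler_wpM2l (ltW b0) (ltW hJ).
    have -> : b * (b * n%:R / 4) = 2 * s by rewrite /s expr2; field.
    by move: (J%:R : R) => j; lra.
  apply: le_trans h _; apply: ler_wpM2r; first exact: expR_ge0.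
  have E : expR (b / 2) * expR (- (b / 2)) = 1 by rewrite -expRD subrr expR0.
  have h1 : 1 - b / 2 <= expR (- (b / 2)) by exact: expR_ge1Dx.
  have h2 : expR (b / 2) * (1 - b / 2) <= 1.
    by rewrite -[leRHS]E; apply: ler_wpM2l => //; exact: expR_ge0.
  have h3 : expR (b / 2) * (1 / 2) <= expR (b / 2) * (1 - b / 2).
    by apply: ler_wpM2l; [exact: expR_ge0|lra].
  lra.
rewrite sE; apply: (@le_trans _ _ (64 * s ^+ 2 * (2 * expR (- s)))).
  by apply: ler_wpM2l => //; apply: mulr_ge0 => //; exact: exprn_ge0.
have := sqr_expR_le s0; move: (s ^+ 2) (expR (- s)) => u w; lra.
Qed.

(** The mean over [|x - zeta| = rho0] is taken with the fourth power of [tangency], of order [b^4]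
    at relative distance [b] from the critical circle. This compensates both the loss [1 / b] of
    [side_bound] and the factor [n^2] of [circle_bound]. *)
Lemma center_bound : exists2 B, 0 <= B & exists N, forall n, (N <= n)%N ->
  bounded_by n zeta B.
Proof.
have [Nc hc] := circle_bound.
have [N1 N01 hs] : exists2 N, (N0 < N)%N & forall n, (N <= n)%N ->
  rho / 2 <= slope n <= 2 * rho by exact: slope_range.
have r8 := rho0_le; have rp := rho_gt0; have r0p := rho0_gt0; have K1 := K0_ge1.
have Kp : 0 <= K0 by exact: le_trans ler01 K1.
pose B0 := (rho0 * (8 * rho ^+ 2)) ^+ 4 * (K0 * (2 + 100 * K0 ^+ 2 * 512)).
have B00 : 0 <= B0.
  rewrite /B0; apply: mulr_ge0; first by pos.
  exact: mulr_ge0 Kp (quadratic_ge0 K0).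
exists (B0 / (rho0 ^+ 2 * rho) ^+ 4); first by apply: mulr_ge0 => //; pos.
exists (maxn (2 * N1) (2 * Nc)) => n; rewrite geq_max => /andP[N1n Ncn].
have n0 : (N0 <= n)%N by nlia.
have n_0 : (0 < n)%N by nlia.
have np : 0 < n%:R :> R by rewrite ltr0n.
have an := a_gt0 n0; have t0 := slope_gt0 n0.
have /andP[t_lo t_hi] := hs n ltac:(nlia).
pose G y := F n y * (y^-1) ^+ n * (tangency (slope n)).[y] ^+ 4.
have GE x : cmod (G x) =
    cmod (F n x) * (cmod x)^-1 ^+ n * cmod (tangency (slope n)).[x] ^+ 4.
  by rewrite /G cmodM cmodM [cmod (_ ^+ n)]cmodX cmodV [cmod (_ ^+ 4)]cmodX.
have circle x : cmod (x - zeta) = rho0 -> cmod (G x) <= B0 * a n.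
  move=> xr; have h1 := cmod_dist x zeta; have h2 := cmod_dist zeta x.
  rewrite (cmodBC zeta x) in h2; rewrite rhoE xr in h1 h2.
  have x_lo : rho / 2 <= cmod x by restrict_to h2 r8 rp r0p; lra.
  have x_hi : cmod x <= 2 * rho by restrict_to h1 r8 rp r0p; lra.
  have x_p : 0 < cmod x by restrict_to x_lo rp; lra.
  have xA : annulus x by rewrite /annulus xr; apply/andP; split; restrict_to r0p; lra.
  rewrite GE tangency_circle//.
  set u := `|cmod x ^+ 2 - slope n ^+ 2|.
  have u0 : 0 <= u by exact: normr_ge0.
  (* On the critical circle itself the multiplier vanishes, so no bound for [F n] is needed
     there. *)
  have [u_0|up] := leP u 0.
    have uz : u = 0 by apply/eqP; rewrite eq_le u_0.
    have -> : (rho0 * u) ^+ 4 = 0 by rewrite uz mulr0 exprS mul0r.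
    by rewrite mulr0; apply: mulr_ge0 => //; exact: ltW.
  (* The denominator makes [b] at most the relative distance of [|x|] from the slope, both being at
     most [2 rho], and at most [1/2]. *)
  pose b := u / (8 * rho ^+ 2).
  have b0 : 0 < b by rewrite /b; pos.
  have ub : u = 8 * rho ^+ 2 * b by rewrite /b mulrC divfK// gt_eqF//; pos.
  have uf : (cmod x - slope n) * (cmod x + slope n) = cmod x ^+ 2 - slope n ^+ 2 by ring.
  have uE : u = `|cmod x - slope n| * (cmod x + slope n).
    by rewrite /u -uf normrM (gtr0_norm (addr_gt0 x_p t0)).
  have b2 : b <= 1 / 2.
    have X2 : cmod x ^+ 2 <= (2 * rho) ^+ 2 by apply: lerXn2r; rewrite ?nnegrE//; pos.
    have T2 : slope n ^+ 2 <= (2 * rho) ^+ 2 by apply: lerXn2r; rewrite ?nnegrE//; [exact: ltW|pos].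
    have : u <= (2 * rho) ^+ 2.
      rewrite /u ler_norml; apply/andP; split.
        by rewrite lerNl opprB; apply: le_trans T2; rewrite gerBl; pos.
      by apply: le_trans X2; rewrite gerBl; apply: exprn_ge0; exact: ltW.
    have rr : 0 < rho ^+ 2 by pos.
    rewrite /b ler_pdivrMr; last by pos.
    by rewrite exprMn expr2; move: (rho ^+ 2) => r2; restrict_to r8; lra.
  have side : cmod x <= slope n * expR (- b) \/ slope n <= cmod x * expR (- b).
    have eb : 1 - b <= expR (- b) by exact: expR_ge1Dx.
    have key X T : 0 < X -> 0 < T -> X <= 2 * rho -> T <= 2 * rho -> X <= T ->
        u = (T - X) * (X + T) -> X <= T * expR (- b).
      move=> X0 T0 Xr Tr XT uXT; apply: (@le_trans _ _ (T * (1 - b))); last first.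
        by apply: ler_wpM2l => //; exact: ltW.
      suff : T * b <= T - X by restrict_to rp; lra.
      rewrite /b mulrA ler_pdivrMr; last by pos.
      rewrite uXT.
      have -> : T * ((T - X) * (X + T)) = (T - X) * (T * (X + T)) by ring.
      apply: ler_wpM2l; first by rewrite subr_ge0.
      apply: (@le_trans _ _ (2 * rho * (4 * rho))).
        by apply: ler_pM; [exact: ltW|pos|done|restrict_to Xr Tr; lra].
      by apply: eq_ler; rewrite expr2; ring.
    have [xt|/ltW tx] := leP (cmod x) (slope n).
      by left; apply: key => //; rewrite uE ler0_norm ?subr_le0// opprB.
    by right; apply: key => //; rewrite uE ger0_norm ?subr_ge0//; congr (_ * _); exact: addrC.
  have bn0 : 0 <= b * n%:R / 4 by pos.
  have [J [J1 J2]] : exists J : nat, J%:R <= b * n%:R / 4 /\ b * n%:R / 4 < J%:R + 1.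
    exists (Num.truncn (b * n%:R / 4)); have /andP[g1 g2] := truncn_itv bn0.
    by rewrite natr1.
  have J4 : 4 * J%:R <= b * n%:R by restrict_to J1; lra.
  have J8 : (8 * J <= n)%N.
    rewrite -(ler_nat R) natrM; have : b * n%:R <= 1 / 2 * n%:R by rewrite ler_pM2r.
    by restrict_to J4; lra.
  have V0 : 0 <= 100 * K0 ^+ 2 * n%:R ^+ 2 by pos.
  have hk k : (Nc <= k)%N -> (N0 <= k)%N -> (k <= 2 * n)%N -> bounded_by k x (100 * K0 ^+ 2 * n%:R ^+ 2).
    move=> Nk N0k kn; apply: bounded_by_le (hc k x Nk xr) => //.
    have : k%:R ^+ 2 <= (2 * n%:R) ^+ 2 :> R.
      by apply: lerXn2r; rewrite ?nnegrE -?natrM ?ler_nat ?ler0n.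
    rewrite exprMn => kk.
    apply: (@le_trans _ _ (25 * K0 ^+ 2 * (2 ^+ 2 * n%:R ^+ 2))); last first.
      by apply: eq_ler; ring.
    by apply: ler_wpM2l => //; pos.
  have := side_bound n_0 (_ : (2 * J <= n)%N) (_ : (N0 <= n - J)%N) b0 J4 xA V0 side.
  move=> /(_ ltac:(nlia) ltac:(nlia) (hk _ _ _ _) (hk _ _ _ _)) h.
  have {}h := h ltac:(nlia) ltac:(nlia) ltac:(nlia) ltac:(nlia) ltac:(nlia) ltac:(nlia).
  set V := K0 * _ in h.
  have hF : cmod (F n x) * (cmod x)^-1 ^+ n <= V * a n.
    by rewrite exprVn ler_pdivrMr ?exprn_gt0// -mulrA.
  have hb := weighted_bound b0 b2 n_0 J2; rewrite -/V in hb.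
  apply: le_trans (ler_wpM2r _ hF) _; first by pos.
  rewrite ub; have -> : V * a n * (rho0 * (8 * rho ^+ 2 * b)) ^+ 4 =
    (rho0 * (8 * rho ^+ 2)) ^+ 4 * (b ^+ 4 * V) * a n by ring.
  apply: ler_wpM2r; first exact: ltW.
  by rewrite /B0; apply: ler_wpM2l => //; pos.
have Glim : poly_limit zeta (2 * rho0) G.
  apply: poly_limitM; last by apply: poly_limitX; exact: poly_poly_limit.
  apply: poly_limitM; first exact: F_lim.
  apply: poly_limitX; apply: (@pseries_poly_limit _ _ _ _ rho).
  - by restrict_to r0p; lra.
  - by restrict_to r0p r8; lra.
  - by rewrite -rhoE; apply: has_pseries_inv; rewrite -cmod_gt0 rhoE.
have zz : cmod (zeta - zeta) + rho0 <= 2 * rho0 by rewrite subrr cmod0 add0r; lra.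
have := poly_limit_mean (ltW rho0_gt0) zz Glim circle.
rewrite GE tangency_center rhoE exprVn => h.
have T0 : 0 < (rho0 ^+ 2 * rho) ^+ 4 by pos.
rewrite /bounded_by rhoE mulrAC ler_pdivlMr//.
by move: h; rewrite mulrAC ler_pdivrMr ?exprn_gt0// -[leRHS]mulrA.
Qed.
End Bootstrap.

(** * Limit points of zeros on the boundary circle *)

Section BoundaryRoots.
Variables (R : realType) (phi : nat -> R[i]) (m : nat).
Variables (p q qs : nat -> {poly R[i]}) (A : nat -> R[i]) (lam : nat -> nat).
Variables (rho : R) (a : nat -> R) (N0 : nat).
Hypothesis row : pade_row phi m p q qs A lam rho a N0.
Local Notation C := R[i].
Implicit Types (x z zeta : C) (t e c : R) (n k : nat).

Variable qm : {poly C}.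
Hypothesis qm_size : size qm = m.+1.
Hypothesis qm_cvg : forall k e, 0 < e -> exists N, forall n, (N <= n)%N ->
  cmod ((q n)`_k - qm`_k) < e.

Lemma coef_uniform e : 0 < e -> exists2 N, (N0 <= N)%N & forall n i, (N <= n)%N ->
  cmod ((q n)`_i - qm`_i) < e.
Proof.
move=> e0; suff [N hN] : exists N, forall n i, (N <= n)%N -> (i < m.+1)%N ->
    cmod ((q n)`_i - qm`_i) < e.
  exists (maxn N0 N); first exact: leq_maxl.
  move=> n i; rewrite geq_max => /andP[n0 Nn]; have [im|mi] := ltnP i m.+1; first exact: hN.
  have [_ qs'] := row_q row n0.
  by rewrite !nth_default ?subrr ?cmod0// ?qm_size// (leq_trans qs').
elim: m.+1 => [|j [N hN]]; first by exists 0%N.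
have [N' hN'] := qm_cvg j e0; exists (maxn N N') => n i.
rewrite geq_max => /andP[Nn N'n]; rewrite ltnS leq_eqVlt => /orP[/eqP ->|ij]; first exact: hN'.
exact: hN.
Qed.

Lemma limit_denominator : denominator_of phi rho qm.
Proof.
apply: (cluster_denominator row); split=> [|e N e0]; first by rewrite qm_size.
have [N' _ h] := coef_uniform e0; exists (maxn N N'); first exact: leq_maxl.
by move=> i; apply: h; exact: leq_maxr.
Qed.

Lemma limit_neq0 : qm != 0.
Proof. by rewrite -size_poly_gt0 qm_size. Qed.

(** The leading coefficient of [qm] forces [q n] to have degree [m] eventually, which leaves no room
    for a common zero at 0. *)
Lemma lam_eventually0 : exists2 N, (N0 <= N)%N & forall n, (N <= n)%N -> lam n = 0%N.
Proof.
have lc : qm`_m != 0.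
  by have := limit_neq0; rewrite -lead_coef_eq0 /lead_coef qm_size.
have lc0 : 0 < cmod qm`_m by rewrite cmod_gt0.
have [N N0N h] := coef_uniform lc0; exists N => // n Nn.
have := h n m Nn; have [sm|ms] := leqP (size (q n)) m.
  by rewrite nth_default// sub0r cmodN ltxx.
by move=> _; have := row_lam row (leq_trans N0N Nn); move: (size _) (lam n) ms => s l; nlia.
Qed.

Lemma limit_uniform e (r : R) : 0 < e -> 0 <= r -> exists2 N, (N0 <= N)%N &
  forall n z, (N <= n)%N -> cmod z <= r -> cmod ((q n).[z] - qm.[z]) <= e.
Proof.
move=> e0 r0; pose B := m.+1%:R * (1 + r) ^+ m; have B0 : 0 < B by rewrite /B; pos.
have [|N N0N h] := coef_uniform (e := e / B); first by pos.
exists N => // n z Nn zr; have [_ qn] := row_q row (leq_trans N0N Nn).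
rewrite -hornerN -hornerD (@horner_coef_wide _ m.+1); last first.
  by rewrite (leq_trans (size_polyD _ _))// size_polyN geq_max qn qm_size/=.
apply: le_trans (cmod_sum _ _ _) _.
apply: (@le_trans _ _ (\sum_(i < m.+1) e / B * (1 + r) ^+ m)).
  apply: ler_sum => i _; rewrite cmodM cmodX coefB; apply: ler_pM => //.
  - exact: exprn_ge0.
  - exact: ltW (h n i Nn).
  - apply: (@le_trans _ _ ((1 + r) ^+ i)).
      by apply: lerXn2r; rewrite ?nnegrE//; lra.
    by apply: ler_weXn2l; [lra|rewrite -ltnS].
rewrite sumr_const card_ord -(mulr_natl _ m.+1) mulrCA.
by apply: eq_ler; rewrite -/B divfK// gt_eqF.
Qed.

Hypothesis a_conc : forall n, (N0 <= n)%N ->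
  n.+1%:R * (a n / a n.+1) <= n.+2%:R * (a n.+1 / a n.+2).

Variables (zeta : C) (g : C -> C) (t : R).
Hypothesis zetaE : cmod zeta = rho.
Hypothesis t_gt0 : 0 < t.
Hypothesis g_series : has_pseries g zeta t.
Hypothesis g_agrees : forall z, cmod (z - zeta) < t -> cmod z < rho ->
  qm.[z] * g z = psum (pmul qm phi) z.

Definition boundary_remainder n z : C := (q n).[z] * g z - (p n).[z].

Lemma punctured_lower_bound : exists rho0 c, [/\ 0 < rho0, 0 < c, 8 * rho0 <= rho,
  2 * rho0 < t & forall x, annulus zeta rho0 x -> c <= cmod qm.[x]].
Proof.
have [w1 w1z w1E] := mup_factor zeta limit_neq0.
move: w1E; move: (mup zeta qm) => nu w1E.
have W0 : 0 < cmod w1.[zeta] / 2 by apply: divr_gt0 => //; rewrite cmod_gt0.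
have [d d0 hd] := has_pseries_continuous ltr01 (has_pseries_poly w1 zeta 1) W0.
have rp := row_rho row.
pose rho0 := Num.min (rho / 8) (Num.min (t / 4) (d / 4)).
have r0 : 0 < rho0 by rewrite /rho0 !lt_min !divr_gt0.
have r1 : rho0 <= rho / 8 by rewrite /rho0 ge_min lexx.
have r2 : rho0 <= t / 4 by rewrite /rho0 !ge_min lexx orbT.
have r3 : rho0 <= d / 4 by rewrite /rho0 !ge_min lexx !orbT.
clearbody rho0; exists rho0, (cmod w1.[zeta] / 2 * (rho0 / 2) ^+ nu).
have tp := t_gt0; split => //; [by pos|by lra|by lra|].
move=> x /andP[x1 x2]; rewrite {1}w1E hornerM horner_exp hornerXsubC cmodM cmodX.
apply: ler_pM; [exact: ltW|by pos| |].
  have xd : cmod (x - zeta) < d by lra.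
  have := hd x xd; have := cmod_dist w1.[zeta] w1.[x]; rewrite cmodBC; lra.
by apply: lerXn2r; rewrite ?nnegrE//; pos.
Qed.

Lemma linear_le_exp (M e : R) : 0 <= M -> 0 < e -> exists N, forall n, (N <= n)%N ->
  M * (n%:R + 1) <= expR (e * n%:R).
Proof.
move=> M0 e0; exists (Num.truncn (8 * M / e ^+ 2)).+1 => n nn.
have e2 : 0 < e ^+ 2 by pos.
have h0 : 0 <= 8 * M / e ^+ 2 by pos.
have /andP[_ h1] := truncn_itv h0.
have n1 : 1 <= n%:R :> R by rewrite ler1n; nlia.
have h2 : 8 * M / e ^+ 2 <= n%:R.
  by apply: le_trans (ltW h1) _; rewrite ler_nat.
rewrite ler_pdivrMr// in h2.
have h3 : (e * n%:R / 2) ^+ 2 <= expR (e * n%:R).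
  have -> : expR (e * n%:R) = expR (e * n%:R / 2) ^+ 2.
    by rewrite expr2 -expRD; congr expR; field.
  apply: lerXn2r; rewrite ?nnegrE ?expR_ge0//; first by pos.
  by apply: le_trans (expR_ge1Dx _); lra.
apply: le_trans h3.
have -> : (e * n%:R / 2) ^+ 2 = n%:R * e ^+ 2 * n%:R / 4 by field.
have h4 : 8 * M * n%:R <= n%:R * e ^+ 2 * n%:R by apply: ler_wpM2r => //; lra.
have : M * 1 <= M * n%:R by apply: ler_wpM2l.
lra.
Qed.

(** Cauchy's estimates on one circle bound every coefficient of [p n]; summing them costs [n + 1],
    which is harmless for a subexponential bound. *)
Lemma p_global_bound (x y : R) : rho < x -> x < y -> exists2 M, 0 <= M &
  exists2 K, (N0 <= K)%N & forall n z, (K <= n)%N ->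
    cmod (p n).[z] <= M * (n%:R + 1) * (a n * Num.max y (cmod z) ^+ n).
Proof.
move=> rx xy; have [M M0 [K N0K hK]] := p_exterior_bound row rx xy.
exists M => //; exists K => // n z Kn; have n0 := leq_trans N0K Kn.
have [s /andP[xs sy] hs] := hK n Kn; have an := row_a row n0.
have rp := row_rho row; have s0 : 0 < s by lra.
set Y := Num.max y (cmod z).
have sY : s <= Y by rewrite /Y le_max sy.
have zY : cmod z <= Y by rewrite /Y le_max lexx orbT.
have Y0 : 0 < Y by exact: lt_le_trans sY.
clearbody Y; apply: le_trans (cmod_horner _ _) _.
apply: (@le_trans _ _ (\sum_(i < size (p n)) M * (a n * Y ^+ n))).
  apply: ler_sum => i _; have hc := cauchy_coef i (ltW s0) hs.
  have iN : (i <= n)%N by rewrite -ltnS (leq_trans (ltn_ord i))// (row_p row).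
  have hc' : cmod (p n)`_i <= M * a n * s ^+ (n - i).
    rewrite -(ler_pM2r (x := s ^+ i)) ?exprn_gt0// (le_trans hc)//.
    by rewrite -!mulrA -exprD subnK.
  apply: (@le_trans _ _ (M * a n * Y ^+ (n - i) * Y ^+ i)).
    apply: ler_pM => //; first by pos.
      apply: le_trans hc' _; apply: ler_wpM2l; first by pos.
      by apply: lerXn2r; rewrite ?nnegrE//; exact: ltW.
    by apply: lerXn2r; rewrite ?nnegrE//; exact: ltW.
  by rewrite -mulrA -exprD subnK// mulrA.
rewrite sumr_const card_ord -(mulr_natl _ (size (p n))).
rewrite [M * (n%:R + 1)]mulrC -[leRHS]mulrA; apply: ler_wpM2r; first by pos.
by rewrite natr1 ler_nat (row_p row).
Qed.

(** For [|x| <= rho (1 - d)] the bound follows from [remainder_bound], divided by [qm], which is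
    bounded below on the annulus. For larger [|x|] the two terms of the remainder are estimated
    separately, at the cost of the factor [exp(4 d n)]. *)
Lemma boundary_apriori rho0 c e : 0 < rho0 -> 0 < c -> 8 * rho0 <= rho -> 2 * rho0 < t ->
    (forall x, annulus zeta rho0 x -> c <= cmod qm.[x]) -> 0 < e ->
  exists K, forall n x, (K <= n)%N -> annulus zeta rho0 x ->
    cmod (boundary_remainder n x) <= expR (e * n%:R) * (a n * cmod x ^+ n).
Proof.
move=> r0 c0 r8 rt hc e0; have rp := row_rho row; have tp := t_gt0.
pose d := Num.min (1 / 4) (e / 16).
have d0 : 0 < d by rewrite /d lt_min; apply/andP; split; [lra|pos].
have d4 : d <= 1 / 4 by rewrite /d ge_min lexx.
have de : d <= e / 16 by rewrite /d ge_min lexx orbT.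
clearbody d.
have rd : 0 < rho * d by pos.
have rx : rho < rho * (1 + d) by rewrite mulrDr mulr1; lra.
have xy : rho * (1 + d) < rho * (1 + 2 * d) by rewrite ltr_pM2l//; lra.
have [M M0 [K1 N0K1 hp]] := p_global_bound rx xy.
set y := rho * (1 + 2 * d) in hp xy; have y0 : 0 < y by rewrite /y; pos.
have ry : rho < y by lra.
have yi : 0 < y^-1 < rho^-1 by rewrite invr_gt0 y0 ltf_pV2.
have [K2 N0K2 hK2] := ratio_ge row yi.
have [G G0 hG] := poly_limit_bounded (pseries_poly_limit (ltW (mulr_gt0 (ltr0n _ 2) r0)) rt g_series).
pose r := rho * (1 - d).
have r_0 : 0 < r by rewrite /r; apply: mulr_gt0 => //; lra.
have rr : r < rho by rewrite /r mulrBr mulr1; lra.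
have [D D0 [K3 N0K3 hK3]] := remainder_bound row limit_denominator r_0 rr.
have [K4 N0K4 hlam] := lam_eventually0.
pose B := (1 + 2 * rho) ^+ m; have B0 : 0 < B by rewrite /B; pos.
have aK2 := row_a row N0K2.
pose cK := a K2 * y ^+ K2; have cK0 : 0 < cK by rewrite /cK; pos.
pose T := B * G / cK + M + D * rho / c.
have T0 : 0 <= T by rewrite /T; apply: addr_ge0; [apply: addr_ge0 => //|]; pos.
have e20 : 0 < e / 2 by pos.
have [K5 hK5] := linear_le_exp T0 e20.
exists (maxn (maxn K1 K2) (maxn (maxn K3 K4) K5)) => n x.
rewrite !geq_max => /andP[/andP[K1n K2n] /andP[/andP[K3n K4n] K5n]] xA.
have n0 := leq_trans N0K1 K1n; have an := row_a row n0.
have /andP[xA1 xA2] := xA.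
have h1 := cmod_dist x zeta; have h2 := cmod_dist zeta x.
rewrite (cmodBC zeta x) in h2; rewrite zetaE in h1 h2.
have x_hi : cmod x <= 2 * rho by lra. have x_lo : rho / 2 <= cmod x by lra.
have x_p : 0 < cmod x by lra.
have axn : 0 < a n * cmod x ^+ n by pos.
have nn : 0 <= n%:R :> R by rewrite ler0n.
suff : cmod (boundary_remainder n x) <= T * (n%:R + 1) * (expR (e / 2 * n%:R) * (a n * cmod x ^+ n)).
  move=> h; apply: le_trans h _; rewrite mulrA; apply: ler_wpM2r; first exact: ltW.
  apply: (@le_trans _ _ (expR (e / 2 * n%:R) * expR (e / 2 * n%:R))).
    by apply: ler_wpM2r; [exact: expR_ge0|exact: hK5].
  by rewrite -expRD -mulrDl -splitr.
have e1 : 1 <= expR (e / 2 * n%:R) by apply: le_trans (expR_ge1Dx _); rewrite lerDl; pos.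
have [xr|rx'] := leP (cmod x) r.
  have xt : cmod (x - zeta) < t by lra.
  have := hK3 n x K3n xr; rewrite (hlam n K4n) subn0 -(g_agrees xt (le_lt_trans xr rr)).
  have -> : (q n).[x] * (qm.[x] * g x) - qm.[x] * (p n).[x] = qm.[x] * boundary_remainder n x.
    by rewrite /boundary_remainder; ring.
  rewrite cmodM => h; have hcx := hc x xA.
  have h3 : c * cmod (boundary_remainder n x) <= D * (a n * cmod x ^+ n * rho).
    apply: le_trans (ler_wpM2r (cmod_ge0 _) hcx) _; apply: le_trans h _.
    apply: ler_wpM2l => //; rewrite exprSr mulrA; apply: ler_wpM2l; first exact: ltW.
    exact: le_trans (ltW rr).
  rewrite mulrC -ler_pdivlMr// in h3; apply: le_trans h3 _.
  have -> : D * (a n * cmod x ^+ n * rho) / c = D * rho / c * (1 * (a n * cmod x ^+ n)) by ring.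
  apply: ler_pM; [by pos|by rewrite mul1r ltW| |by rewrite ler_pM2r].
  apply: (@le_trans _ _ (T * 1)); last by apply: ler_wpM2l => //; lra.
  by rewrite mulr1 /T lerDr; apply: addr_ge0 => //; pos.
have d1 : 0 < 1 - d by lra.
set Yn := Num.max y (cmod x).
(* Since [d <= 1/4], [1 + 2 d] is at most [(1 - d) * (1 + 4 d)]; this compares [y] with
   [|x| > rho (1 - d)]. *)
have Yx : Yn <= cmod x * expR (4 * d).
  have E1 : 1 + 4 * d <= expR (4 * d) by exact: expR_ge1Dx.
  rewrite /Yn ge_max; apply/andP; split; last by rewrite ler_peMr// (le_trans _ E1)// lerDl mulr_ge0// ltW.
  have h3 : rho * (1 - d) * (1 + 4 * d) <= cmod x * expR (4 * d).
    by apply: ler_pM => //; [exact: ltW|rewrite addr_ge0// mulr_ge0// ltW|exact: ltW].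
  apply: le_trans h3; rewrite /y -mulrA ler_pM2l//.
  have : d * d <= 1 / 4 * d by rewrite ler_pM2r.
  lra.
have Y0 : 0 < Yn by rewrite /Yn lt_max y0.
have yY : y <= Yn by rewrite /Yn le_max lexx.
have hYn : a n * Yn ^+ n <= expR (e / 2 * n%:R) * (a n * cmod x ^+ n).
  rewrite mulrCA; apply: ler_wpM2l; first exact: ltW.
  apply: (@le_trans _ _ ((cmod x * expR (4 * d)) ^+ n)).
    by apply: lerXn2r; rewrite ?nnegrE//; [exact: ltW|apply: mulr_ge0 => //; exact: expR_ge0].
  rewrite exprMn mulrC; apply: ler_wpM2r; first by pos.
  rewrite -expRM_natr ler_expR; apply: ler_wpM2r => //; lra.
(* As [y > rho], the quantity [a n * y^n] does not decay, so it can absorb the constant bound for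
   [q n * g]. *)
have low : cK <= a n * Yn ^+ n.
  have := hK2 K2 (n - K2)%N (leqnn _); rewrite subnKC// => h.
  have h3 : a K2 * y^-1 ^+ (n - K2) * y ^+ n <= a n * y ^+ n.
    by apply: ler_wpM2r => //; pos.
  apply: le_trans (le_trans _ h3) _.
    rewrite /cK -mulrA; apply: ler_wpM2l; first exact: ltW.
    have -> : y ^+ n = y ^+ (n - K2) * y ^+ K2 by rewrite -exprD subnK.
    by rewrite mulrA -exprMn mulVf ?gt_eqF// expr1n mul1r.
  apply: ler_wpM2l; first exact: ltW.
  by apply: lerXn2r; rewrite ?nnegrE//; exact: ltW.
have [qn qsz] := row_q row n0.
have hq : cmod (q n).[x] <= B.
  apply: le_trans (normalized_le x qn qsz) _.
  by apply: lerXn2r; rewrite ?nnegrE ?lerD2l// addr_ge0// mulr_ge0// ltW.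
have hg : cmod (g x) <= G by apply: hG; lra.
have hpn := hp n x K1n; rewrite -/Yn in hpn.
set U := a n * Yn ^+ n in hpn hYn low; have U0 : 0 < U by exact: lt_le_trans low.
apply: (@le_trans _ _ (T * (n%:R + 1) * U)); last first.
  by apply: ler_wpM2l => //; apply: mulr_ge0 => //; lra.
rewrite /boundary_remainder; apply: le_trans (cmodB _ _) _.
rewrite cmodM; have h4 : cmod (q n).[x] * cmod (g x) <= B * G by apply: ler_pM.
have h5 : B * G <= B * G / cK * U.
  rewrite mulrAC ler_pdivlMr//; apply: ler_wpM2l => //; by pos.
have h6 : B * G / cK * U <= B * G / cK * U * (n%:R + 1).
  by apply: ler_peMr; [by apply: mulr_ge0; [pos|exact: ltW]|rewrite lerDr].
have h7 : 0 <= D * rho / c * (n%:R + 1) * U.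
  by apply: mulr_ge0; [apply: mulr_ge0; [pos|exact: addr_ge0]|exact: ltW].
rewrite /T; move: h4 h5 h6 h7 hpn.
move: (cmod (q n).[x] * cmod (g x)) (B * G / cK) (D * rho / c) (B * G) (cmod _) => X1 X2 X3 X4 X5.
move: (n%:R : R) => N h4 h5 h6 h7 hpn; lra.
Qed.

(** The continuation [g] drops out of the difference of [F n / q n] and [F k / q k], which is a
    telescoping sum; on the annulus the [q i] are bounded above and below. *)
Lemma boundary_recursion rho0 c : 0 < rho0 -> 0 < c -> 8 * rho0 <= rho ->
    (forall x, annulus zeta rho0 x -> c <= cmod qm.[x]) ->
  exists2 K0, 1 <= K0 & exists2 N1, (N0 <= N1)%N &
    forall n k x, (N1 <= n)%N -> (n <= k)%N -> annulus zeta rho0 x ->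
    cmod (boundary_remainder n x) <=
      K0 * (\sum_(n <= i < k) a i * cmod x ^+ i + cmod (boundary_remainder k x)) /\
    cmod (boundary_remainder k x) <=
      K0 * (\sum_(n <= i < k) a i * cmod x ^+ i + cmod (boundary_remainder n x)).
Proof.
move=> r0 c0 r8 hc; have rp := row_rho row.
have c20 : 0 < c / 2 by pos. have r20 : 0 <= 2 * rho by pos.
have [N1 N01 hN] := limit_uniform c20 r20.
pose B := (1 + 2 * rho) ^+ m; have B0 : 0 < B by rewrite /B; pos.
pose Cx := term_cst m (rho / 2) (2 * rho).
have Cx0 : 0 <= Cx by apply: term_cst_ge0; pos.
pose K0 := 1 + (B / (c / 2) + B * (Cx / (c / 2) ^+ 2)).
have b1 : 0 <= B / (c / 2) by pos.
have b2 : 0 <= B * (Cx / (c / 2) ^+ 2) by pos.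
have K01 : 1 <= K0 by rewrite /K0; lra.
exists K0 => //; exists N1 => // n k x N1n nk xA.
have /andP[xA1 xA2] := xA.
have h1 := cmod_dist x zeta; have h2 := cmod_dist zeta x.
rewrite (cmodBC zeta x) in h2; rewrite zetaE in h1 h2.
have x_hi : cmod x <= 2 * rho by lra. have x_lo : rho / 2 <= cmod x by lra.
have xr : rho / 2 <= cmod x <= 2 * rho by rewrite x_lo.
have hcx := hc x xA.
have qlow i : (N1 <= i)%N -> c / 2 <= cmod (q i).[x].
  move=> Ni; have := hN i x Ni x_hi; have := cmod_dist qm.[x] (q i).[x]; rewrite cmodBC; lra.
have qne i : (N1 <= i)%N -> (q i).[x] != 0.
  by move=> Ni; rewrite -cmod_gt0; apply: lt_le_trans (qlow i Ni).
have qhi i : (N1 <= i)%N -> cmod (q i).[x] <= B.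
  move=> Ni; have [qn qsz] := row_q row (leq_trans N01 Ni).
  apply: le_trans (normalized_le x qn qsz) _.
  by apply: lerXn2r; rewrite ?nnegrE; lra.
set S := \sum_(n <= i < k) _.
have S0 : 0 <= S.
  rewrite /S big_nat; apply: sumr_ge0 => i /andP[ni _].
  by have ai := row_a row (leq_trans N01 (leq_trans N1n ni)); pos.
have tele : cmod ((p k).[x] / (q k).[x] - (p n).[x] / (q n).[x]) <= Cx / (c / 2) ^+ 2 * S.
  rewrite row_telescope//; apply: le_trans (cmod_sum _ _ _) _.
  rewrite /S mulr_sumr; apply: ler_sum_nat => i /andP[ni ik].
  have Ni := leq_trans N1n ni; have hi := leq_trans N01 Ni.
  have r2 : 0 < rho / 2 by pos.
  apply: le_trans (term_bound row hi r2 xr (qne _ Ni) (qne _ (leqW Ni))) _.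
  rewrite -/Cx mulrAC; apply: ler_wpM2r.
    by have ai := row_a row hi; pos.
  apply: ler_wpM2l => //.
  have q1 := qlow _ Ni; have q2 := qlow _ (leqW Ni).
  have cc : (c / 2) ^+ 2 <= cmod (q i).[x] * cmod (q i.+1).[x].
    by rewrite expr2; apply: ler_pM => //; exact: ltW.
  by rewrite lef_pV2 ?posrE//; [apply: lt_le_trans cc; pos|pos].
have gen i j : (N1 <= i)%N -> (N1 <= j)%N ->
    cmod ((p i).[x] / (q i).[x] - (p j).[x] / (q j).[x]) <= Cx / (c / 2) ^+ 2 * S ->
    cmod (boundary_remainder i x) <= K0 * (S + cmod (boundary_remainder j x)).
  move=> Ni Nj h; have qi := qne i Ni; have qj := qne j Nj.
  have -> : boundary_remainder i x = (q i).[x] *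
     (boundary_remainder j x / (q j).[x] - ((p i).[x] / (q i).[x] - (p j).[x] / (q j).[x])).
    by rewrite /boundary_remainder; field; apply/andP; split.
  rewrite cmodM; apply: (@le_trans _ _ (B * (cmod (boundary_remainder j x) / (c / 2) +
      Cx / (c / 2) ^+ 2 * S))).
    apply: ler_pM => //; first exact: qhi.
    apply: le_trans (cmodB _ _) _; apply: lerD => //.
    rewrite cmodM cmodV; apply: ler_wpM2l => //.
    have ql := qlow j Nj; rewrite lef_pV2 ?posrE//; exact: lt_le_trans ql.
  have F0 := cmod_ge0 (boundary_remainder j x).
  have -> : B * (cmod (boundary_remainder j x) / (c / 2) + Cx / (c / 2) ^+ 2 * S) =
     B / (c / 2) * cmod (boundary_remainder j x) + B * (Cx / (c / 2) ^+ 2) * S by ring.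
  have p1 : 0 <= B / (c / 2) * S by apply: mulr_ge0.
  have p2 : 0 <= B * (Cx / (c / 2) ^+ 2) * cmod (boundary_remainder j x) by apply: mulr_ge0.
  rewrite /K0; move: (B / (c / 2)) (B * (Cx / (c / 2) ^+ 2)) (cmod _) p1 p2 F0.
  by move=> X1 X2 X3 p1 p2 F0; lra.
have N1k := leq_trans N1n nk.
by split; apply: gen => //; rewrite cmodBC.
Qed.

(** At [zeta] itself the remainders at [n] and [n + 1] are [O(a n * rho^n)] by [center_bound], while
    [q n] and [q n.+1] tend to 0. The identity then makes [qs n] small at [zeta] when [A n] is
    comparable to [a n]. *)
Lemma boundary_roots c : 0 < c -> root qm zeta ->
  roots_tend qs [set n | c * a n <= cmod (A n)] zeta.
Proof.
move=> c0 qz; apply: contrapT => nstar; have rp := row_rho row; have tp := t_gt0.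
have [rho0 [c1 [r0 c10 r8 rt hc1]]] := punctured_lower_bound.
have [K0 K01 [N1 N01 hrec]] := boundary_recursion r0 c10 r8 hc1.
have Flim n : (N1 <= n)%N -> poly_limit zeta (2 * rho0) (boundary_remainder n).
  move=> _; apply: poly_limitB; last exact: poly_poly_limit.
  apply: poly_limitM; first exact: poly_poly_limit.
  by apply: pseries_poly_limit rt g_series; pos.
have ap e : 0 < e -> exists K, forall n x, (K <= n)%N -> annulus zeta rho0 x ->
    cmod (boundary_remainder n x) <= expR (e * n%:R) * (a n * cmod x ^+ n).
  exact: boundary_apriori r0 c10 r8 rt hc1.
have a0 n : (N1 <= n)%N -> 0 < a n by move=> h; apply: (row_a row); exact: leq_trans h.
have acc n : (N1 <= n)%N -> n.+1%:R * (a n / a n.+1) <= n.+2%:R * (a n.+1 / a n.+2).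
  by move=> h; apply: a_conc; exact: leq_trans h.
have [B B0 [N2 hB]] := center_bound zetaE rp r0 r8 K01 a0 (row_ratio row) acc Flim hrec ap.
have [kap kap0 [d d0 hd]] := not_roots_tend (row_qs row) nstar.
have [N3 N03 hlam] := lam_eventually0.
have [K hK] := row_ratio row (e := rho / 2) ltac:(by pos).
(* The two products add up to at most [3 * eta * B], as [a n.+1 * rho <= 2 * a n]; this has to be
   less than [c * rho * kap]. *)
pose eta := c * rho * kap / (4 * (B + 1)).
have eta0 : 0 < eta by rewrite /eta; pos.
have [N4 N04 hN4] := limit_uniform eta0 (ltW rp).
have [n [nn Sn hn]] := hd (maxn (maxn N2 N3) (maxn K N4)).
move: nn; rewrite !geq_max => /andP[/andP[N2n N3n] /andP[Kn N4n]].
have n0 := leq_trans N03 N3n; have an := row_a row n0; have an1 := row_a row (leqW n0).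
have hz : kap <= cmod (qs n).[zeta] by apply: hn; rewrite subrr cmod0 ltW.
have q0 := hN4 n zeta N4n; have q1 := hN4 n.+1 zeta (leqW N4n).
rewrite (rootP qz) !subr0 zetaE lexx in q0 q1.
have {}q0 := q0 isT; have {}q1 := q1 isT.
have F0 := hB n N2n; have F1 := hB n.+1 (leqW N2n).
rewrite /bounded_by zetaE in F0 F1.
have a1 : a n.+1 * rho <= 2 * a n.
  have := hK n Kn; rewrite ltr_distl => /andP[h _].
  have h' : rho / 2 <= a n / a n.+1 by lra.
  by rewrite ler_pdivlMr// in h'; lra.
have E : A n * zeta ^+ n.+1 * (qs n).[zeta] =
    (q n.+1).[zeta] * boundary_remainder n zeta - (q n).[zeta] * boundary_remainder n.+1 zeta.
  have := row_diff row zeta n0; rewrite (hlam n N3n) (hlam n.+1 (leqW N3n)) !subn0 => <-.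
  by rewrite /boundary_remainder; ring.
have {}E := congr1 (@cmod R) E; rewrite !cmodM cmodX zetaE in E.
have rn : 0 < rho ^+ n by pos.
have up : cmod (A n) * rho ^+ n.+1 * cmod (qs n).[zeta] <= 3 * eta * B * (a n * rho ^+ n).
  rewrite E; apply: le_trans (cmodB _ _) _; rewrite !cmodM.
  apply: (@le_trans _ _ (eta * (B * (a n * rho ^+ n)) + eta * (B * (a n.+1 * rho ^+ n.+1)))).
    by apply: lerD; apply: ler_pM.
  have h : a n.+1 * rho ^+ n.+1 <= 2 * (a n * rho ^+ n).
    by rewrite exprS [a n.+1 * _]mulrA mulrA ler_pM2r.
  have hB0 : 0 <= eta * B by apply: mulr_ge0 => //; exact: ltW.
  have := ler_wpM2l hB0 h.
  move: (a n * rho ^+ n) (a n.+1 * rho ^+ n.+1) => X Y h'; lra.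
have low : c * rho * kap * (a n * rho ^+ n) <= cmod (A n) * rho ^+ n.+1 * cmod (qs n).[zeta].
  have -> : c * rho * kap * (a n * rho ^+ n) = c * a n * rho ^+ n.+1 * kap.
    by rewrite exprS; ring.
  apply: ler_pM => //; [by pos|exact: ltW|].
  by apply: ler_wpM2r => //; pos.
have := le_trans low up; rewrite ler_pM2r; last by pos.
have etaE : eta * (4 * (B + 1)) = c * rho * kap by rewrite /eta divfK// gt_eqF//; pos.
have : 0 <= eta * B by apply: mulr_ge0 => //; exact: ltW.
rewrite -etaE; lra.
Qed.
End BoundaryRoots.

(** * Poles and singular points in terms of a denominator *)

Section Singularities.
Variables (R : realType) (phi : nat -> R[i]) (rho : R) (w : {poly R[i]}).
Local Notation C := R[i].
Implicit Types (z y : C) (t e d : R) (F g h : C -> C).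
Hypothesis rho0 : 0 < rho.
Hypothesis hw : denominator_of phi rho w.
Hypothesis w0 : w != 0.
Local Notation W := (psum (pmul w phi)).

Lemma punctured_neq0 z0 : exists2 d, 0 < d &
  forall z, z != z0 -> cmod (z - z0) < d -> w.[z] != 0.
Proof.
have [w1 w1z w1E] := mup_factor z0 w0.
have p0 : 0 < cmod w1.[z0] by rewrite cmod_gt0.
have [d d0 hd] := has_pseries_continuous ltr01 (has_pseries_poly w1 z0 1) p0.
exists d => // z zz0 /hd h; rewrite w1E hornerM horner_exp hornerXsubC mulf_neq0//.
  by apply: contraTneq h => ->; rewrite sub0r cmodN ltxx.
by rewrite expf_neq0// subr_eq0.
Qed.

Lemma removable F z0 i k h t : 0 < t -> has_pseries h z0 t -> (k <= i)%N ->
    (forall z, z != z0 -> cmod (z - z0) < t ->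
      F z = (z - z0) ^+ i / (z - z0) ^+ k * h z) ->
  exists2 g, has_pseries g z0 t &
    forall z, z != z0 -> cmod (z - z0) < t -> F z = g z.
Proof.
move=> t0 hh ki FE; exists (fun z => (('X - z0%:P) ^+ (i - k)).[z] * h z).
  exact: has_pseriesM.
move=> z zz0 zt; rewrite (FE z zz0 zt) horner_exp hornerXsubC.
by rewrite expfB_cond// subr_eq0 (negbTE zz0).
Qed.

(** The value of [F] at [z0] matters only if [F] is analytic there, and then it is the value of [g]
    by [pseries_eq]. *)
Lemma removable_regular F D z0 g t : 0 < t -> has_pseries g z0 t ->
    (forall z, z != z0 -> cmod (z - z0) < t -> F z = g z) ->
  regular_point F D z0.
Proof.
move=> t0 hg FE; exists g; split; first by apply/analytic_atP; exists t.
apply/nearCP; exists t => // z zt _ hF; have [zz0|zz0] := eqVneq z z0; last exact: FE.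
rewrite zz0 in hF *; have /analytic_atP[t1 t10 hF1] := hF.
pose t2 := Num.min t t1; have t20 : 0 < t2 by rewrite /t2 lt_min t0.
have t2t : t2 <= t by rewrite /t2 ge_min lexx.
have t2t1 : t2 <= t1 by rewrite /t2 ge_min lexx orbT.
apply: (@pseries_eq _ _ _ _ t2) => //.
- by apply: has_pseries_le hF1; rewrite (ltW t20).
- by apply: has_pseries_le hg; rewrite (ltW t20).
by move=> y yz0 yt; apply: FE => //; exact: lt_le_trans t2t.
Qed.

Variable F : C -> C.
Hypothesis hF : meromorphic_extension phi (disk rho) F.

Lemma nonroot_analytic z0 : cmod z0 < rho -> w.[z0] != 0 ->
  exists2 d, 0 < d & forall z, z != z0 -> cmod (z - z0) < d -> analytic_at F z.
Proof.
move=> z0r wz0; have m0 : mup z0 w = 0%N.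
  apply/eqP; rewrite -leqn0 leqNgt -XsubC_dvd// dvdp_XsubCl.
  exact: wz0.
suff [g [t [t0 hg FE]]] : exists g t, [/\ 0 < t, has_pseries g z0 t &
    forall z, z != z0 -> cmod (z - z0) < t -> F z = g z].
  exists t => // z zz0 zt; apply/analytic_atP.
  pose t1 := Num.min (t - cmod (z - z0)) (cmod (z - z0)).
  have t10 : 0 < t1 by rewrite /t1 lt_min subr_gt0 zt cmod_gt0 subr_eq0.
  have t1t : t1 <= t - cmod (z - z0) by rewrite /t1 ge_min lexx.
  have t1z : t1 <= cmod (z - z0) by rewrite /t1 ge_min lexx orbT.
  exists t1 => //; apply: (@has_pseries_ext _ g).
    move=> y yt; rewrite FE//.
      apply: contraTneq yt => ->; rewrite cmodBC -leNgt; exact: t1z.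
    have -> : y - z0 = (y - z) + (z - z0) by rewrite addrA subrK.
    by apply: le_lt_trans (cmodD _ _) _; rewrite -ltrBrDr; exact: lt_le_trans t1t.
  by apply: has_pseries_le (has_pseries_recentre zt hg); rewrite (ltW t10).
have [[t t0 F0]|[i [k [h [t [t0 hh h0 [ki _] FE]]]]]] := denominator_order hw w0 z0r hF.
  exists (fun z => (0 : {poly C}).[z]), t; split=> //; first exact: has_pseries_poly.
  by move=> z zz0 zt; rewrite horner0; exact: F0.
rewrite m0 add0n in ki; have [g hg gE] := removable t0 hh ki FE.
by exists g, t.
Qed.

(** [F = g] is known only where [F] is analytic. Such points accumulate at each [z0] of the disk,
    where [w F = W] turns into zeros of [w g - W]. *)
Lemma regular_denominator zeta g t : has_pseries g zeta t ->
    (forall z, cmod (z - zeta) < t -> cmod z < rho -> analytic_at F z -> F z = g z) ->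
  forall z, cmod (z - zeta) < t -> cmod z < rho -> w.[z] * g z = W z.
Proof.
move=> hg FE z0 z0t z0r.
have [d1 d10 hd1] := agrees_disk hw hF z0r.
have [d2 d20 hd2] := punctured_neq0 z0.
have [t1 t10 hW] := numerator_pseries hw z0r.
have h0 : 0 < t - cmod (z0 - zeta) by rewrite subr_gt0.
have h1 : 0 < rho - cmod z0 by rewrite subr_gt0.
pose s := Num.min (t - cmod (z0 - zeta)) (Num.min t1 (Num.min (rho - cmod z0) (Num.min d1 d2))).
have s0 : 0 < s by rewrite /s !lt_min h0 t10 h1 d10 d20.
have s1 : s <= t - cmod (z0 - zeta) by rewrite /s !ge_min lexx.
have s2 : s <= t1 by rewrite /s !ge_min lexx ?orbT.
have s3 : s <= rho - cmod z0 by rewrite /s !ge_min lexx ?orbT.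
have s4 : s <= d1 by rewrite /s !ge_min lexx ?orbT.
have s5 : s <= d2 by rewrite /s !ge_min lexx ?orbT.
clearbody s.
have sr z : cmod (z - z0) < s -> cmod z < rho.
  move=> zs; have := cmod_dist z z0; lra.
have hg0 : has_pseries g z0 s.
  by apply: has_pseries_le (has_pseries_recentre z0t hg); rewrite (ltW s0).
have hW0 : has_pseries W z0 s by apply: has_pseries_le hW; rewrite (ltW s0).
have hWg := has_pseriesD s0 (has_pseriesM w s0 hg0) (has_pseriesM (-1)%:P s0 hW0).
have := pseries_zero s0 hWg; move/(_ _ z0); rewrite subrr cmod0 => H.
apply/eqP; rewrite -subr_eq0; apply/eqP.
have -> : w.[z0] * g z0 - W z0 = w.[z0] * g z0 + ((-1)%:P).[z0] * W z0.
  by rewrite hornerC mulN1r.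
apply: H => // e e0; pose u := Num.min e s.
have u0 : 0 < u by rewrite /u lt_min e0.
have ue : u <= e by rewrite /u ge_min lexx.
have us : u <= s by rewrite /u ge_min lexx orbT.
clearbody u.
(* The shift to [z1] avoids the zeros of [w]; the further shift to [z] avoids [z1], at which [F] may
   still take a wrong value. *)
pose z1 := z0 + (u / 2)%:C; have z1E : cmod (z1 - z0) = u / 2.
  by rewrite /z1 addrC addKr cmod_real//; pos.
have z10 : z1 != z0 by rewrite -subr_eq0 -cmod_gt0 z1E; pos.
have [d3 d30 hd3] := nonroot_analytic (sr z1 ltac:(rewrite z1E; lra))
  (hd2 z1 z10 ltac:(rewrite z1E; lra)).
pose v := Num.min (d3 / 2) (u / 4).
have v0 : 0 < v by rewrite /v lt_min; apply/andP; split; pos.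
have v3 : v <= d3 / 2 by rewrite /v ge_min lexx.
have vu : v <= u / 4 by rewrite /v ge_min lexx orbT.
clearbody v.
pose z := z1 + v%:C; have zE : cmod (z - z1) = v.
  have -> : z - z1 = v%:C by rewrite /z; ring.
  by rewrite cmod_real// ltW.
have zz1 : z != z1 by rewrite -subr_eq0 -cmod_gt0 zE.
have zd : cmod (z - z0) = u / 2 + v.
  have -> : z - z0 = (u / 2 + v)%:C by rewrite /z /z1 rmorphD; ring.
  by rewrite cmod_real// addr_ge0// ltW//; pos.
have zz0 : z != z0 by rewrite -subr_eq0 -cmod_gt0 zd; lra.
have zs : cmod (z - z0) < s by rewrite zd; lra.
exists z; split=> //; first by rewrite zd; lra.
rewrite hornerC mulN1r -(FE z).
- by rewrite (hd1 z zz0 (lt_le_trans zs s4)) subrr.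
- have := cmodD (z - z0) (z0 - zeta); rewrite addrA subrK.
  by lra.
- exact: sr.
by apply: hd3 => //; rewrite zE; lra.
Qed.

Lemma closure_disk z : cmod z <= rho -> closure (disk rho) z.
Proof.
move=> zr B /nearCP[r r0 hr].
pose s := Num.min (1 / 2) (r / (2 * rho)).
have s0 : 0 < s by rewrite /s lt_min; apply/andP; split; pos.
have s1 : s <= 1 / 2 by rewrite /s ge_min lexx.
have s2 : s <= r / (2 * rho) by rewrite /s ge_min lexx orbT.
clearbody s; exists (z * (1 - s)%:C); have zp := cmod_ge0 z.
have sr : s * rho <= r / 2.
  by move: s2; rewrite ler_pdivlMr; [move=> h; lra|pos].
split.
  rewrite /disk /= cmodM cmod_real; last lra.
  apply: (@le_lt_trans _ _ (rho * (1 - s))).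
    by apply: ler_wpM2r => //; lra.
  have h := mulr_gt0 rho0 s0; rewrite mulrBr mulr1; lra.
apply: hr; have -> : z * (1 - s)%:C - z = - (z * s%:C).
  by rewrite rmorphB rmorph1; ring.
rewrite cmodN cmodM cmod_real ?ltW//.
apply: (@le_lt_trans _ _ (rho * s)); first by apply: ler_wpM2r => //; exact: ltW.
by rewrite mulrC; lra.
Qed.

Lemma denominator_singular z : cmod z < rho -> root w z -> W z != 0 ->
  singular_point F (disk rho) z.
Proof.
move=> zr wz Wz; split; first by apply: closure_disk; exact: ltW.
move=> [g [/analytic_atP[t t0 hg] /nearCP[r r0 hr]]]; case/eqP: Wz.
pose s := Num.min t r; have s0 : 0 < s by rewrite /s lt_min t0.
have st : s <= t by rewrite /s ge_min lexx.
have sr : s <= r by rewrite /s ge_min lexx orbT.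
have hg' : has_pseries g z s by apply: has_pseries_le hg; rewrite (ltW s0).
rewrite -(regular_denominator hg')//; last by rewrite subrr cmod0.
  by rewrite (rootP wz) mul0r.
by move=> y ys yr; apply: hr => //; exact: lt_le_trans sr.
Qed.

Lemma singular_pole z : cmod z < rho -> singular_point F (disk rho) z ->
  exists2 k, (k <= mup z w)%N & pole_of_order F z k.
Proof.
move=> zr [_ nreg].
have [[t t0 F0]|[i [k [h [t [t0 hh h0 [ki _] FE]]]]]] := denominator_order hw w0 zr hF.
  case: nreg; apply: (removable_regular _ t0 (has_pseries_poly 0 z t)).
  by move=> y yz yt; rewrite horner0; exact: F0.
have [ik|ik] := leqP k i.
  by case: nreg; have [g hg gE] := removable t0 hh ik FE; exact: removable_regular t0 hg gE.
exists (k - i)%N; first by rewrite leq_subLR addnC.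
split; first by rewrite subn_gt0.
exists h; split=> //; first by apply/analytic_atP; exists t.
apply/dnearCP; exists t => // y yz yt; rewrite (FE y yz yt) [RHS]mulrC; congr (_ * _).
have yz0 : y - z != 0 by rewrite subr_eq0.
have -> : (y - z) ^+ k = (y - z) ^+ i * (y - z) ^+ (k - i) by rewrite -exprD subnKC// ltnW.
by rewrite invfM mulrA divff ?mul1r// expf_neq0.
Qed.
End Singularities.

(** * The alternatives at a limit point and the count of zeros *)

Section Alternatives.
Variables (R : realType) (phi : nat -> R[i]) (m : nat).
Variables (p q qs : nat -> {poly R[i]}) (A : nat -> R[i]) (lam : nat -> nat).
Variables (rho : R) (a : nat -> R) (N0 : nat).
Hypothesis row : pade_row phi m p q qs A lam rho a N0.
Local Notation C := R[i].
Implicit Types (z zeta : C) (t e : R) (n k : nat).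
Variable F : C -> C.
Hypothesis hF : meromorphic_extension phi (disk rho) F.
Variable c : R.
Hypothesis c0 : 0 < c.
Local Notation S := [set n | c * a n <= cmod (A n)].

Lemma interior_roots zeta l : cmod zeta < rho -> roots_tend q setT zeta ->
    ((0 < l)%N -> forall e, 0 < e -> exists N, forall n, (N <= n)%N ->
      (l <= count (fun v => (cmod (v - zeta) <= e)%R) (zeros (q n)))%N) ->
  roots_tend qs S zeta \/
  (exists2 k, (l <= k)%N & pole_of_order F zeta k) /\
  singular_point F (disk rho) zeta.
Proof.
move=> zr hq hl; have [|nstar] := pselect (roots_tend qs S zeta); first by left.
right; have rp := row_rho row; have [w [w0 hw hW]] := coprime_denominator row.
(* The hypothesis on distances alone gives order one, so [zeta] is a zero of [w] even for
   [l = 0]. *)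
have m1 : (0 < mup zeta w)%N.
  have [B B0 [r0 r00 h]] := roots_tend_order1 row hq.
  exact: (interior_multiplicity row w0 hw zr c0 nstar B0 r00 h).
have wz : root w zeta by rewrite -dvdp_XsubCl XsubC_dvd.
split; last exact: (denominator_singular rp hw w0 hF zr wz (hW _ zr wz)).
exists (mup zeta w); last exact: (denominator_pole hw w0 zr wz (hW _ zr wz) hF).
case: l hl => // l /(_ isT) hl.
have [B B0 [r0 r00 h]] := many_roots_order row hl.
exact: (interior_multiplicity row w0 hw zr c0 nstar B0 r00 h).
Qed.

Variable qm : {poly C}.
Hypothesis qm_size : size qm = m.+1.
Hypothesis qm_cvg : forall k e, 0 < e -> exists N, forall n, (N <= n)%N ->
  cmod ((q n)`_k - qm`_k) < e.

Lemma limit_root zeta : roots_tend q setT zeta -> root qm zeta.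
Proof.
move=> hq; apply/rootP/eqP; rewrite -cmod_eq0; apply/eqP/le_anti.
rewrite cmod_ge0 andbT; apply/ler_addgt0Pr => e e0; rewrite add0r.
have e2 : 0 < e / 2 by rewrite divr_gt0.
have [N1 _ h1] := limit_uniform row qm_size qm_cvg e2 (cmod_ge0 zeta).
have [d d0 [N2 _ h2]] := roots_tend_small row hq e2.
pose n := maxn N1 N2.
have h3 := h1 n zeta (leq_maxl _ _) (lexx _).
have h4 := h2 n zeta (leq_maxr _ _) I ltac:(by rewrite subrr cmod0).
have := cmod_dist qm.[zeta] (q n).[zeta]; rewrite cmodBC.
move: (cmod _) (cmod (q n).[zeta]) (cmod (_ - _)) h3 h4 => x y u; lra.
Qed.

Lemma limit_roots_tend zeta : root qm zeta -> roots_tend q setT zeta.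
Proof.
move=> /rootP qz e e0; have [eta eta0 h] := roots_of_small m zeta e0.
have eta2 : 0 < eta / 2 by rewrite divr_gt0.
have [N N0N hN] := limit_uniform row qm_size qm_cvg eta2 (cmod_ge0 zeta).
exists N => n Nn _; have [qn qsz] := row_q row (leq_trans N0N Nn).
apply: (h (q n) zeta qn qsz); first by rewrite subrr cmod0 ltW// divr_gt0.
have := hN n zeta Nn (lexx _); rewrite qz subr0; lra.
Qed.

Hypothesis a_conc : forall n, (N0 <= n)%N ->
  n.+1%:R * (a n / a n.+1) <= n.+2%:R * (a n.+1 / a n.+2).

Lemma boundary_alternative zeta : cmod zeta = rho -> root qm zeta ->
  roots_tend qs S zeta \/ singular_point F (disk rho) zeta.
Proof.
move=> zr qz; have rp := row_rho row.
have [[g [/analytic_atP[t t0 hg] /nearCP[r r0 hr]]]|nreg] :=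
  pselect (regular_point F (disk rho) zeta); last first.
  by right; split=> //; apply: closure_disk => //; rewrite zr.
left; pose s := Num.min t r; have s0 : 0 < s by rewrite /s lt_min t0.
have st : s <= t by rewrite /s ge_min lexx.
have sr : s <= r by rewrite /s ge_min lexx orbT.
have hg' : has_pseries g zeta s by apply: has_pseries_le hg; rewrite (ltW s0).
have qm0 := limit_neq0 qm_size.
have hd := limit_denominator row qm_size qm_cvg.
have agr := regular_denominator hd qm0 hF hg'.
apply: (boundary_roots row qm_size qm_cvg a_conc zr s0 hg') => //.
by apply: agr => y ys yr; apply: hr => //; exact: lt_le_trans sr.
Qed.

Lemma limit_alternative zeta : root qm zeta ->
  roots_tend qs S zeta \/ singular_point F (disk rho) zeta.
Proof.
move=> qz; have hq := limit_roots_tend qz.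
have [zr|zr|zr] := ltgtP (cmod zeta) rho.
- have [|[_ h]] := @interior_roots zeta 0 zr hq ltac:(by []); by [left|right].
- by left; exact: (exterior_roots row c0 zr hq).
exact: boundary_alternative.
Qed.

Lemma limit_simple_pole zeta : root qm zeta -> uniq (zeros qm) ->
    singular_point F (disk rho) zeta -> cmod zeta < rho ->
  pole_of_order F zeta 1.
Proof.
move=> qz uq hs zr; have qm0 := limit_neq0 qm_size.
have hd := limit_denominator row qm_size qm_cvg.
have [k kmu hk] := singular_pole hd qm0 hF zr hs.
suff m1 : (mup zeta qm <= 1)%N.
  have /eqP <- // : k == 1%N by rewrite eqn_leq (leq_trans kmu m1); case: hk.
rewrite leqNgt mup_geq//; apply/negP => h.
have : dvdp (('X - zeta%:P) ^+ 2) (\prod_(z <- zeros qm) ('X - z%:P)).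
  by move: h; rewrite {1}(zerosP qm) dvdpZr// lead_coef_eq0.
have zq : zeta \in zeros qm by rewrite -root_zeros.
rewrite (perm_big _ (perm_to_rem zq)) /= big_cons expr2 dvdp_mul2l ?polyXsubC_eq0//.
rewrite dvdp_XsubCl root_prod_XsubC mem_rem_uniq// inE eqxx.
by [].
Qed.

Lemma separated (U : seq C) : exists2 e, 0 < e & forall u v, u \in U -> v \in U ->
  cmod (u - v) < 2 * e -> u = v.
Proof.
elim: U => [|x U [e e0 he]]; first by exists 1.
have [d d0 hd] : exists2 d, 0 < d & forall v, v \in U -> cmod (x - v) < 2 * d -> x = v.
  elim: {e e0 he} U => [|y U [d d0 hd]]; first by exists 1.
  have [<-|xy] := eqVneq x y.
    by exists d => // v; rewrite inE => /orP[/eqP -> //|]; exact: hd.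
  have xy0 : 0 < cmod (x - y) / 2 by rewrite divr_gt0// cmod_gt0 subr_eq0.
  exists (Num.min d (cmod (x - y) / 2)); first by rewrite lt_min d0.
  move=> v; rewrite inE => /orP[/eqP ->|vU].
    by rewrite -ltr_pdivrMl// lt_min => /andP[_]; rewrite mulrC ltxx.
  by rewrite -ltr_pdivrMl// lt_min ltr_pdivrMl// => /andP[/hd h _]; exact: h.
exists (Num.min d e); first by rewrite lt_min d0.
move=> u v; rewrite !inE -ltr_pdivrMl// lt_min !ltr_pdivrMl//.
move=> /orP[/eqP ->|uU] /orP[/eqP -> //|vU] /andP[h1 h2].
- exact: hd.
- by apply/esym/hd => //; rewrite cmodBC.
exact: he.
Qed.

(** At one large index, disks of a radius separating the points of [U] contain distinct zeros of a
    single polynomial of degree at most [k]. *)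
Lemma roots_tend_size (r : nat -> {poly C}) (T : set nat) (U : seq C) k :
    uniq U -> (forall u, u \in U -> roots_tend r T u) ->
    (forall N, exists n, [/\ (N <= n)%N, T n, r n != 0 & (size (r n) <= k.+1)%N]) ->
  (size U <= k)%N.
Proof.
move=> uU hU hT; have [e e0 he] := separated U.
have [N hN] : exists N, forall n u, (N <= n)%N -> T n -> u \in U ->
    exists w, root (r n) w /\ cmod (u - w) < e.
  elim: U hU {uU he} => [|x U ih] hU; first by exists 0%N.
  have [|N1 h1] := ih; first by move=> u uU; apply: hU; rewrite inE uU orbT.
  have [N2 h2] := hU x (mem_head _ _) e e0; exists (maxn N1 N2) => n u.
  rewrite geq_max inE => /andP[Nn1 Nn2] Tn /orP[/eqP ->|]; last exact: h1.
  by have [w rw wx] := h2 n Nn2 Tn; exists w.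
have [n [Nn Tn rn0 rs]] := hT N.
pose g u : C := xget 0 [set w | root (r n) w /\ cmod (u - w) < e].
have gP u : u \in U -> root (r n) (g u) /\ cmod (u - g u) < e.
  move=> u_U; rewrite /g; case: xgetP => [v _ [] //|hv].
  by have [w hw] := hN n u Nn Tn u_U; case: (hv w hw).
rewrite -(size_map g U) -ltnS; apply: leq_trans rs; apply: max_poly_roots => //.
  by apply/allP => _ /mapP[u u_U ->]; have [] := gP u u_U.
rewrite map_inj_in_uniq// => u v u_U vU guv; apply: he => //.
have [_ h1] := gP u u_U; have [_ h2] := gP v vU; rewrite -guv cmodBC in h2.
have := cmodD (u - g u) (g u - v); rewrite addrA subrK; lra.
Qed.
End Alternatives.

(** * Translation of limits of extended distances *)

Section ExtendedDistances.
Variable R : realType.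
Local Notation C := R[i].
Implicit Types (z zeta : C) (e : R) (n k : nat) (T : set nat) (r : nat -> {poly C}).

Lemma within_cvge0 T (u : nat -> \bar R) : (forall n, 0 <= u n)%E ->
  u n @[n --> within T \oo] --> 0%E <->
  forall e, 0 < e -> exists N, forall n, (N <= n)%N -> T n -> (u n < e%:E)%E.
Proof.
move=> u0; split=> [/fine_cvgP[[N1 _ h1] /cvgrPdist_lt h2] e e0|h].
  have [N2 _ hN2] := h2 e e0; exists (maxn N1 N2) => n.
  rewrite geq_max => /andP[N1n N2n] Tn; have ufin := h1 n N1n Tn.
  have := hN2 n N2n Tn; rewrite /= sub0r normrN -{2}(fineK ufin) lte_fin.
  exact/le_lt_trans/ler_norm.
have ufin e n : (u n < e%:E)%E -> u n \is a fin_num.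
  by move=> h1; rewrite ge0_fin_numE// (lt_trans h1)// ltry.
apply/fine_cvgP; split.
  have [N hN] := h 1 ltr01; exists N => // n Nn Tn; exact: ufin (hN n Nn Tn).
apply/cvgrPdist_lt => e e0; have [N hN] := h e e0; exists N => // n Nn Tn.
have h1 := hN n Nn Tn; rewrite /= sub0r normrN ger0_norm ?fine_ge0//.
by rewrite -lte_fin fineK//; exact: ufin h1.
Qed.

Lemma cdist_ge0 zeta (B : set C) : (0 <= cdist zeta B)%E.
Proof. by apply: le_ereal_inf_tmp => _ [z _ <-]; rewrite lee_fin cmod_ge0. Qed.

Lemma cdist_roots_tend r T zeta :
  cdist zeta (zero_set (r n)) @[n --> within T \oo] --> 0%E <-> roots_tend r T zeta.
Proof.
rewrite within_cvge0; last by move=> n; exact: cdist_ge0.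
split=> h e e0; have [N hN] := h e e0; exists N => n Nn Tn.
  have [_ [z rz <-]] := ereal_inf_lt (hN n Nn Tn).
  by rewrite lte_fin => hz; exists z.
have [z rz hz] := hN n Nn Tn; apply: (@le_lt_trans _ _ (cmod (zeta - z))%:E).
  by apply: ereal_inf_lbound; exists z.
by rewrite lte_fin.
Qed.

Lemma zero_dist_count (q : {poly C}) zeta k e : (zero_dist q zeta k.+1 < e%:E)%E ->
  (k.+1 <= count (fun v => (cmod (v - zeta) <= e)%R) (zeros q))%N.
Proof.
rewrite /zero_dist /=; set s := sort _ _ => h.
(* The default [+oo] of [zero_dist] rules out a missing zero, since the distance is below a real
   number. *)
have ks : (k < size s)%N.
  rewrite ltnNge; apply: contraTN h => sk.
  by rewrite nth_default ?size_map// -leNgt leey.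
rewrite (nth_map 0)// lte_fin in h.
have <- : count (fun d => d <= e) s =
    count (fun v => (cmod (v - zeta) <= e)%R) (zeros q).
  by rewrite count_sort count_map.
rewrite -(cat_take_drop k.+1 s) count_cat; apply: leq_trans (leq_addr _ _).
have st : size (take k.+1 s) = k.+1 by apply: size_takel.
rewrite -{1}st leq_eqVlt eq_sym -all_count; apply/orP; left; apply/(all_nthP 0) => i; rewrite st => ik.
rewrite nth_take//; apply: le_trans (ltW h).
apply: (sorted_leq_nth le_trans lexx) => //.
- by apply: sort_sorted; exact: le_total.
- by rewrite inE (leq_ltn_trans _ ks).
Qed.

Lemma zeros_tending_count (q : nat -> {poly C}) zeta l : zeros_tending_to q zeta l ->
  (0 < l)%N -> forall e, 0 < e -> exists N, forall n, (N <= n)%N ->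
    (l <= count (fun v => (cmod (v - zeta) <= e)%R) (zeros (q n)))%N.
Proof.
case: l => // l [/(_ isT) h _] _ e e0; move: h.
rewrite -{1}[\oo]withinET within_cvge0 => [/(_ e e0)[N hN]|n].
  by exists N => n Nn; apply: zero_dist_count; exact: hN.
rewrite /zero_dist; set s := map _ _.
have [ks|ks] := ltnP l (size s); last by rewrite nth_default.
have := mem_nth +oo%E ks; move/mapP => [d]; rewrite mem_sort => /mapP[v _ ->] ->.
by rewrite lee_fin cmod_ge0.
Qed.
End ExtendedDistances.

(** * Assembly of the four assertions *)

Unset Implicit Arguments.

Theorem theorem2p5 (R : realType) (phi : nat -> R[i]) (m ms : nat)
    (hms : (1 <= ms)%N) (hm : (ms <= m)%N)
    (P Q p q qstar : nat -> {poly R[i]}) (A : nat -> R[i])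
    (hPade : forall n, (m <= n)%N -> incomplete_pade phi n m ms (P n) (Q n))
    (hred : forall n, (m <= n)%N ->
       reduced_fraction (P n) (Q n) (p n) (q n))
    (hqstar : forall n, (m <= n)%N ->
       (size (qstar n) <= (m - ms).+1)%N /\ normalized (qstar n))
    (hA : forall n, (m <= n)%N ->
       difference_formula (p n) (q n) (p n.+1) (q n.+1)
         (common_zero_order (P n) (Q n))
         (common_zero_order (P n.+1) (Q n.+1)) n (A n) (qstar n))
    (rho : R) (hrho : 0 < rho) (hR : Rstar A = rho%:E)
    (f : R[i] -> R[i]) (hf : meromorphic_extension phi (disk rho) f)
    (Bs : nat -> R) (c : R) (Lambda : set nat)
    (hLambda : regularizing_sequence m (fun n => A n * (rho ^+ n)%:C)
                 Bs c Lambda) :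
  let star (zeta : R[i]) :=
    cdist zeta (zero_set (qstar n)) @[n --> within Lambda \oo] --> 0%E in
  (forall zeta : R[i],
     cdist zeta (zero_set (q n)) @[n --> \oo] --> 0%E ->
     [/\ rho < cmod zeta -> star zeta,
         cmod zeta < rho ->
           forall l, zeros_tending_to q zeta l ->
           star zeta \/ exists2 k, (l <= k)%N & pole_of_order f zeta k
       & forall qm : {poly R[i]},
           size qm = m.+1 -> qm.[0] != 0 -> poly_cvg q qm ->
           cmod zeta = rho ->
           star zeta \/ singular_point f (disk rho) zeta]) /\
  (forall qm : {poly R[i]},
     size qm = m.+1 -> qm.[0] != 0 -> poly_cvg q qm -> uniq (zeros qm) ->
     (exists s : seq R[i],
        [/\ uniq s, (ms <= size s)%N &
            forall z, z \in s ->
              root qm z /\ singular_point f (disk rho) z]) /\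
     (forall z, root qm z -> singular_point f (disk rho) z ->
        disk rho z -> pole_of_order f z 1)).
Proof.
move=> star; case: hLambda => [[Bs0 Bsr Bsc Bsb] c0 Linf hL].
pose a n := Bs n / rho ^+ n; pose lam n := common_zero_order (P n) (Q n).
have an n : (m <= n)%N -> 0 < a n by move=> mn; rewrite divr_gt0 ?Bs0 ?exprn_gt0.
have reduced n mn := pade_reduced mn hms (hPade n mn) (hred n mn).
have aratio n : (m <= n)%N -> a n / a n.+1 = rho * (Bs n / Bs n.+1).
  move=> mn; have B1 := Bs0 n.+1 (leqW mn); rewrite /a exprS; field.
  by rewrite !gt_eqF ?exprn_gt0.
have modA n : cmod (A n * (rho ^+ n)%:C) = cmod (A n) * rho ^+ n.
  by rewrite cmodM cmod_real// exprn_ge0// ltW.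
pose N0 := (2 * m).+1.
have mN0 n : (N0 <= n)%N -> (m <= n)%N by rewrite /N0; lia.
have row : pade_row phi m p q qstar A lam rho a N0.
  split=> //.
  - move=> n /mN0 mn; split; first by case: (hred n mn).
    by have [_ h _] := reduced n mn; rewrite (leq_trans _ h)// leq_addl.
  - move=> n /mN0 mn; have [sq nq] := hqstar n mn; split=> //.
    by rewrite (leq_trans sq)// ltnS leq_subr.
  - by move=> n /mN0 mn; have [] := reduced n mn.
  - by move=> n /mN0 mn; have [] := reduced n mn.
  - by move=> n k /mN0 mn kl; have [_ _ ->] := reduced n mn.
  - move=> n z n0; have mn := mN0 n n0; have mn1 := leqW mn.
    have qn0 := normalized_neq0 (let: And3 _ _ h := hred n mn in h).
    have qn1 := normalized_neq0 (let: And3 _ _ h := hred n.+1 mn1 in h).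
    apply: difference_poly (hA n mn) z => //.
    have [_ h1 _] := reduced n mn; have [_ h2 _] := reduced n.+1 mn1.
    rewrite -size_poly_gt0 in qn0; rewrite -size_poly_gt0 in qn1.
    rewrite -/(lam n) in h1 *; rewrite -/(lam n.+1) in h2 *.
    move: (lam n) (lam n.+1) (size (q n)) (size (q n.+1)) qn0 qn1 h1 h2 n0.
    by rewrite /N0 => l1 l2 s1 s2; lia.
  - by move=> n /mN0; exact: an.
  - by move=> n /mN0 mn; rewrite /a ler_pdivlMr ?exprn_gt0// -modA Bsb.
  - move=> e e0; have /cvgrPdist_lt/(_ (e / rho)) := Bsr.
    move=> /(_ (divr_gt0 e0 hrho))[K _ hK]; exists (maxn K m) => n.
    rewrite geq_max => /andP[Kn mn]; rewrite aratio// -[X in _ - X]mulr1 -mulrBr.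
    rewrite normrM gtr0_norm// mulrC -ltr_pdivlMr// distrC.
    exact: hK.
(* With [b k = Bs k / k!], the left-hand side is [rho * (b n / b n.+1)], so the inequality is the
   logarithmic concavity of [b]. *)
have a_conc n : (N0 <= n)%N ->
    n.+1%:R * (a n / a n.+1) <= n.+2%:R * (a n.+1 / a n.+2).
  move=> /mN0 mn; have mn1 := leqW mn; rewrite !aratio//.
  have b0 := Bs0 n mn; have b1 := Bs0 _ mn1; have b2 := Bs0 _ (leqW mn1).
  pose b k := Bs k / k`!%:R; have bp k : 0 < Bs k -> 0 < b k.
    by move=> h; rewrite divr_gt0// ltr0n fact_gt0.
  have := Bsc n mn; rewrite /= -/(b n) -/(b n.+1) -/(b n.+2) => hln.
  have {}hln : b n * b n.+2 <= b n.+1 * b n.+1.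
    move: (bp n b0) (bp n.+1 b1) (bp n.+2 b2) hln.
    move: (b n) (b n.+1) (b n.+2) => x y z x0 y0 z0 h.
    rewrite -ler_ln ?posrE ?mulr_gt0// !lnM ?posrE//.
    by rewrite -[leRHS]mulr2n -mulr_natl.
  have {}hln : b n / b n.+1 <= b n.+1 / b n.+2.
    by rewrite ler_pdivrMr ?bp// mulrAC ler_pdivlMr ?bp.
  have bE k : 0 < Bs k.+1 -> k.+1%:R * (rho * (Bs k / Bs k.+1)) = rho * (b k / b k.+1).
    move=> h; rewrite /b factS natrM; field.
    by rewrite !gt_eqF ?ltr0n ?fact_gt0.
  by rewrite !bE// ler_pM2l.
pose S := [set n | c * a n <= cmod (A n)].
have LS n : Lambda n -> S n.
  move=> /hL[mn h]; rewrite /S /= mulrA ler_pdivrMr ?exprn_gt0//.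
  by rewrite -modA.
have starS zeta : roots_tend qstar S zeta -> star zeta.
  move=> h; apply/cdist_roots_tend => e e0; have [N hN] := h e e0.
  by exists N => n Nn Ln; exact: hN (LS n Ln).
have coefs qm : poly_cvg q qm -> forall k e, 0 < e -> exists N, forall n,
    (N <= n)%N -> cmod ((q n)`_k - qm`_k) < e.
  by move=> h k; have /cvg_ccvg := h k.
have tendq zeta : cdist zeta (zero_set (q n)) @[n --> \oo] --> 0%E ->
    roots_tend q setT zeta.
  by rewrite -{1}[\oo]withinET cdist_roots_tend.
split=> [zeta /tendq hq|qm qm_size _ /coefs qm_cvg uq].
  split=> [zr|zr l hl|qm qm_size _ /coefs qm_cvg zr].
  - by apply: starS; exact: (exterior_roots row c0 zr hq).
  - have [/starS|[hpole _]] := interior_roots row hf c0 zr hq (zeros_tending_count hl);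
      by [left|right].
  - have qz := limit_root row qm_size qm_cvg hq.
    by have [/starS|] := boundary_alternative row hf c0 qm_size qm_cvg a_conc zr qz;
      [left|right].
have qm0 := limit_neq0 qm_size.
split; last first.
  by move=> z qz hs zr; exact: (limit_simple_pole row hf qm_size qm_cvg).
pose sing := fun z => `[< singular_point f (disk rho) z >].
exists (seq.filter sing (zeros qm)); split; first exact: filter_uniq.
  have : (size (seq.filter (predC sing) (zeros qm)) <= m - ms)%N.
    apply: (@roots_tend_size _ qstar Lambda); first exact: filter_uniq.
      move=> u; rewrite mem_filter => /andP[/asboolPn nsing]; rewrite -root_zeros// => qu.
      have [h|//] := limit_alternative row hf c0 qm_size qm_cvg a_conc qu.
      by move=> e e0; have [N hN] := h e e0; exists N => n Nn Ln; exact: hN (LS n Ln).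
    move=> N; have [n [Ln /negP]] := infinite_setN0 (infinite_setD Linf (finite_II N)).
    rewrite -leqNgt => Nn; have [mn _] := hL n Ln; have [sq nq] := hqstar n mn.
    by exists n; split=> //; exact: normalized_neq0.
  rewrite !size_filter; have := count_predC sing (zeros qm).
  have := size_zeros qm0; rewrite qm_size => -[<-]; lia.
move=> z; rewrite mem_filter -root_zeros// => /andP[/asboolP hs qz]; by split.
Qed.
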